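(* Let $G\in H^2(\mathbb D)$ and let $A$ be the operator on $H^2(\mathbb D)$ defined by $Af=Gf'$ on the domain $D(A)=\{f\in H^2(\mathbb D): Gf'\in H^2(\mathbb D)\}$. Then $A$ generates a $C_0$-semigroup of composition operators on $H^2(\mathbb D)$ if and only if for all $z\in\mathbb D$, $$2\,\mathrm{Re}(\overline{z}G(z)) + (1-|z|^2)\,\mathrm{Re}(G'(z))\le 0.$$
   Context: $\mathbb D$ is the open unit disc and $H^2(\mathbb D)$ is the Hardy space of analytic functions $f(z)=\sum_{n\ge0}c_nz^n$ on $\mathbb D$ with $\|f\|^2=\sum_{n\ge 0}|c_n|^2<\infty$. A $C_0$-semigroup on a Banach space $X$ is a strongly continuous family $(T(t))_{t\ge0}$ of bounded linear operators with $T(0)=\mathrm{Id}$ and $T(t+s)=T(t)T(s)$. Its generator is $Ax=\lim_{t\downarrow0}(T(t)x-x)/t$, with domain $D(A)$ the set of $x\in X$ for which this limit exists. A semigroup of analytic functions on $\mathbb D$ is a family $(\varphi_t)_{t\ge0}$ of analytic self-maps of $\mathbb D$ such that $\varphi_0(z)=z$, $\varphi_{t+s}=\varphi_t\circ\varphi_s$ for all $s,t\ge0$, and $(t,z)\mapsto\varphi_t(z)$ is continuous on $[0,\infty)\times\mathbb D$. ''$A$ generates a $C_0$-semigroup of composition operators'' means that $A$ (with its domain $D(A)$) is the generator of a $C_0$-semigroup of the form $T(t)=C_{\varphi_t}$, $C_{\varphi_t}f=f\circ\varphi_t$, for some semigroup $(\varphi_t)_{t\ge0}$ of analytic functions on $\mathbb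 D$. *)

(* Defs.v *)
From Stdlib Require Import Arith Reals Lra Lia Psatz.
From Stdlib Require Import ProofIrrelevance FunctionalExtensionality PropExtensionality.
From Coquelicot Require Import Coquelicot.

Open Scope R_scope.

Definition sqmod (c : nat -> C) (n : nat) : R := Cmod (c n) ^ 2.

Lemma sqmod_ge0 c n : 0 <= sqmod c n.
Proof. apply pow2_ge_0. Qed.

Lemma sum_n_S (a : nat -> R) N : sum_n a (S N) = sum_n a N + a (S N).
Proof. rewrite sum_Sn. reflexivity. Qed.

Lemma sum_sqmod_incr c N : sum_n (sqmod c) N <= sum_n (sqmod c) (S N).
Proof. rewrite sum_n_S. generalize (sqmod_ge0 c (S N)). lra. Qed.

Lemma sqmod_bounded c M :
  (forall N, sum_n (sqmod c) N <= M) ->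
  ex_series (sqmod c) /\ Series (sqmod c) <= M.
Proof.
intros H.
destruct (ex_finite_lim_seq_incr (sum_n (sqmod c)) M) as [l Hl].
- apply sum_sqmod_incr.
- exact H.
- assert (Hs : is_series (sqmod c) l) by exact Hl.
  split; [now exists l|].
  rewrite (is_series_unique _ _ Hs).
  exact (is_lim_seq_le (sum_n (sqmod c)) (fun _ => M) l M H Hl
    (is_lim_seq_const M)).
Qed.

Lemma sum_sqmod_le_Series c N :
  ex_series (sqmod c) -> sum_n (sqmod c) N <= Series (sqmod c).
Proof.
intros H.
apply (is_lim_seq_incr_compare (sum_n (sqmod c)) (Series (sqmod c))).
- exact (Series_correct _ H).
- apply sum_sqmod_incr.
Qed.

Lemma Series_sqmod_ge0 c : ex_series (sqmod c) -> 0 <= Series (sqmod c).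
Proof.
intros H. apply Rle_trans with (sum_n (sqmod c) 0).
- rewrite sum_O. apply sqmod_ge0.
- now apply sum_sqmod_le_Series.
Qed.

Lemma sq_le_weighted u v w a b : 0 < a -> 0 < b ->
  0 <= u -> 0 <= v -> 0 <= w -> w <= u + v ->
  w ^ 2 <= (1 + b / a) * u ^ 2 + (1 + a / b) * v ^ 2.
Proof.
intros Ha Hb Hu Hv Hw H.
apply Rle_trans with ((u + v) ^ 2).
- apply pow_incr; lra.
- assert (E : (1 + b / a) * u ^ 2 + (1 + a / b) * v ^ 2 - (u + v) ^ 2
    = (b * u - a * v) ^ 2 / (a * b)) by (field; lra).
  assert (0 <= (b * u - a * v) ^ 2 / (a * b)).
  { apply Rmult_le_pos; [apply pow2_ge_0|].
    apply Rlt_le, Rinv_0_lt_compat. now apply Rmult_lt_0_compat. }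
  lra.
Qed.

Lemma sq_limit x s : 0 <= s ->
  (forall e, 0 < e -> x <= (s + e) ^ 2) -> x <= s ^ 2.
Proof.
intros Hs H. apply le_epsilon. intros e He.
set (d := Rmin 1 (e / (2 * s + 1))).
assert (Hd : 0 < d).
{ apply Rmin_glb_lt; [lra|]. apply Rdiv_lt_0_compat; lra. }
assert (H1 : d <= 1) by apply Rmin_l.
assert (H2 : d * (2 * s + 1) <= e).
{ apply Rle_trans with (e / (2 * s + 1) * (2 * s + 1)).
  - apply Rmult_le_compat_r; [lra|apply Rmin_r].
  - right; field; lra. }
generalize (H d Hd). nra.
Qed.

Lemma sum_sqmod_minkowski (a b c : nat -> C) N s t :
  0 <= s -> 0 <= t ->
  (forall n, Cmod (c n) <= Cmod (a n) + Cmod (b n)) ->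
  sum_n (sqmod a) N <= s ^ 2 -> sum_n (sqmod b) N <= t ^ 2 ->
  sum_n (sqmod c) N <= (s + t) ^ 2.
Proof.
intros Hs Ht Hc Ha Hb.
apply sq_limit; [lra|]. intros e He.
set (x := s + e / 2). set (y := t + e / 2).
assert (Hx : 0 < x) by (unfold x; lra).
assert (Hy : 0 < y) by (unfold y; lra).
assert (Hax : sum_n (sqmod a) N <= x ^ 2).
{ apply Rle_trans with (1 := Ha). apply pow_incr. unfold x; lra. }
assert (Hby : sum_n (sqmod b) N <= y ^ 2).
{ apply Rle_trans with (1 := Hb). apply pow_incr. unfold y; lra. }
assert (H : sum_n (sqmod c) N
  <= (1 + y / x) * sum_n (sqmod a) N + (1 + x / y) * sum_n (sqmod b) N).
{ clear -Hx Hy Hc.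
  assert (P : forall n, sqmod c n
    <= (1 + y / x) * sqmod a n + (1 + x / y) * sqmod b n).
  { intros n. apply sq_le_weighted; trivial; apply Cmod_ge_0. }
  induction N as [|N IH].
  - rewrite !sum_O. apply P.
  - rewrite !sum_n_S. generalize (P (S N)). lra. }
replace (s + t + e) with (x + y) by (unfold x, y; lra).
apply Rle_trans with (1 := H).
replace ((x + y) ^ 2) with ((1 + y / x) * x ^ 2 + (1 + x / y) * y ^ 2)
  by (field; lra).
assert (0 < y / x) by now apply Rdiv_lt_0_compat.
assert (0 < x / y) by now apply Rdiv_lt_0_compat.
apply Rplus_le_compat; apply Rmult_le_compat_l; lra.
Qed.

Lemma sqmod_minkowski (a b c : nat -> C) :
  ex_series (sqmod a) -> ex_series (sqmod b) ->
  (forall n, Cmod (c n) <= Cmod (a n) + Cmod (b n)) ->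
  ex_series (sqmod c) /\
  sqrt (Series (sqmod c)) <= sqrt (Series (sqmod a)) + sqrt (Series (sqmod b)).
Proof.
intros Ha Hb Hc.
set (s := sqrt (Series (sqmod a))). set (t := sqrt (Series (sqmod b))).
assert (Hs : 0 <= s) by apply sqrt_pos.
assert (Ht : 0 <= t) by apply sqrt_pos.
destruct (sqmod_bounded c ((s + t) ^ 2)) as [H1 H2].
- intros N. apply sum_sqmod_minkowski with a b; trivial.
  + unfold s. rewrite pow2_sqrt by now apply Series_sqmod_ge0.
    now apply sum_sqmod_le_Series.
  + unfold t. rewrite pow2_sqrt by now apply Series_sqmod_ge0.
    now apply sum_sqmod_le_Series.
- split; trivial.
  rewrite <- (sqrt_pow2 (s + t)) by lra.
  now apply sqrt_le_1_alt.
Qed.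

(** An element [f(z) = sum c_n z^n] of the Hardy space is stored as the
    sequence of its Taylor coefficients; [H2_fun] is the function itself.  By
    [H2_fun_inj] nothing is lost: [f] is determined by its values on the
    disc. *)

Record H2 : Type := mkH2 {
  coef : nat -> C;
  coef_summable : ex_series (fun n => Cmod (coef n) ^ 2)
}.

Definition disc (z : C) : Prop := Cmod z < 1.

Definition H2_fun (f : H2) (z : C) : C :=
  (Series (fun n => Re (coef f n * z ^ n)%C),
   Series (fun n => Im (coef f n * z ^ n)%C)).

Coercion H2_fun : H2 >-> Funclass.

Definition H2_norm (f : H2) : R := sqrt (Series (fun n => Cmod (coef f n) ^ 2)).

Lemma H2_ext (f g : H2) : (forall n, coef f n = coef g n) -> f = g.
Proof.
destruct f as [c Hc], g as [d Hd]; simpl. intros H.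
assert (E : c = d) by (apply functional_extensionality; exact H).
subst d. f_equal. apply proof_irrelevance.
Qed.

Lemma H2_zero_summable : ex_series (fun _ : nat => Cmod (RtoC 0) ^ 2).
Proof.
apply (fun H => proj1 (sqmod_bounded (fun _ => RtoC 0) 0 H)).
intros N. induction N as [|N IH].
- rewrite sum_O. unfold sqmod. rewrite Cmod_0. simpl; lra.
- rewrite sum_n_S. unfold sqmod at 2. rewrite Cmod_0. simpl; lra.
Qed.

Lemma H2_plus_summable (f g : H2) :
  ex_series (fun n => Cmod (coef f n + coef g n)%C ^ 2).
Proof.
apply (fun H => proj1 (sqmod_minkowski (coef f) (coef g)
  (fun n => (coef f n + coef g n)%C) (coef_summable f) (coef_summable g) H)).
intros n. apply Cmod_triangle.
Qed.

Lemma H2_scal_summable (k : C) (f : H2) :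
  ex_series (fun n => Cmod (k * coef f n)%C ^ 2).
Proof.
apply (ex_series_ext (fun n => Cmod k ^ 2 * Cmod (coef f n) ^ 2)).
- intros n. rewrite Cmod_mult. simpl. ring.
- exact (ex_series_scal_l (Cmod k ^ 2) _ (coef_summable f)).
Qed.

Lemma H2_opp_summable (f : H2) : ex_series (fun n => Cmod (- coef f n)%C ^ 2).
Proof.
apply (ex_series_ext (fun n => Cmod (coef f n) ^ 2)).
- intros n. now rewrite Cmod_opp.
- apply coef_summable.
Qed.

Definition H2_zero : H2 := mkH2 (fun _ => RtoC 0) H2_zero_summable.
Definition H2_plus (f g : H2) : H2 :=
  mkH2 (fun n => (coef f n + coef g n)%C) (H2_plus_summable f g).
Definition H2_opp (f : H2) : H2 :=
  mkH2 (fun n => (- coef f n)%C) (H2_opp_summable f).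
Definition H2_scal (k : C) (f : H2) : H2 :=
  mkH2 (fun n => (k * coef f n)%C) (H2_scal_summable k f).

Definition H2_AbelianMonoid_mixin : AbelianMonoid.mixin_of H2.
Proof.
apply (AbelianMonoid.Mixin H2 H2_plus H2_zero);
  intros; apply H2_ext; intros n; simpl; ring.
Defined.

Canonical H2_AbelianMonoid := AbelianMonoid.Pack H2 H2_AbelianMonoid_mixin H2.

Definition H2_AbelianGroup_mixin : AbelianGroup.mixin_of H2_AbelianMonoid.
Proof.
apply (AbelianGroup.Mixin H2_AbelianMonoid H2_opp).
intros x; apply H2_ext; intros n; simpl; ring.
Defined.

Canonical H2_AbelianGroup := AbelianGroup.Pack H2
  (AbelianGroup.Class H2 H2_AbelianMonoid_mixin H2_AbelianGroup_mixin) H2.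

Definition H2_ModuleSpace_mixin : ModuleSpace.mixin_of C_Ring H2_AbelianGroup.
Proof.
apply (ModuleSpace.Mixin C_Ring H2_AbelianGroup H2_scal);
  intros; apply H2_ext; intros n; simpl; unfold one, mult, plus; simpl; ring.
Defined.

Canonical H2_ModuleSpace := ModuleSpace.Pack C_Ring H2
  (ModuleSpace.Class C_Ring H2 (AbelianGroup.class H2_AbelianGroup)
    H2_ModuleSpace_mixin) H2.

Definition H2_ball (f : H2) (e : R) (g : H2) : Prop := H2_norm (minus g f) < e.

Lemma H2_norm_triangle (f g : H2) :
  H2_norm (plus f g) <= H2_norm f + H2_norm g.
Proof.
apply (sqmod_minkowski (coef f) (coef g) (coef (plus f g))
  (coef_summable f) (coef_summable g)).
intros n. apply Cmod_triangle.
Qed.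

Lemma H2_norm_zero : H2_norm zero = 0.
Proof.
unfold H2_norm. rewrite (Series_ext _ (fun _ => 0 * 0)).
- rewrite Series_scal_l, Rmult_0_l. apply sqrt_0.
- intros n. simpl. rewrite Cmod_0. ring.
Qed.

Lemma H2_norm_opp (f : H2) : H2_norm (opp f) = H2_norm f.
Proof.
unfold H2_norm. f_equal. apply Series_ext. intros n. simpl.
now rewrite Cmod_opp.
Qed.

Lemma H2_norm_scal (k : C) (f : H2) :
  H2_norm (scal k f) = Cmod k * H2_norm f.
Proof.
unfold H2_norm.
rewrite (Series_ext _ (fun n => Cmod k ^ 2 * Cmod (coef f n) ^ 2)).
- rewrite Series_scal_l, sqrt_mult_alt by apply pow2_ge_0.
  now rewrite sqrt_pow2 by apply Cmod_ge_0.
- intros n. simpl. rewrite Cmod_mult. ring.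
Qed.

Lemma Cmod_coef_le_norm (f : H2) n : Cmod (coef f n) <= H2_norm f.
Proof.
rewrite <- (sqrt_pow2 (Cmod (coef f n))) by apply Cmod_ge_0.
apply sqrt_le_1_alt.
apply Rle_trans with (sum_n (sqmod (coef f)) n).
- destruct n as [|n].
  + rewrite sum_O. apply Rle_refl.
  + rewrite sum_n_S. assert (0 <= sum_n (sqmod (coef f)) n).
    { clear. induction n as [|n IH].
      - rewrite sum_O. apply sqmod_ge0.
      - rewrite sum_n_S. generalize (sqmod_ge0 (coef f) (S n)). lra. }
    unfold sqmod in *. lra.
- apply sum_sqmod_le_Series. apply coef_summable.
Qed.

Definition H2_UniformSpace_mixin : UniformSpace.mixin_of H2.
Proof.
apply (UniformSpace.Mixin H2 H2_zero H2_ball); unfold H2_ball.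
- intros x e. rewrite minus_eq_zero.
  apply Rle_lt_trans with 0; [right; exact H2_norm_zero|apply cond_pos].
- intros x y e H. now rewrite <- opp_minus, H2_norm_opp.
- intros x y z e1 e2 H1 H2.
  rewrite (minus_trans y).
  apply Rle_lt_trans with (1 := H2_norm_triangle _ _). lra.
Defined.

Canonical H2_UniformSpace := UniformSpace.Pack H2 H2_UniformSpace_mixin H2.

Canonical H2_NormedModuleAux := NormedModuleAux.Pack C_AbsRing H2
  (NormedModuleAux.Class C_AbsRing H2
    (ModuleSpace.class C_Ring H2_ModuleSpace) H2_UniformSpace_mixin) H2.

Definition H2_NormedModule_mixin :
  NormedModule.mixin_of C_AbsRing H2_NormedModuleAux.
Proof.
apply (NormedModule.Mixin C_AbsRing H2_NormedModuleAux H2_norm 1).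
- exact H2_norm_triangle.
- intros k f. right. exact (H2_norm_scal k f).
- intros x y e H. exact H.
- intros x y e H. rewrite Rmult_1_l. exact H.
- intros f Hf. apply H2_ext. intros n. apply Cmod_eq_0.
  apply Rle_antisym; [|apply Cmod_ge_0].
  rewrite <- Hf. apply Cmod_coef_le_norm.
Defined.

Canonical H2_NormedModule := NormedModule.Pack C_AbsRing H2
  (NormedModule.Class C_AbsRing H2
    (NormedModuleAux.class C_AbsRing H2_NormedModuleAux)
    H2_NormedModule_mixin) H2.

Definition H2_of_seq (c : nat -> C) : H2 :=
  match ex_series_dec (sqmod c) with
  | left H => mkH2 c H
  | right _ => H2_zero
  end.

Definition H2_lim (F : (H2 -> Prop) -> Prop) : H2 :=
  H2_of_seq (fun n =>
    lim (T := C_CompleteNormedModule) (fun P => F (fun f => P (coef f n)))).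

Lemma sum_sqmod_small (c : nat -> C) N e : 0 < e ->
  (forall n, (n <= N)%nat -> Cmod (c n) <= e / INR (S N)) ->
  sum_n (sqmod c) N <= e ^ 2.
Proof.
intros He H.
assert (HN : 1 <= INR (S N)) by (rewrite S_INR; generalize (pos_INR N); lra).
set (d := e / INR (S N)) in *.
assert (Hd : 0 < d) by (apply Rdiv_lt_0_compat; lra).
assert (P : forall k, (k <= N)%nat -> sum_n (sqmod c) k <= INR (S k) * d ^ 2).
{ assert (Q : forall n, (n <= N)%nat -> sqmod c n <= d ^ 2).
  { intros n Hn. apply pow_incr. split; [apply Cmod_ge_0|now apply H]. }
  induction k as [|k IH]; intros Hk.
  - rewrite sum_O. simpl INR. generalize (Q 0%nat Hk). lra.
  - rewrite sum_n_S, (S_INR (S k)).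
    generalize (IH ltac:(lia)) (Q (S k) Hk). lra. }
apply Rle_trans with (1 := P N (le_n N)).
replace (e ^ 2) with (INR (S N) * (INR (S N) * d ^ 2))
  by (unfold d; field; lra).
assert (0 < d ^ 2) by nra. nra.
Qed.

Lemma H2_complete (F : (H2 -> Prop) -> Prop) :
  ProperFilter F -> cauchy F -> forall eps : posreal, F (ball (H2_lim F) eps).
Proof.
intros FF HF.
set (Fn := fun n (P : C -> Prop) => F (fun f => P (coef f n))).
set (l := fun n => lim (T := C_CompleteNormedModule) (Fn n)).
assert (Hsub : forall (f g : H2) n,
  Cmod (coef g n - coef f n)%C <= H2_norm (minus g f)).
{ intros f g n. exact (Cmod_coef_le_norm (minus g f) n). }
assert (PFn : forall n, ProperFilter (Fn n)).
{ intros n. split.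
  - intros P HP. destruct (filter_ex (F := F) _ HP) as [f Hf]. now exists (coef f n).
  - split.
    + exact (filter_true (F := F)).
    + intros P Q HP HQ. exact (filter_and (F := F) _ _ HP HQ).
    + intros P Q HPQ. apply (filter_imp (F := F)). intros f. apply HPQ. }
assert (CFn : forall n, cauchy (T := C_CompleteNormedModule) (Fn n)).
{ intros n e. destruct (HF e) as [f Hf]. exists (coef f n).
  apply (filter_imp (F := F)) with (2 := Hf). intros g Hg.
  apply C_NormedModule_mixin_compat1.
  apply Rle_lt_trans with (1 := Hsub f g n). exact Hg. }
assert (Hl : forall n (e : posreal),
  F (fun f => Cmod (l n - coef f n)%C < e)).
{ intros n e.
  assert (He : 0 < e / 2) by (generalize (cond_pos e); lra).
  assert (K := complete_cauchy (T := C_CompleteNormedModule)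
    (Fn n) (PFn n) (CFn n) (mkposreal _ He)).
  change (F (fun f => ball (l n) (mkposreal _ He) (coef f n))) in K.
  revert K. apply (filter_imp (F := F)). intros f Hf.
  apply (C_NormedModule_mixin_compat2 (l n) (coef f n) (mkposreal _ He)) in Hf.
  assert (E : Cmod (l n - coef f n)%C = Cmod (minus (coef f n) (l n))).
  { rewrite <- Cmod_opp. f_equal. unfold minus, plus, opp; simpl.
    change ((- (l n - coef f n))%C = (coef f n + - l n)%C). ring. }
  rewrite E. apply Rlt_trans with (1 := Hf). simpl.
  assert (sqrt 2 < 2).
  { rewrite <- (sqrt_pow2 2) at 2 by lra. apply sqrt_lt_1; lra. }
  nra. }
assert (Hdist : forall (x : H2) e, 0 < e -> F (ball x e) -> forall N,
  sum_n (sqmod (fun n => (l n - coef x n)%C)) N <= e ^ 2).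
{ intros x e He Hx N. apply sq_limit; [lra|]. intros d Hd.
  assert (HN : 0 < d / INR (S N)).
  { apply Rdiv_lt_0_compat; trivial. apply lt_0_INR. lia. }
  assert (HFN : forall k, F (fun f => forall n, (n <= k)%nat ->
    Cmod (l n - coef f n)%C < d / INR (S N))).
  { induction k as [|k IH].
    - generalize (Hl 0%nat (mkposreal _ HN)). apply filter_imp.
      intros f Hf n Hn. replace n with 0%nat by lia. exact Hf.
    - generalize (filter_and _ _ IH (Hl (S k) (mkposreal _ HN))).
      apply filter_imp. intros f [H1 H2] n Hn.
      destruct (Nat.eq_dec n (S k)) as [->|]; [exact H2|apply H1; lia]. }
  destruct (filter_ex _ (filter_and _ _ Hx (HFN N))) as [f [H1 H2]].
  apply (sum_sqmod_minkowski (fun n => (coef f n - coef x n)%C)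
    (fun n => (l n - coef f n)%C)); try lra.
  - intros n.
    replace (l n - coef x n)%C
      with ((coef f n - coef x n) + (l n - coef f n))%C by ring.
    apply Cmod_triangle.
  - assert (H3 : H2_norm (minus f x) < e) by exact H1.
    apply Rle_trans with (Series (sqmod (coef (minus f x)))).
    + exact (sum_sqmod_le_Series _ N (coef_summable (minus f x))).
    + rewrite <- (pow2_sqrt (Series _))
        by (apply Series_sqmod_ge0; apply coef_summable).
      apply pow_incr. split; [apply sqrt_pos|]. apply Rlt_le. exact H3.
  - apply sum_sqmod_small; trivial. intros n Hn. now apply Rlt_le, H2. }
assert (Hsum : ex_series (sqmod l)).
{ destruct (HF (mkposreal 1 Rlt_0_1)) as [x Hx].
  apply (sqmod_minkowski (fun n => (l n - coef x n)%C) (coef x)).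
  - apply (fun H => proj1 (sqmod_bounded _ _ H)) with (1 := Hdist x 1 Rlt_0_1 Hx).
  - apply coef_summable.
  - intros n. replace (l n) with ((l n - coef x n) + coef x n)%C at 1 by ring.
    apply Cmod_triangle. }
assert (El : coef (H2_lim F) = l).
{ unfold H2_lim, H2_of_seq.   change (coef (match ex_series_dec (sqmod l) with
    | left H => mkH2 l H | right _ => H2_zero end) = l).
  destruct (ex_series_dec (sqmod l)); [reflexivity|contradiction]. }
intros eps.
assert (He : 0 < eps / 2) by (generalize (cond_pos eps); lra).
destruct (HF (mkposreal _ He)) as [x Hx].
apply filter_imp with (2 := Hx). intros g Hg.
change (H2_norm (minus g (H2_lim F)) < eps).
rewrite (minus_trans x).
apply Rle_lt_trans with (1 := H2_norm_triangle _ _).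
assert (H1 : H2_norm (minus g x) < eps / 2) by exact Hg.
assert (H2 : H2_norm (minus x (H2_lim F)) <= eps / 2).
{ rewrite <- opp_minus, H2_norm_opp. unfold H2_norm.
  rewrite <- (sqrt_pow2 (eps / 2)) by lra. apply sqrt_le_1_alt.
  apply (fun H => proj2 (sqmod_bounded _ _ H)).
  intros N. generalize (Hdist x (eps / 2) He Hx N).
  rewrite <- El. intros H. exact H. }
lra.
Qed.

Lemma H2_close_lim (F1 F2 : (H2 -> Prop) -> Prop) :
  filter_le F1 F2 -> filter_le F2 F1 -> close (H2_lim F1) (H2_lim F2).
Proof.
intros H12 H21.
replace F2 with F1; [apply close_refl|].
apply functional_extensionality. intros P. apply propositional_extensionality.
split; [apply H21|apply H12].
Qed.

Definition H2_CompleteSpace_mixin : CompleteSpace.mixin_of H2_UniformSpace :=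
  CompleteSpace.Mixin H2_UniformSpace H2_lim H2_complete H2_close_lim.

Canonical H2_CompleteSpace := CompleteSpace.Pack H2
  (CompleteSpace.Class H2 H2_UniformSpace_mixin H2_CompleteSpace_mixin) H2.

Canonical H2_CompleteNormedModule := CompleteNormedModule.Pack C_AbsRing H2
  (CompleteNormedModule.Class C_AbsRing H2
    (NormedModule.class C_AbsRing H2_NormedModule)
    H2_CompleteSpace_mixin) H2.

Lemma ex_series_Cmod_H2 (f : H2) r : 0 <= r < 1 ->
  ex_series (fun n => Cmod (coef f n) * r ^ n).
Proof.
intros Hr.
apply (ex_series_le (V := R_CompleteNormedModule) _
  (fun n => Cmod (coef f n) ^ 2 + (r ^ 2) ^ n)).
- intros n. change (Rabs (Cmod (coef f n) * r ^ n)
    <= Cmod (coef f n) ^ 2 + (r ^ 2) ^ n).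
  assert (H1 := Cmod_ge_0 (coef f n)). assert (H2 := pow_le r n (proj1 Hr)).
  rewrite Rabs_pos_eq by now apply Rmult_le_pos.
  rewrite <- pow_mult, Nat.mul_comm, pow_mult. nra.
- apply (ex_series_plus (V := R_NormedModule)).
  + apply coef_summable.
  + apply ex_series_geom. rewrite Rabs_pos_eq; nra.
Qed.

Lemma is_series_C (a : nat -> C) (x y : R) :
  is_series (fun n => Re (a n)) x -> is_series (fun n => Im (a n)) y ->
  is_series a ((x, y) : C).
Proof.
intros Hx Hy.
apply (filterlim_ext (fun N => (sum_n (fun n => Re (a n)) N,
  sum_n (fun n => Im (a n)) N) : C)).
- intros N. induction N as [|N IH].
  + rewrite !sum_O. now destruct (a 0%nat).
  + rewrite !sum_Sn, <- IH. reflexivity.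
- apply filterlim_locally. intros e.
  generalize (filter_and _ _ (proj1 (filterlim_locally _ _) Hx e)
    (proj1 (filterlim_locally _ _) Hy e)).
  apply filter_imp. intros N [H1 H2]. now split.
Qed.

Lemma H2_fun_correct (f : H2) (z : C) : disc z ->
  is_series (fun n => (coef f n * z ^ n)%C) (f z).
Proof.
intros Hz.
assert (E := ex_series_Cmod_H2 f (Cmod z) (conj (Cmod_ge_0 z) Hz)).
apply is_series_C; apply Series_correct;
  apply (ex_series_le (V := R_CompleteNormedModule) _ _) with (2 := E);
  intros n; rewrite <- Cmod_pow, <- Cmod_mult.
- apply re_le_Cmod.
- apply Rle_trans with (2 := Rmax_Cmod _). apply Rmax_r.
Qed.

Lemma H2_fun_inj (f g : H2) : (forall z, disc z -> f z = g z) -> f = g.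
Proof.
intros Hfg. apply H2_ext.
set (h := minus f g).
assert (Hh : forall r, 0 < r < 1 ->
  is_series (fun n => (coef h n * RtoC (r ^ n))%C) (RtoC 0)).
{ intros r Hr. assert (Hz : disc (RtoC r)).
  { unfold disc. rewrite Cmod_R, Rabs_pos_eq; lra. }
  assert (K := is_series_minus _ _ _ _ (H2_fun_correct f _ Hz)
    (H2_fun_correct g _ Hz)).
  rewrite (Hfg _ Hz) in K.
  replace (RtoC 0) with (plus (g (RtoC r) : C_NormedModule) (opp (g (RtoC r))))
    by exact (plus_opp_r (g (RtoC r) : C_NormedModule)).
  apply is_series_ext with (2 := K). intros n.
  rewrite RtoC_pow.
  change ((coef f n * RtoC r ^ n + - (coef g n * RtoC r ^ n))%C
    = ((coef f n + - coef g n) * RtoC r ^ n)%C). ring. }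
assert (H0 : forall n, coef h n = RtoC 0).
{ intros n. induction n as [n IH] using lt_wf_ind.
  set (b := fun k => coef h (n + k)%nat).
  assert (Hb : forall r, 0 < r < 1 ->
    is_series (fun k => (b k * RtoC (r ^ k))%C) (RtoC 0)).
  { intros r Hr.
    assert (K : is_series (fun k => (coef h (n + k) * RtoC (r ^ (n + k)))%C)
      (RtoC 0)).
    { destruct n as [|n]; [exact (Hh r Hr)|].
      apply (is_series_incr_n (V := C_NormedModule)
        (fun k => (coef h k * RtoC (r ^ k))%C) (S n)); [lia|].
      refine (eq_ind_r (fun l : C_NormedModule => is_series
        (fun k => (coef h k * RtoC (r ^ k))%C : C_NormedModule) l) (Hh r Hr) _).
      rewrite (sum_n_ext_loc _ (fun _ => zero : C_NormedModule)).
      - unfold sum_n. rewrite sum_n_m_const_zero.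
        exact (plus_zero_r (RtoC 0 : C_NormedModule)).
      - intros k Hk. rewrite IH by (simpl in Hk; lia).
        exact (Cmult_0_l _). }
    assert (Hrn : RtoC (r ^ n) <> RtoC 0).
    { intros E. apply RtoC_inj in E. revert E. apply pow_nonzero. lra. }
    assert (K2 := is_series_scal (/ RtoC (r ^ n))%C _ _ K).
    assert (K3 := eq_ind _ (fun l : C_NormedModule => is_series _ l) K2 (RtoC 0)
      (Cmult_0_r _)).
    apply is_series_ext with (2 := K3). intros k. unfold b.
    change ((/ RtoC (r ^ n) * (coef h (n + k) * RtoC (r ^ (n + k))))%C
      = (coef h (n + k) * RtoC (r ^ k))%C).
    rewrite pow_add, RtoC_mult. field. exact Hrn. }
  replace (coef h n) with (b 0%nat) by (unfold b; now rewrite Nat.add_0_r).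
  assert (Hbd : ex_series (fun k => Cmod (b (S k)) * (1 / 2) ^ k)).
  { assert (K := ex_series_Cmod_H2 h (1 / 2) ltac:(lra)).
    apply (ex_series_incr_n _ (n + 1)) in K.
    apply (ex_series_scal_l (2 ^ (n + 1))) in K.
    apply ex_series_ext with (2 := K). intros k. unfold b.
    replace (n + 1 + k)%nat with (n + S k)%nat by lia.
    replace (n + S k)%nat with ((n + 1) + k)%nat at 2 by lia.
    rewrite (pow_add (1 / 2)). unfold Rdiv. rewrite !Rmult_1_l, !pow_inv.
    change ((2 ^ (n + 1) * (Cmod (coef h (n + S k))
      * (/ 2 ^ (n + 1) * / 2 ^ k)))
      = Cmod (coef h (n + S k)) * / 2 ^ k).
    field. split; apply pow_nonzero; lra. }
  set (M := Series (fun k => Cmod (b (S k)) * (1 / 2) ^ k)).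
  assert (HM : 0 <= M).
  { apply Rle_trans with (Series (fun _ : nat => 0 * 0)).
    - rewrite Series_scal_l. lra.
    - apply Series_le; trivial. intros k. split; [lra|].
      rewrite Rmult_0_l. apply Rmult_le_pos; [apply Cmod_ge_0|apply pow_le; lra]. }
  assert (Hr : forall r, 0 < r <= 1 / 2 -> Cmod (b 0%nat) <= r * M).
  { intros r Hr.
    assert (K := Hb r ltac:(lra)).
    assert (P : forall N, Cmod (sum_n (fun k => (b k * RtoC (r ^ k))%C) N
        - b 0%nat)%C <= r * M).
    { assert (Q : forall N,
        Cmod (sum_n (fun k => (b k * RtoC (r ^ k))%C) (S N) - b 0%nat)%C
        <= r * sum_n (fun k => Cmod (b (S k)) * (1 / 2) ^ k) N).
      { assert (Q1 : forall k, Cmod (b (S k) * RtoC (r ^ S k))%C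
          <= r * (Cmod (b (S k)) * (1 / 2) ^ k)).
        { intros k. rewrite Cmod_mult, Cmod_R, Rabs_pos_eq by (apply pow_le; lra).
          assert (r ^ k <= (1 / 2) ^ k) by (apply pow_incr; lra).
          generalize (Cmod_ge_0 (b (S k))). intros Hc.
          simpl pow at 1.
          replace (r * (Cmod (b (S k)) * (1 / 2) ^ k))
            with (Cmod (b (S k)) * (r * (1 / 2) ^ k)) by ring.
          apply Rmult_le_compat_l; trivial.
          apply Rmult_le_compat_l; lra. }
        induction N as [|N IHN].
        - rewrite sum_Sn, !sum_O.
          change (Cmod (b 0%nat * RtoC 1 + b 1%nat * RtoC (r ^ 1) - b 0%nat)%C
            <= r * (Cmod (b 1%nat) * (1 / 2) ^ 0)).
          replace (b 0%nat * RtoC 1 + b 1%nat * RtoC (r ^ 1) - b 0%nat)%C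
            with (b 1%nat * RtoC (r ^ 1))%C by ring.
          apply Q1.
        - rewrite sum_Sn, sum_n_S.
          set (S' := sum_n (fun k => (b k * RtoC (r ^ k))%C) (S N)) in *.
          change (Cmod (S' + b (S (S N)) * RtoC (r ^ S (S N)) - b 0%nat)%C
            <= r * (sum_n (fun k => Cmod (b (S k)) * (1 / 2) ^ k) N
               + Cmod (b (S (S N))) * (1 / 2) ^ S N)).
          replace (S' + b (S (S N)) * RtoC (r ^ S (S N)) - b 0%nat)%C
            with ((S' - b 0%nat) + b (S (S N)) * RtoC (r ^ S (S N)))%C by ring.
          apply Rle_trans with (1 := Cmod_triangle _ _).
          generalize (Q1 (S N)). lra. }
      intros [|N].
      - rewrite sum_O.
        replace (b 0%nat * RtoC (r ^ 0) - b 0%nat)%C with (RtoC 0)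
          by (simpl; ring).
        rewrite Cmod_0. nra.
      - apply Rle_trans with (1 := Q N). apply Rmult_le_compat_l; [lra|].
        apply (is_lim_seq_incr_compare
          (sum_n (fun k => Cmod (b (S k)) * (1 / 2) ^ k)) M).
        + exact (Series_correct _ Hbd).
        + intros m. rewrite sum_n_S.
          assert (0 <= Cmod (b (S (S m))) * (1 / 2) ^ S m); [|lra].
          apply Rmult_le_pos; [apply Cmod_ge_0|apply pow_le; lra]. }
    apply le_epsilon. intros e He.
    assert (He2 : 0 < e / 2) by lra.
    destruct (filter_ex (F := eventually) _
      (proj1 (filterlim_locally _ _) K (mkposreal _ He2))) as [N HN].
    apply (C_NormedModule_mixin_compat2 (RtoC 0) _ (mkposreal _ He2)) in HN.
    simpl pos in HN.
    set (s := sum_n (fun k => (b k * RtoC (r ^ k))%C) N) in *.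
    assert (E : Cmod s < sqrt 2 * (e / 2)).
    { apply Rle_lt_trans with (2 := HN). right. f_equal. symmetry.
      exact (minus_zero_r (s : C_NormedModule)). }
    assert (sqrt 2 < 2).
    { rewrite <- (sqrt_pow2 2) at 2 by lra. apply sqrt_lt_1; lra. }
    replace (b 0%nat) with (s + - (s - b 0%nat))%C by ring.
    apply Rle_trans with (1 := Cmod_triangle _ _).
    rewrite Cmod_opp. generalize (P N). fold s. nra. }
  apply Cmod_eq_0, Rle_antisym; [|apply Cmod_ge_0].
  apply le_epsilon. intros e He. rewrite Rplus_0_l.
  set (r := Rmin (1 / 2) (e / (M + 1))).
  assert (Hr0 : 0 < r).
  { apply Rmin_glb_lt; [lra|]. apply Rdiv_lt_0_compat; lra. }
  assert (Hr1 : r <= 1 / 2) by apply Rmin_l.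
  assert (Hr2 : r * (M + 1) <= e).
  { apply Rle_trans with (e / (M + 1) * (M + 1)).
    - apply Rmult_le_compat_r; [lra|apply Rmin_r].
    - right; field; lra. }
  generalize (Hr r ltac:(lra)). nra. }
intros n. specialize (H0 n). unfold h in H0.
change ((coef f n + - coef g n)%C = RtoC 0) in H0.
replace (coef f n) with ((coef f n + - coef g n) + coef g n)%C by ring.
rewrite H0. ring.
Qed.

(** [T t] is only meaningful for [0 <= t].  Boundedness of [T t] is part of
    [is_linear]. *)
Record C0_semigroup {X : CompleteNormedModule C_AbsRing} (T : R -> X -> X) :
  Prop := {
  C0_bounded_linear : forall t, 0 <= t -> is_linear (T t);
  C0_zero : forall x, T 0 x = x;
  C0_plus : forall s t x, 0 <= s -> 0 <= t -> T (t + s) x = T t (T s x);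
  C0_continuous : forall t x, 0 <= t ->
    filterlim (fun s => T s x) (within (fun s => 0 <= s) (locally t))
      (locally (T t x))
}.

(** An unbounded operator [A] with domain [D(A)] is given by its graph:
    [A x y] means that [x] is in [D(A)] and [A x = y]. *)
Definition operator (X : Type) : Type := X -> X -> Prop.

Definition is_generator {X : CompleteNormedModule C_AbsRing}
    (A : operator X) (T : R -> X -> X) : Prop :=
  forall x y : X, A x y <->
    filterlim (fun t : R => scal (RtoC (/ t)) (minus (T t x) x))
      (at_right 0) (locally y).

Record analytic_semigroup (phi : R -> C -> C) : Prop := {
  semi_disc : forall t z, 0 <= t -> disc z -> disc (phi t z);
  semi_analytic : forall t z, 0 <= t -> disc z ->
    ex_derive (K := C_AbsRing) (V := C_NormedModule) (phi t) z;
  semi_zero : forall z, disc z -> phi 0 z = z;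
  semi_plus : forall s t z, 0 <= s -> 0 <= t -> disc z ->
    phi (t + s) z = phi t (phi s z);
  semi_continuous : forall t z, 0 <= t -> disc z ->
    filterlim (fun p : R * C => phi (fst p) (snd p))
      (within (fun p : R * C => 0 <= fst p /\ disc (snd p)) (locally (t, z)))
      (locally (phi t z))
}.

Definition generates_composition_C0_semigroup (A : operator H2) : Prop :=
  exists (phi : R -> C -> C) (T : R -> H2 -> H2),
    analytic_semigroup phi /\
    C0_semigroup T /\
    (forall t (f : H2) z, 0 <= t -> disc z -> T t f z = f (phi t z)) /\
    is_generator A T.

(** Graph of [f |-> G f'] with domain [{f in H2 | G f' in H2}]: the element [g]
    is unique by [H2_fun_inj].  Coquelicot's [C_derive] is a total function that
    takes the limit of difference quotients along real increments; it is the
    complex derivative wherever the latter exists ([C_derive_correct]), hence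
    everywhere on the disc for [f] in [H2]. *)
Definition mult_derive (G : H2) : operator H2 :=
  fun f g => forall z, disc z -> g z = (G z * C_derive f z)%C.

(* Main.v *)
(** The inequality says that the flow of [G] contracts the hyperbolic metric infinitesimally.

    Necessity.  The function [z] belongs to the domain and is mapped to [G], so
    [phi_t(z) = z + t G(z) + o(t)] in [H2], hence also for values and derivatives at a point.
    Inserting this in the Schwarz-Pick inequality
    [|phi_t'(w)| (1 - |w|^2)^2 <= |1 - conj w phi_t(w)|^2], an equality at [t = 0], and comparing
    the terms of order [t] gives the condition.

    Sufficiency.  Along rays the condition integrates to
    [Re (conj z G(z)) <= (1 - |z|^2) Re (conj z G(0))].  Hence [1 - |u|^2] decays at most
    exponentially along solutions of [u' = G(u)], which therefore exist for all positive times and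
    form a semigroup of analytic maps; the derivative in the initial value solves the linearized
    equation.  Littlewood's subordination principle bounds the composition operators with constants
    that tend to [1] as [t] tends to [0], and weak convergence together with convergence of norms
    gives strong continuity.  If [y = G x'] then [x(phi_t z)] has time derivative [y(phi_t z)], so
    [|T_t x - x - t y| <= t sup_(s <= t) |T_s y - y|], which identifies the generator on its maximal
    domain. *)

Require Import Defs.
From Stdlib Require Import Arith Reals Lra Lia Psatz ClassicalChoice.
From Coquelicot Require Import Coquelicot.

Open Scope R_scope.

(** * Curves in the plane and their integrals *)

(** The estimates for holomorphic functions are uniform only on discs |z| <= r with r < 1, while the
    conclusions are in norm. A pointwise bound on the circle |z| = 1/2 controls each coefficient,
    hence finitely many at a time. The passage to the norm is made by [radon_riesz] for strong
    continuity, which requires operator bounds tending to 1, and by a bound free of N in the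
    seminorms [l2 N] for the generator. Littlewood's constant (1 + |phi_t(0)|)/(1 - |phi_t(0)|) is
    Harnack's constant at phi_t(0) for a harmonic majorant, and phi_t(0) tends to 0.

    Global solutions come from a globally Lipschitz field that agrees with G on |z| <= rho and keeps
    the lower bound for 1 - |u|^2 on the whole plane. The bound then shows that the solution stays
    in |z| <= rho up to time T, for rho chosen in terms of T.

    The stated form of Schwarz-Pick results from conjugating with automorphisms centred at the same
    point on both sides. It rests on |f'(0)| <= 1 for self-maps that may move the origin, and it
    agrees with the classical inequality to first order at the identity. *)

(** Cutting [0, t] into n equal pieces leaves a total quadratic error K t^2 / n, which vanishes as n
    grows. This stands in for differentiation followed by integration where only increments are
    controlled. *)
Lemma chain_bound (d : R -> R -> R) t m K : 0 <= t -> 0 <= K ->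
  (forall a b c, 0 <= a <= b -> b <= c <= t -> d a c <= d a b + d b c) ->
  (forall a b, 0 <= a <= b -> b <= t -> d a b <= m * (b - a) + K * (b - a) ^ 2) ->
  d 0 t <= m * t.
Proof.
intros Ht HK Htri Hd.
assert (H : forall n, d 0 t <= m * t + K * t ^ 2 * / INR (S n)).
{ intros n.
  assert (Hn : 0 < INR (S n)) by (apply lt_0_INR; lia).
  set (h := t / INR (S n)).
  assert (Eh : INR (S n) * h = t) by (unfold h; field; lra).
  assert (Hh : 0 <= h).
  { apply Rmult_le_pos; [lra|]. apply Rlt_le, Rinv_0_lt_compat; lra. }
  assert (P : forall k, (1 <= k <= S n)%nat ->
    d 0 (INR k * h) <= INR k * (m * h + K * h ^ 2)).
  { induction k as [|k IH]; intros Hk; [lia|].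
    assert (Hk1 : INR (S k) * h <= t).
    { rewrite <- Eh. apply Rmult_le_compat_r; trivial. apply le_INR. lia. }
    assert (Hk0 : 0 <= INR k * h) by (apply Rmult_le_pos; [apply pos_INR|trivial]).
    assert (Hs : INR (S k) * h = INR k * h + h) by (rewrite S_INR; ring).
    assert (Q : d (INR k * h) (INR (S k) * h) <= m * h + K * h ^ 2).
    { apply Rle_trans with (1 := Hd (INR k * h) (INR (S k) * h) ltac:(lra) Hk1).
      rewrite Hs. right; ring. }
    destruct (Nat.eq_dec k 0) as [->|Hk'].
    - replace (INR 0 * h) with 0 in Q by (simpl; ring).
      replace (INR 1) with 1 in * by reflexivity. lra.
    - apply Rle_trans with (1 := Htri 0 (INR k * h) (INR (S k) * h) ltac:(lra) ltac:(lra)).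
      generalize (IH ltac:(lia)). rewrite (S_INR k) at 2. lra. }
  generalize (P (S n) ltac:(lia)). rewrite Eh.
  intros Q. apply Rle_trans with (1 := Q). right. unfold h. field. lra. }
apply le_epsilon. intros e He.
destruct (archimed_cor1 (e / (K * t ^ 2 + 1))) as [N [HN1 HN2]].
{ apply Rdiv_lt_0_compat; nra. }
destruct N as [|N]; [lia|].
apply Rle_trans with (1 := H N).
assert (HK2 : 0 <= K * t ^ 2) by (apply Rmult_le_pos; [trivial|apply pow2_ge_0]).
assert (HN0 : 0 < / INR (S N)) by (apply Rinv_0_lt_compat, lt_0_INR; lia).
assert (E : e / (K * t ^ 2 + 1) * (K * t ^ 2 + 1) = e) by (field; lra).
nra.
Qed.

Lemma Cmod_minus_sym (a b : C) : Cmod (a - b) = Cmod (b - a).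
Proof. rewrite <- Cmod_opp. f_equal. ring. Qed.

Lemma Cmod_triangle_inv (a b : C) : Cmod a - Cmod b <= Cmod (a - b).
Proof.
assert (H := Cmod_triangle (a - b) b).
replace (a - b + b)%C with a in H by ring. lra.
Qed.

Lemma Cmod_minus_le (a b : C) : Cmod (a - b) <= Cmod a + Cmod b.
Proof. rewrite <- (Cmod_opp b). apply Cmod_triangle. Qed.

Lemma Cmod_le_ReIm (z : C) : Cmod z <= Rabs (Re z) + Rabs (Im z).
Proof.
assert (0 <= Rabs (Re z)) by apply Rabs_pos.
assert (0 <= Rabs (Im z)) by apply Rabs_pos.
apply Rsqr_incr_0_var; [|lra].
rewrite !Rsqr_pow2, Cmod2_alt.
rewrite <- (pow2_abs (Re z)), <- (pow2_abs (Im z)). nra.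
Qed.

Lemma im_le_Cmod (z : C) : Rabs (Im z) <= Cmod z.
Proof. apply Rle_trans with (2 := Rmax_Cmod z). apply Rmax_r. Qed.

Lemma Re_le_Cmod (z : C) : Re z <= Cmod z.
Proof. apply Rle_trans with (1 := Rle_abs _). apply re_le_Cmod. Qed.

Lemma Cmod_le_sq (z : C) m : 0 <= m -> Cmod z ^ 2 <= m ^ 2 -> Cmod z <= m.
Proof.
intros Hm H. apply Rsqr_incr_0_var; trivial. rewrite !Rsqr_pow2. exact H.
Qed.

Lemma eq_of_Cmod_le_eps (a b : C) :
  (forall e, 0 < e -> Cmod (a - b) <= e) -> a = b.
Proof.
intros H. replace a with (a - b + b)%C by ring.
replace (a - b)%C with (RtoC 0); [ring|].
symmetry. apply Cmod_eq_0, Rle_antisym; [|apply Cmod_ge_0].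
apply le_epsilon. intros e He. rewrite Rplus_0_l. now apply H.
Qed.

Lemma is_derive_iff_eps (f : R -> R) (x l : R) :
  is_derive f x l <-> forall eps : posreal,
    locally x (fun y => Rabs (f y - f x - l * (y - x)) <= eps * Rabs (y - x)).
Proof.
split.
- intros [_ H] eps.
  generalize (H x (fun P HP => HP) eps). apply filter_imp. intros y Hy.
  unfold minus, plus, opp, scal, norm in Hy; simpl in Hy.
  unfold mult, abs in Hy; simpl in Hy.
  replace (f y - f x - l * (y - x))
    with (f y + - f x + - ((y + - x) * l)) by ring. exact Hy.
- intros H. split; [apply is_linear_scal_l|].
  intros z Hz.
  apply (is_filter_lim_locally_unique (V := R_NormedModule)) in Hz. subst z.
  intros eps. generalize (H eps). apply filter_imp. intros y Hy.
  unfold minus, plus, opp, scal, norm; simpl.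
  unfold mult, abs; simpl.
  replace (f y + - f x + - ((y + - x) * l)) with
    (f y - f x - l * (y - x)) by ring. exact Hy.
Qed.

(** Componentwise, so that the real rules for derivatives and integrals apply; [Cder_iff_eps]
    returns to the modulus. *)
Definition Cder (u : R -> C) (t : R) (l : C) : Prop :=
  is_derive (fun s => Re (u s)) t (Re l) /\
  is_derive (fun s => Im (u s)) t (Im l).

Lemma Cder_iff_eps u t l : Cder u t l <-> forall eps : posreal,
  locally t (fun y => Cmod (u y - u t - l * RtoC (y - t)) <= eps * Rabs (y - t)).
Proof.
unfold Cder. rewrite !is_derive_iff_eps. split.
- intros [H1 H2] eps.
  assert (He : 0 < eps / 2) by (generalize (cond_pos eps); lra).
  generalize (filter_and _ _ (H1 (mkposreal _ He)) (H2 (mkposreal _ He))).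
  apply filter_imp. simpl. intros y [K1 K2].
  apply Rle_trans with (1 := Cmod_le_ReIm _).
  replace (Re (u y - u t - l * RtoC (y - t))%C)
    with (Re (u y) - Re (u t) - Re l * (y - t)) by (simpl; unfold Re, Im; ring).
  replace (Im (u y - u t - l * RtoC (y - t))%C)
    with (Im (u y) - Im (u t) - Im l * (y - t)) by (simpl; unfold Re, Im; ring).
  lra.
- intros H. split; intros eps; generalize (H eps); apply filter_imp; intros y Hy.
  + apply Rle_trans with (2 := Hy).
    apply Rle_trans with (2 := re_le_Cmod _). right. f_equal.
    simpl; unfold Re, Im; ring.
  + apply Rle_trans with (2 := Hy).
    apply Rle_trans with (2 := im_le_Cmod _). right. f_equal.
    simpl; unfold Re, Im; ring.
Qed.

Definition Ccont (u : R -> C) (t : R) : Prop :=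
  continuous (fun s => Re (u s)) t /\ continuous (fun s => Im (u s)) t.

Lemma Cder_cont u t l : Cder u t l -> Ccont u t.
Proof.
intros [H1 H2]. split; apply (ex_derive_continuous (V := R_NormedModule));
  eexists; eassumption.
Qed.

Lemma Cder_const (c : C) t : Cder (fun _ => c) t 0.
Proof. split; apply (is_derive_const (V := R_NormedModule)). Qed.

Lemma Cder_plus u v t k l :
  Cder u t k -> Cder v t l -> Cder (fun s => u s + v s)%C t (k + l)%C.
Proof.
intros [H1 H2] [H3 H4].
split; apply (is_derive_plus (V := R_NormedModule)); assumption.
Qed.

Lemma Cder_opp u t k : Cder u t k -> Cder (fun s => - u s)%C t (- k)%C.
Proof.
intros [H1 H2].
split; apply (is_derive_opp (V := R_NormedModule)); assumption.
Qed.

Lemma Cder_minus u v t k l :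
  Cder u t k -> Cder v t l -> Cder (fun s => u s - v s)%C t (k - l)%C.
Proof. intros Hu Hv. apply Cder_plus; [exact Hu|]. now apply Cder_opp. Qed.

Lemma Cder_mult u v t k l : Cder u t k -> Cder v t l ->
  Cder (fun s => u s * v s)%C t (k * v t + u t * l)%C.
Proof.
intros [H1 H2] [H3 H4]. split.
- replace (Re (k * v t + u t * l)%C)
    with ((Re k * Re (v t) + Re (u t) * Re l)
      - (Im k * Im (v t) + Im (u t) * Im l))
    by (simpl; unfold Re, Im; ring).
  apply (is_derive_minus (V := R_NormedModule));
    apply (is_derive_mult (K := R_AbsRing)); trivial; intros; apply Rmult_comm.
- replace (Im (k * v t + u t * l)%C)
    with ((Re k * Im (v t) + Re (u t) * Im l)
      + (Im k * Re (v t) + Im (u t) * Re l))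
    by (simpl; unfold Re, Im; ring).
  apply (is_derive_plus (V := R_NormedModule));
    apply (is_derive_mult (K := R_AbsRing)); trivial; intros; apply Rmult_comm.
Qed.

Lemma Cder_ext_loc u v t l : locally t (fun s => u s = v s) ->
  Cder u t l -> Cder v t l.
Proof.
intros H [H1 H2]. split.
- apply (is_derive_ext_loc (fun s => Re (u s))); trivial.
  revert H. apply filter_imp. now intros s ->.
- apply (is_derive_ext_loc (fun s => Im (u s))); trivial.
  revert H. apply filter_imp. now intros s ->.
Qed.

Lemma is_derive_Cmod2 u t l : Cder u t l ->
  is_derive (fun s => Cmod (u s) ^ 2) t (2 * Re (Cconj (u t) * l)%C).
Proof.
intros [H1 H2].
apply (is_derive_ext (fun s => Re (u s) * Re (u s) + Im (u s) * Im (u s))).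
{ intros s. assert (E := Cmod2_alt (u s)). simpl in *. lra. }
replace (2 * Re (Cconj (u t) * l)%C)
  with ((Re l * Re (u t) + Re (u t) * Re l) + (Im l * Im (u t) + Im (u t) * Im l))
  by (simpl; unfold Re, Im; ring).
apply (is_derive_plus (V := R_NormedModule));
  apply (is_derive_mult (K := R_AbsRing)); trivial; intros; apply Rmult_comm.
Qed.

Lemma Ccont_const (c : C) t : Ccont (fun _ => c) t.
Proof. split; apply continuous_const. Qed.

Lemma Ccont_plus u v t :
  Ccont u t -> Ccont v t -> Ccont (fun s => u s + v s)%C t.
Proof.
intros [H1 H2] [H3 H4].
split; apply (continuous_plus (V := R_NormedModule)); assumption.
Qed.

Lemma Ccont_opp u t : Ccont u t -> Ccont (fun s => - u s)%C t.
Proof.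
intros [H1 H2].
split; apply (continuous_opp (V := R_NormedModule)); assumption.
Qed.

Lemma Ccont_minus u v t :
  Ccont u t -> Ccont v t -> Ccont (fun s => u s - v s)%C t.
Proof. intros Hu Hv. apply Ccont_plus; [exact Hu|]. now apply Ccont_opp. Qed.

Lemma Ccont_mult u v t :
  Ccont u t -> Ccont v t -> Ccont (fun s => u s * v s)%C t.
Proof.
intros [H1 H2] [H3 H4]. split.
- apply (continuous_minus (V := R_NormedModule));
    apply (continuous_mult (K := R_AbsRing)); assumption.
- apply (continuous_plus (V := R_NormedModule));
    apply (continuous_mult (K := R_AbsRing)); assumption.
Qed.

Lemma Ccont_iff_eps u t : Ccont u t <-> forall eps : posreal,
  locally t (fun y => Cmod (u y - u t) < eps).
Proof.
split.
- intros [H1 H2] eps.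
  assert (He : 0 < eps / 2) by (generalize (cond_pos eps); lra).
  generalize (filter_and _ _
    (proj1 (filterlim_locally _ _) H1 (mkposreal _ He))
    (proj1 (filterlim_locally _ _) H2 (mkposreal _ He))).
  apply filter_imp. intros y [K1 K2].
  apply Rle_lt_trans with (1 := Cmod_le_ReIm _).
  change (Rabs (Re (u y) - Re (u t)) < eps / 2) in K1.
  change (Rabs (Im (u y) - Im (u t)) < eps / 2) in K2.
  change (Rabs (Re (u y) - Re (u t)) + Rabs (Im (u y) - Im (u t)) < eps). lra.
- intros H.
  split; apply filterlim_locally; intros eps; generalize (H eps);
    apply filter_imp; intros y Hy; apply Rle_lt_trans with (2 := Hy).
  + exact (re_le_Cmod (u y - u t)%C).
  + exact (im_le_Cmod (u y - u t)%C).
Qed.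

Lemma Ccont_lip (f : C -> C) (S : C -> Prop) L u t : 0 <= L ->
  (forall a b, S a -> S b -> Cmod (f a - f b) <= L * Cmod (a - b)) ->
  (forall s, S (u s)) -> Ccont u t -> Ccont (fun s => f (u s)) t.
Proof.
intros HL Hf HS Hu. apply Ccont_iff_eps. intros eps.
assert (He : 0 < eps / (L + 1)).
{ apply Rdiv_lt_0_compat; [apply cond_pos|lra]. }
generalize (proj1 (Ccont_iff_eps _ _) Hu (mkposreal _ He)).
apply filter_imp. simpl. intros y Hy.
apply Rle_lt_trans with (1 := Hf _ _ (HS y) (HS t)).
assert (E : eps / (L + 1) * (L + 1) = eps) by (field; lra).
assert (H0 := Cmod_ge_0 (u y - u t)). generalize (cond_pos eps). nra.
Qed.

Definition CInt (u : R -> C) (a b : R) : C :=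
  (RInt (fun s => Re (u s)) a b, RInt (fun s => Im (u s)) a b).

Lemma ex_RInt_Re u a b : (forall t, Ccont u t) -> ex_RInt (fun s => Re (u s)) a b.
Proof.
intros H. apply (ex_RInt_continuous (V := R_CompleteNormedModule)).
intros z _. apply H.
Qed.

Lemma ex_RInt_Im u a b : (forall t, Ccont u t) -> ex_RInt (fun s => Im (u s)) a b.
Proof.
intros H. apply (ex_RInt_continuous (V := R_CompleteNormedModule)).
intros z _. apply H.
Qed.

Lemma CInt_plus u v a b : (forall t, Ccont u t) -> (forall t, Ccont v t) ->
  CInt (fun s => u s + v s)%C a b = (CInt u a b + CInt v a b)%C.
Proof.
intros Hu Hv. apply injective_projections; simpl.
- apply (RInt_plus (V := R_CompleteNormedModule)); now apply ex_RInt_Re.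
- apply (RInt_plus (V := R_CompleteNormedModule)); now apply ex_RInt_Im.
Qed.

Lemma CInt_ext u v a b : (forall t, u t = v t) -> CInt u a b = CInt v a b.
Proof.
intros H. unfold CInt. f_equal; apply RInt_ext; intros; now rewrite H.
Qed.

Lemma CInt_scal (c : C) u a b : (forall t, Ccont u t) ->
  CInt (fun s => c * u s)%C a b = (c * CInt u a b)%C.
Proof.
intros Hu.
assert (H1 := RInt_correct (V := R_CompleteNormedModule) _ _ _ (ex_RInt_Re u a b Hu)).
assert (H2 := RInt_correct (V := R_CompleteNormedModule) _ _ _ (ex_RInt_Im u a b Hu)).
apply injective_projections; apply is_RInt_unique.
- exact (is_RInt_minus (V := R_NormedModule) _ _ _ _ _ _
    (is_RInt_scal (V := R_NormedModule) _ _ _ (fst c) _ H1)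
    (is_RInt_scal (V := R_NormedModule) _ _ _ (snd c) _ H2)).
- exact (is_RInt_plus (V := R_NormedModule) _ _ _ _ _ _
    (is_RInt_scal (V := R_NormedModule) _ _ _ (fst c) _ H2)
    (is_RInt_scal (V := R_NormedModule) _ _ _ (snd c) _ H1)).
Qed.

(* Sharpness: rotate the integral onto the positive axis and integrate a real part. *)
Lemma Cmod_CInt_le u a b (g : R -> R) : a <= b -> (forall t, Ccont u t) ->
  ex_RInt g a b -> (forall t, a < t < b -> Cmod (u t) <= g t) ->
  Cmod (CInt u a b) <= RInt g a b.
Proof.
intros Hab Hu Hg H.
set (m := CInt u a b).
destruct (Req_dec (Cmod m) 0) as [E|E].
{ rewrite E. replace 0 with (RInt (fun _ => 0) a b).
  - apply RInt_le; trivial.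
    + apply ex_RInt_const.
    + intros x Hx. apply Rle_trans with (2 := H x Hx). apply Cmod_ge_0.
  - rewrite RInt_const. apply Rmult_0_r. }
assert (Hm : 0 < Cmod m) by (generalize (Cmod_ge_0 m); lra).
apply Rmult_le_reg_l with (Cmod m); trivial.
replace (Cmod m * Cmod m) with (Re (Cconj m * m)%C).
2:{ replace (Cmod m * Cmod m) with (Cmod m ^ 2) by ring.
    rewrite Cmod2_alt. simpl. unfold Re, Im. ring. }
unfold m at 2. rewrite <- CInt_scal by trivial.
assert (Hc : forall t, Ccont (fun s => Cconj m * u s)%C t).
{ intros t. apply Ccont_mult; [apply Ccont_const|apply Hu]. }
replace (Cmod m * RInt g a b) with (RInt (fun s => scal (Cmod m) (g s)) a b)
  by now rewrite (RInt_scal (V := R_CompleteNormedModule)).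
apply RInt_le; trivial.
- exact (ex_RInt_Re _ a b Hc).
- now apply (ex_RInt_scal (V := R_NormedModule)).
- intros x Hx. apply Rle_trans with (1 := Re_le_Cmod _).
  rewrite Cmod_mult, Cmod_conj.
  apply Rmult_le_compat_l; [lra|]. now apply H.
Qed.

Lemma Cmod_CInt_le_const u a b M : a <= b -> (forall t, Ccont u t) ->
  (forall t, a < t < b -> Cmod (u t) <= M) -> Cmod (CInt u a b) <= (b - a) * M.
Proof.
intros Hab Hu H.
replace ((b - a) * M) with (RInt (fun _ => M) a b) by exact (RInt_const (V := R_CompleteNormedModule) a b M).
apply Cmod_CInt_le; trivial. apply ex_RInt_const.
Qed.

Lemma CInt_derive u u' a b : (forall t, Cder u t (u' t)) ->
  (forall t, Ccont u' t) -> CInt u' a b = (u b - u a)%C.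
Proof.
intros H Hc. apply injective_projections; simpl; apply is_RInt_unique.
- apply (is_RInt_derive (V := R_CompleteNormedModule) (fun s => Re (u s)));
    intros x _; [apply H|apply Hc].
- apply (is_RInt_derive (V := R_CompleteNormedModule) (fun s => Im (u s)));
    intros x _; [apply H|apply Hc].
Qed.

Lemma Cder_CInt u a t : (forall t, Ccont u t) ->
  Cder (fun s => CInt u a s) t (u t).
Proof.
intros Hu. split.
- apply (is_derive_RInt (V := R_NormedModule) (fun s => Re (u s)) _ a); [|apply Hu].
  apply filter_forall. intros b. apply (RInt_correct (V := R_CompleteNormedModule)).
  now apply ex_RInt_Re.
- apply (is_derive_RInt (V := R_NormedModule) (fun s => Im (u s)) _ a); [|apply Hu].
  apply filter_forall. intros b. apply (RInt_correct (V := R_CompleteNormedModule)).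
  now apply ex_RInt_Im.
Qed.

Lemma CInt_point u a : CInt u a a = RtoC 0.
Proof. unfold CInt. now rewrite !RInt_point. Qed.

(** * Picard iteration *)

Lemma half_pow_pos n : 0 < (1 / 2) ^ n.
Proof. apply pow_lt. lra. Qed.

Lemma geom_small r K e : 0 <= r < 1 -> 0 <= K -> 0 < e ->
  exists N, forall n, (N <= n)%nat -> K * r ^ n <= e.
Proof.
intros Hr HK He.
destruct (pow_lt_1_zero r) with (y := e / (K + 1)) as [N HN].
- rewrite Rabs_pos_eq; lra.
- apply Rdiv_lt_0_compat; lra.
- exists N. intros n Hn. generalize (HN n Hn).
  assert (0 <= r ^ n) by (apply pow_le; lra). rewrite Rabs_pos_eq by trivial.
  assert (E : e / (K + 1) * (K + 1) = e) by (field; lra). nra.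
Qed.

Lemma geometric_limit (a : nat -> C) B : 0 <= B ->
  (forall n, Cmod (a (S n) - a n) <= B * (1 / 2) ^ n) ->
  exists l, forall n, Cmod (l - a n) <= 2 * B * (1 / 2) ^ n.
Proof.
intros HB H.
(* The bound is the exact partial geometric sum; in this form the induction on p closes. *)
assert (P : forall n p, Cmod (a (n + p)%nat - a n) <= 2 * B * ((1 / 2) ^ n - (1 / 2) ^ (n + p))).
{ intros n. induction p as [|p IH].
  - rewrite Nat.add_0_r. replace (a n - a n)%C with (RtoC 0) by ring.
    rewrite Cmod_0. lra.
  - rewrite Nat.add_succ_r.
    replace (a (S (n + p)) - a n)%C
      with ((a (S (n + p)) - a (n + p)%nat) + (a (n + p)%nat - a n))%C by ring.
    apply Rle_trans with (1 := Cmod_triangle _ _).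
    generalize (H (n + p)%nat). simpl pow. lra. }
assert (Q : forall n m, (n <= m)%nat -> Cmod (a m - a n) <= 2 * B * (1 / 2) ^ n).
{ intros n m Hnm. generalize (P n (m - n)%nat).
  replace (n + (m - n))%nat with m by lia.
  generalize (half_pow_pos m). nra. }
assert (Cau : forall e, 0 < e -> exists N, forall n m, (N <= n)%nat -> (N <= m)%nat ->
  Cmod (a n - a m) < e).
{ intros e He. destruct (geom_small (1 / 2) (2 * B) (e / 3)) as [N HN]; try lra.
  exists N. intros n m Hn Hm.
  replace (a n - a m)%C with ((a n - a N) - (a m - a N))%C by ring.
  apply Rle_lt_trans with (1 := Cmod_minus_le _ _).
  generalize (Q N n Hn) (Q N m Hm) (HN N (le_n N)). lra. }
assert (L1 : ex_finite_lim_seq (fun n => Re (a n))).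
{ apply ex_lim_seq_cauchy_corr. intros e. destruct (Cau e (cond_pos e)) as [N HN].
  exists N. intros n m Hn Hm. apply Rle_lt_trans with (2 := HN n m Hn Hm).
  exact (re_le_Cmod (a n - a m)%C). }
assert (L2 : ex_finite_lim_seq (fun n => Im (a n))).
{ apply ex_lim_seq_cauchy_corr. intros e. destruct (Cau e (cond_pos e)) as [N HN].
  exists N. intros n m Hn Hm. apply Rle_lt_trans with (2 := HN n m Hn Hm).
  exact (im_le_Cmod (a n - a m)%C). }
destruct L1 as [x Hx], L2 as [y Hy]. exists (x, y). intros n.
apply le_epsilon. intros e He.
assert (He2 : 0 < e / 2) by lra.
destruct (proj2 (is_lim_seq_spec _ _) Hx (mkposreal _ He2)) as [N1 HN1].
destruct (proj2 (is_lim_seq_spec _ _) Hy (mkposreal _ He2)) as [N2 HN2].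
set (m := (n + N1 + N2)%nat).
specialize (HN1 m ltac:(lia)). specialize (HN2 m ltac:(lia)). simpl in HN1, HN2.
replace ((x, y) - a n)%C with ((a m - a n) - (a m - (x, y)))%C by ring.
apply Rle_trans with (1 := Cmod_minus_le _ _).
assert (K : Cmod (a m - (x, y)) <= e).
{ apply Rle_trans with (1 := Cmod_le_ReIm _).
  change (Rabs (Re (a m) - x) + Rabs (Im (a m) - y) <= e). lra. }
generalize (Q n m ltac:(lia)). lra.
Qed.

(** A curve known only for t >= 0 is frozen at its initial value, which makes it continuous on the
    whole line, as the lemmas on [CInt] require. *)
Lemma Ccont_Rmax0 u : (forall t, 0 <= t -> Ccont u t) ->
  forall t, Ccont (fun s => u (Rmax s 0)) t.
Proof.
intros Hu t.
assert (H : continuous (fun s => Rmax s 0) t).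
{ apply filterlim_locally. intros eps. exists eps. intros y Hy.
  change (Rabs (Rmax y 0 - Rmax t 0) < eps).
  change (Rabs (y - t) < eps) in Hy. apply Rle_lt_trans with (2 := Hy).
  unfold Rmax. destruct (Rle_dec y 0), (Rle_dec t 0);
    unfold Rabs; repeat destruct Rcase_abs; lra. }
split; [apply (continuous_comp (fun s => Rmax s 0) (fun s => Re (u s)))
       |apply (continuous_comp (fun s => Rmax s 0) (fun s => Im (u s)))];
  trivial; apply Hu, Rmax_r.
Qed.

(** [Rmax s 0] freezes the integrand at negative times, so that the iterates are differentiable on
    the whole line, with a two-sided derivative at 0. *)
Fixpoint picard_iter (F : C -> C) (z : C) (k : nat) : R -> C :=
  match k with
  | O => fun _ => z
  | S k => fun t => (z + CInt (fun s => F (picard_iter F z k (Rmax s 0))) 0 t)%C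
  end.

Section Picard.

Variables (F : C -> C) (L : R) (z : C).
Hypothesis HL : 0 < L.
Hypothesis HF : forall a b, Cmod (F a - F b) <= L * Cmod (a - b).

Lemma Ccont_Lipschitz u : (forall t, Ccont u t) -> forall t, Ccont (fun s => F (u s)) t.
Proof.
intros Hu t. apply Ccont_lip with (fun _ => True) L; auto; lra.
Qed.

Lemma picard_iter_cont k t : Ccont (picard_iter F z k) t.
Proof.
revert t. induction k as [|k IH]; intros t; simpl.
- apply Ccont_const.
- apply Ccont_plus; [apply Ccont_const|].
  eapply Cder_cont, Cder_CInt.
  apply (Ccont_Lipschitz (fun s => picard_iter F z k (Rmax s 0))).
  apply Ccont_Rmax0. auto.
Qed.

Let cont_F k t : Ccont (fun s => F (picard_iter F z k (Rmax s 0))) t.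
Proof.
apply (Ccont_Lipschitz (fun s => picard_iter F z k (Rmax s 0))).
apply Ccont_Rmax0. intros; apply picard_iter_cont.
Qed.

(** Chosen so that the first increment, at most t |F z| = B (2 L t), lies below B exp (2 L t). *)
Let B := Cmod (F z) / (2 * L).

(* Measured with the weight [exp (- 2 L t)], the Picard map contracts by 1/2. *)
Lemma picard_iter_dist k t : 0 <= t ->
  Cmod (picard_iter F z (S k) t - picard_iter F z k t)
    <= B * exp (2 * L * t) * (1 / 2) ^ k.
Proof.
assert (HB : 0 <= B).
{ apply Rmult_le_pos; [apply Cmod_ge_0|]. apply Rlt_le, Rinv_0_lt_compat; lra. }
revert t. induction k as [|k IH]; intros t Ht.
- simpl. replace (z + CInt (fun s => F z) 0 t - z)%C with (CInt (fun s => F z) 0 t) by ring.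
  apply Rle_trans with ((t - 0) * Cmod (F z)).
  + apply Cmod_CInt_le_const; trivial; intros; [apply Ccont_const|lra].
  + replace (Cmod (F z)) with (B * (2 * L)) by (unfold B; field; lra).
    assert (H := exp_ineq1_le (2 * L * t)). nra.
- set (v := fun s => (F (picard_iter F z (S k) (Rmax s 0)) - F (picard_iter F z k (Rmax s 0)))%C).
  assert (Hv : forall s, Ccont v s) by (intros s; apply Ccont_minus; apply cont_F).
  replace (picard_iter F z (S (S k)) t - picard_iter F z (S k) t)%C with (CInt v 0 t).
  2:{ unfold v.
      rewrite (CInt_ext _ (fun s => F (picard_iter F z (S k) (Rmax s 0))
        + (- RtoC 1) * F (picard_iter F z k (Rmax s 0)))%C) by (intros; ring).
      rewrite CInt_plus; [|apply cont_F|].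
      - rewrite CInt_scal by apply cont_F.
        change (picard_iter F z (S (S k)) t - picard_iter F z (S k) t)%C with
          ((z + CInt (fun s => F (picard_iter F z (S k) (Rmax s 0))) 0 t)
            - (z + CInt (fun s => F (picard_iter F z k (Rmax s 0))) 0 t))%C.
        ring.
      - intros s. apply Ccont_mult; [apply Ccont_const|apply cont_F]. }
  (* [L] times the bound of the induction hypothesis. Integrating the exponential divides by 2 L,
     and this is where the factor 1/2 is gained. *)
  set (g := fun s => L * B * (1 / 2) ^ k * exp (2 * L * s)).
  assert (Hg : is_RInt g 0 t
    (minus (B * (1 / 2) ^ S k * exp (2 * L * t)) (B * (1 / 2) ^ S k * exp (2 * L * 0)))).
  { apply (is_RInt_derive (V := R_CompleteNormedModule)
      (fun s => B * (1 / 2) ^ S k * exp (2 * L * s))).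
    - intros x _. unfold g. auto_derive; trivial. simpl. field.
    - intros x _. unfold g. apply (ex_derive_continuous (V := R_NormedModule)).
      auto_derive. trivial. }
  apply Rle_trans with (RInt g 0 t).
  + apply Cmod_CInt_le; trivial.
    * eexists; exact Hg.
    * intros s Hs. unfold v, g. rewrite (Rmax_left s 0) by lra.
      apply Rle_trans with (1 := HF _ _).
      generalize (IH s ltac:(lra)). nra.
  + rewrite (is_RInt_unique _ _ _ _ Hg). unfold minus, plus, opp; simpl.
    assert (H0 := half_pow_pos k). assert (H1 := exp_pos (2 * L * 0)).
    assert (0 <= B * (1 / 2 * (1 / 2) ^ k) * exp (2 * L * 0)); [|lra].
    apply Rmult_le_pos; [|lra]. apply Rmult_le_pos; lra.
Qed.

(** The limit [v] of the iterates is continuous, and [u] is defined from it by the integral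
    equation, so that [u] is differentiable at once; it remains to identify [u] with [v]. At
    negative times [u] continues along its tangent at 0, whence the argument [Rmax t 0]. *)
Lemma picard : exists u : R -> C, u 0 = z /\
  forall t, Cder u t (F (u (Rmax t 0))).
Proof.
assert (HB : 0 <= B).
{ apply Rmult_le_pos; [apply Cmod_ge_0|]. apply Rlt_le, Rinv_0_lt_compat; lra. }
set (W := fun s => 2 * (B * exp (2 * L * Rmax s 0))).
assert (HW : forall s, 0 <= W s).
{ intros s. unfold W. generalize (exp_pos (2 * L * Rmax s 0)). nra. }
destruct (choice (fun s l => forall n,
  Cmod (l - picard_iter F z n (Rmax s 0)) <= W s * (1 / 2) ^ n)) as [v Hv].
{ intros s. apply geometric_limit.
  - generalize (HW s). unfold W. lra.
  - intros n. apply picard_iter_dist. apply Rmax_r. }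
assert (Wle : forall s t, s <= t -> W s <= W t).
{ intros s t Hst. unfold W.
  assert (exp (2 * L * Rmax s 0) <= exp (2 * L * Rmax t 0)); [|nra].
  assert (H : Rmax s 0 <= Rmax t 0) by (apply Rle_max_compat_r; trivial).
  destruct (Rle_lt_or_eq_dec _ _ H) as [H1|H1].
  - apply Rlt_le, exp_increasing. nra.
  - rewrite H1. lra. }
assert (vc : forall t, Ccont v t).
{ intros t. apply Ccont_iff_eps. intros eps.
  assert (He : 0 < eps / 3) by (generalize (cond_pos eps); lra).
  destruct (geom_small (1 / 2) (W (t + 1)) (eps / 4)) as [n Hn]; [lra|apply HW|lra|].
  specialize (Hn n (le_n n)).
  assert (Hsm : forall s, s <= t + 1 -> Cmod (v s - picard_iter F z n (Rmax s 0)) < eps / 3).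
  { intros s Hs. apply Rle_lt_trans with (1 := Hv s n).
    generalize (Wle _ _ Hs) (HW s) (half_pow_pos n). nra. }
  assert (Hloc : locally t (fun s => s <= t + 1)).
  { exists (mkposreal 1 Rlt_0_1). intros y Hy. change (Rabs (y - t) < 1) in Hy.
    apply Rabs_def2 in Hy. lra. }
  generalize (filter_and _ _ Hloc (proj1 (Ccont_iff_eps _ _)
    (Ccont_Rmax0 _ (fun t _ => picard_iter_cont n t) t) (mkposreal _ He))).
  apply filter_imp. simpl. intros y [Hy1 Hy2].
  replace (v y - v t)%C with ((v y - picard_iter F z n (Rmax y 0))
    + ((picard_iter F z n (Rmax y 0) - picard_iter F z n (Rmax t 0))
       - (v t - picard_iter F z n (Rmax t 0))))%C by ring.
  apply Rle_lt_trans with (1 := Cmod_triangle _ _).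
  generalize (Cmod_minus_le (picard_iter F z n (Rmax y 0) - picard_iter F z n (Rmax t 0))
    (v t - picard_iter F z n (Rmax t 0))) (Hsm y Hy1) (Hsm t ltac:(lra)). lra. }
set (u := fun t => (z + CInt (fun s => F (v s)) 0 t)%C).
assert (cFv : forall t, Ccont (fun s => F (v s)) t) by now apply Ccont_Lipschitz.
(* Both lie within a multiple of (1/2)^n of the iterate [S n]: [u] by integrating the Lipschitz
   bound, [v] by its choice. *)
assert (E : forall t, 0 <= t -> u t = v t).
{ intros t Ht. apply eq_of_Cmod_le_eps. intros e He.
  assert (HtW : 0 <= t * L * W t).
  { apply Rmult_le_pos; [|apply HW]. apply Rmult_le_pos; lra. }
  destruct (geom_small (1 / 2) (W t + t * L * W t) e) as [n Hn]; [lra| |trivial|].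
  { generalize (HW t). lra. }
  specialize (Hn n (le_n n)).
  assert (H1 : Cmod (u t - picard_iter F z (S n) t) <= (t - 0) * (L * (W t * (1 / 2) ^ n))).
  { replace (u t - picard_iter F z (S n) t)%C with
      (CInt (fun s => F (v s) - F (picard_iter F z n (Rmax s 0)))%C 0 t).
    - apply Cmod_CInt_le_const; trivial.
      + intros s. apply Ccont_minus; [apply cFv|apply cont_F].
      + intros s Hs. apply Rle_trans with (1 := HF _ _).
        apply Rmult_le_compat_l; [lra|]. apply Rle_trans with (1 := Hv s n).
        apply Rmult_le_compat_r; [apply Rlt_le, half_pow_pos|]. apply Wle. lra.
    - rewrite (CInt_ext _ (fun s => F (v s)
        + (- RtoC 1) * F (picard_iter F z n (Rmax s 0)))%C) by (intros; ring).
      rewrite CInt_plus; [|apply cFv|].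
      + rewrite CInt_scal by apply cont_F. unfold u. simpl. ring.
      + intros s. apply Ccont_mult; [apply Ccont_const|apply cont_F]. }
  assert (H2 := Hv t (S n)). rewrite (Rmax_left t 0) in H2 by trivial.
  replace (u t - v t)%C
    with ((u t - picard_iter F z (S n) t) - (v t - picard_iter F z (S n) t))%C by ring.
  apply Rle_trans with (1 := Cmod_minus_le _ _).
  assert (H3 : W t * (1 / 2) ^ S n <= W t * (1 / 2) ^ n).
  { apply Rmult_le_compat_l; [apply HW|]. simpl. generalize (half_pow_pos n). lra. }
  lra. }
(* [choice] picks [v t] and [v (Rmax t 0)] separately; they agree because both are limits of the
   same iterates. *)
assert (Ev : forall t, v t = u (Rmax t 0)).
{ intros t. rewrite E by apply Rmax_r. apply eq_of_Cmod_le_eps. intros e He.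
  destruct (geom_small (1 / 2) (2 * W t) e) as [n Hn]; [lra|generalize (HW t); lra|trivial|].
  specialize (Hn n (le_n n)).
  assert (H1 := Hv t n). assert (H2 := Hv (Rmax t 0) n).
  rewrite (Rmax_left (Rmax t 0) 0) in H2 by apply Rmax_r.
  assert (EW : W (Rmax t 0) = W t).
  { unfold W. rewrite (Rmax_left (Rmax t 0) 0) by apply Rmax_r. reflexivity. }
  rewrite EW in H2.
  replace (v t - v (Rmax t 0))%C with ((v t - picard_iter F z n (Rmax t 0))
    - (v (Rmax t 0) - picard_iter F z n (Rmax t 0)))%C by ring.
  apply Rle_trans with (1 := Cmod_minus_le _ _). lra. }
exists u. split.
- unfold u. rewrite CInt_point. ring.
- intros t. rewrite <- Ev. unfold u.
  replace (F (v t)) with (0 + F (v t))%C by ring.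
  apply Cder_plus; [apply Cder_const|]. now apply (Cder_CInt (fun s => F (v s))).
Qed.

End Picard.

(** * Functions with locally Lipschitz complex derivative *)

(** The derivative is tied to [f] by a quadratic Taylor remainder, which passes through products and
    compositions with explicit constants. [S] may be a closed disc, as for [mobius] on |z| <= 1. *)
Record C11 (S : C -> Prop) (f f' : C -> C) (M : R) : Prop := {
  C11_ge0 : 0 <= M;
  C11_bound : forall a, S a -> Cmod (f a) <= M;
  C11_bound' : forall a, S a -> Cmod (f' a) <= M;
  C11_lip : forall a b, S a -> S b -> Cmod (f a - f b) <= M * Cmod (a - b);
  C11_lip' : forall a b, S a -> S b -> Cmod (f' a - f' b) <= M * Cmod (a - b);
  C11_taylor : forall a b, S a -> S b ->
    Cmod (f a - f b - f' b * (a - b)) <= M * Cmod (a - b) ^ 2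
}.

Definition cball (r : R) (z : C) : Prop := Cmod z <= r.

(* Holomorphy on the disc in quantitative form, with [f'] Lipschitz on every smaller disc. *)
Definition hol (f f' : C -> C) : Prop :=
  forall r, r < 1 -> exists M, C11 (cball r) f f' M.

(** The sum of the Taylor remainders from a to b and from b to a is (f' a - f' b)(a - b), so [f'] is
    Lipschitz with constant 2 M. For [f] itself, |a - b| <= 2 turns the quadratic remainder into a
    linear one, whence the factor 3. *)
Lemma C11_intro S f f' M : (forall a, S a -> Cmod a <= 1) -> 0 <= M ->
  (forall a, S a -> Cmod (f a) <= M) -> (forall a, S a -> Cmod (f' a) <= M) ->
  (forall a b, S a -> S b ->
    Cmod (f a - f b - f' b * (a - b)) <= M * Cmod (a - b) ^ 2) ->
  C11 S f f' (3 * M).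
Proof.
intros HS HM H1 H2 H3.
assert (H0 : forall a b, S a -> S b -> 0 <= Cmod (a - b) <= 2).
{ intros a b Ha Hb. split; [apply Cmod_ge_0|].
  apply Rle_trans with (1 := Cmod_minus_le _ _). generalize (HS a Ha) (HS b Hb). lra. }
split.
- lra.
- intros a Ha. generalize (H1 a Ha). lra.
- intros a Ha. generalize (H2 a Ha). lra.
- intros a b Ha Hb.
  replace (f a - f b)%C with ((f a - f b - f' b * (a - b)) + f' b * (a - b))%C by ring.
  apply Rle_trans with (1 := Cmod_triangle _ _). rewrite Cmod_mult.
  generalize (H0 a b Ha Hb) (H2 b Hb) (H3 a b Ha Hb). intros K1 K2 K3.
  assert (Cmod (f' b) * Cmod (a - b) <= M * Cmod (a - b)) by (apply Rmult_le_compat_r; lra).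
  assert (Cmod (a - b) ^ 2 <= 2 * Cmod (a - b)) by nra.
  assert (M * Cmod (a - b) ^ 2 <= M * (2 * Cmod (a - b))) by (apply Rmult_le_compat_l; lra).
  lra.
- intros a b Ha Hb.
  destruct (Req_dec (Cmod (a - b)) 0) as [E|E].
  + apply Cmod_eq_0 in E. replace a with b.
    * replace (f' b - f' b)%C with (RtoC 0) by ring.
      replace (b - b)%C with (RtoC 0) by ring. rewrite Cmod_0. lra.
    * replace a with (a - b + b)%C by ring. rewrite E. ring.
  + assert (Hp : 0 < Cmod (a - b)) by (generalize (H0 a b Ha Hb); lra).
    apply Rmult_le_reg_r with (1 := Hp). rewrite <- Cmod_mult.
    replace ((f' a - f' b) * (a - b))%C with
      ((f a - f b - f' b * (a - b)) + (f b - f a - f' a * (b - a)))%C by ring.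
    apply Rle_trans with (1 := Cmod_triangle _ _).
    generalize (H3 a b Ha Hb) (H3 b a Hb Ha). rewrite (Cmod_minus_sym b a).
    assert (0 <= M * Cmod (a - b) ^ 2) by (apply Rmult_le_pos; [trivial|apply pow2_ge_0]).
    intros. lra.
- intros a b Ha Hb. generalize (H3 a b Ha Hb).
  assert (0 <= M * Cmod (a - b) ^ 2) by (apply Rmult_le_pos; [trivial|apply pow2_ge_0]).
  lra.
Qed.

Lemma C11_sub S S' f f' M : (forall a, S a -> S' a) -> C11 S' f f' M -> C11 S f f' M.
Proof. intros H [H0 H1 H2 H3 H4 H5]. split; auto. Qed.

Lemma C11_comp S S' f f' M g g' N : (forall a, S a -> Cmod a <= 1) ->
  C11 S g g' N -> (forall a, S a -> S' (g a)) -> C11 S' f f' M ->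
  exists K, C11 S (fun z => f (g z)) (fun z => f' (g z) * g' z)%C K.
Proof.
intros HS Hg Hgs Hf.
assert (HM := C11_ge0 _ _ _ _ Hf). assert (HN := C11_ge0 _ _ _ _ Hg).
exists (3 * (M + M * N + M * N ^ 2)).
assert (0 <= M * N) by (apply Rmult_le_pos; lra).
assert (0 <= M * N ^ 2) by (apply Rmult_le_pos; [lra|apply pow2_ge_0]).
apply C11_intro; trivial.
- lra.
- intros a Ha. generalize (C11_bound _ _ _ _ Hf _ (Hgs a Ha)). lra.
- intros a Ha. rewrite Cmod_mult.
  apply Rle_trans with (M * N); [|lra].
  apply Rmult_le_compat; try apply Cmod_ge_0.
  + apply (C11_bound' _ _ _ _ Hf). auto.
  + now apply (C11_bound' _ _ _ _ Hg).
- intros a b Ha Hb.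
  replace (f (g a) - f (g b) - f' (g b) * g' b * (a - b))%C with
    ((f (g a) - f (g b) - f' (g b) * (g a - g b))
      + f' (g b) * (g a - g b - g' b * (a - b)))%C by ring.
  apply Rle_trans with (1 := Cmod_triangle _ _). rewrite Cmod_mult.
  assert (K1 := C11_taylor _ _ _ _ Hf _ _ (Hgs a Ha) (Hgs b Hb)).
  assert (K2 := C11_taylor _ _ _ _ Hg _ _ Ha Hb).
  assert (K3 := C11_lip _ _ _ _ Hg _ _ Ha Hb).
  assert (K4 := C11_bound' _ _ _ _ Hf _ (Hgs b Hb)).
  assert (K5 := Cmod_ge_0 (a - b)).
  assert (K6 : Cmod (g a - g b) ^ 2 <= (N * Cmod (a - b)) ^ 2).
  { apply pow_incr. split; [apply Cmod_ge_0|trivial]. }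
  rewrite Rpow_mult_distr in K6.
  assert (K7 : M * Cmod (g a - g b) ^ 2 <= M * (N ^ 2 * Cmod (a - b) ^ 2))
    by (apply Rmult_le_compat_l; lra).
  assert (K8 : Cmod (f' (g b)) * Cmod (g a - g b - g' b * (a - b)) <= M * (N * Cmod (a - b) ^ 2))
    by (apply Rmult_le_compat; trivial; apply Cmod_ge_0).
  assert (0 <= M * Cmod (a - b) ^ 2) by (apply Rmult_le_pos; [trivial|apply pow2_ge_0]).
  lra.
Qed.

(** Since [hol] gives no bound up to the unit circle, [g] has to map each smaller disc into a
    smaller disc. For flows and disc automorphisms this is [flow_trap] and [mobius_trap]. *)
Lemma hol_comp f f' g g' : hol f f' -> hol g g' ->
  (forall r, r < 1 -> exists r', r' < 1 /\ forall z, Cmod z <= r -> Cmod (g z) <= r') ->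
  hol (fun z => f (g z)) (fun z => f' (g z) * g' z)%C.
Proof.
intros Hf Hg H r Hr. destruct (H r Hr) as [r' [Hr' Hgr]].
destruct (Hf r' Hr') as [M HM]. destruct (Hg r Hr) as [N HN].
apply C11_comp with (cball r') M N; trivial.
intros a Ha. unfold cball in Ha. lra.
Qed.

Lemma hol_const (c : C) : hol (fun _ => c) (fun _ => RtoC 0).
Proof.
intros r Hr. exists (Cmod c). assert (H := Cmod_ge_0 c).
assert (Z : forall x y, x = RtoC 0 -> 0 <= y -> Cmod x <= Cmod c * y).
{ intros x y -> Hy. rewrite Cmod_0. now apply Rmult_le_pos. }
split; intros; trivial; try lra.
- now rewrite Cmod_0.
- apply Z; [ring|apply Cmod_ge_0].
- apply Z; [ring|apply Cmod_ge_0].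
- apply Z; [ring|apply pow2_ge_0].
Qed.

Lemma hol_id : hol (fun z => z) (fun _ => RtoC 1).
Proof.
intros r Hr. exists 1. unfold cball. split; intros.
- lra.
- lra.
- rewrite Cmod_1. lra.
- lra.
- replace (1 - 1)%C with (RtoC 0) by ring. rewrite Cmod_0. generalize (Cmod_ge_0 (a - b)). lra.
- replace (a - b - 1 * (a - b))%C with (RtoC 0) by ring. rewrite Cmod_0.
  generalize (pow2_ge_0 (Cmod (a - b))). lra.
Qed.

Lemma hol_plus f f' g g' : hol f f' -> hol g g' ->
  hol (fun z => f z + g z)%C (fun z => f' z + g' z)%C.
Proof.
intros Hf Hg r Hr. destruct (Hf r Hr) as [M HM]. destruct (Hg r Hr) as [N HN].
exists (M + N). destruct HM, HN.
split; [lra|..]; intros a; [intros Ha|intros Ha|intros b Ha Hb..].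
- apply Rle_trans with (1 := Cmod_triangle _ _). apply Rplus_le_compat; auto.
- apply Rle_trans with (1 := Cmod_triangle _ _). apply Rplus_le_compat; auto.
- rewrite Rmult_plus_distr_r.
  replace (f a + g a - (f b + g b))%C with ((f a - f b) + (g a - g b))%C by ring.
  apply Rle_trans with (1 := Cmod_triangle _ _). apply Rplus_le_compat; auto.
- rewrite Rmult_plus_distr_r.
  replace (f' a + g' a - (f' b + g' b))%C with ((f' a - f' b) + (g' a - g' b))%C by ring.
  apply Rle_trans with (1 := Cmod_triangle _ _). apply Rplus_le_compat; auto.
- rewrite Rmult_plus_distr_r.
  replace (f a + g a - (f b + g b) - (f' b + g' b) * (a - b))%C
    with ((f a - f b - f' b * (a - b)) + (g a - g b - g' b * (a - b)))%C by ring.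
  apply Rle_trans with (1 := Cmod_triangle _ _). apply Rplus_le_compat; auto.
Qed.

Lemma hol_mult f f' g g' : hol f f' -> hol g g' ->
  hol (fun z => f z * g z)%C (fun z => f' z * g z + f z * g' z)%C.
Proof.
intros Hf Hg r Hr. destruct (Hf r Hr) as [M HM]. destruct (Hg r Hr) as [N HN].
exists (3 * (3 * M * N)).
assert (HM0 := C11_ge0 _ _ _ _ HM). assert (HN0 := C11_ge0 _ _ _ _ HN).
destruct HM as [_ M1 M2 M3 M4 M5], HN as [_ N1 N2 N3 N4 N5].
assert (HMN : 0 <= M * N) by (apply Rmult_le_pos; lra).
assert (B : forall x y, Cmod x <= M -> Cmod y <= N -> Cmod (x * y) <= M * N).
{ intros x y Hx Hy. rewrite Cmod_mult. apply Rmult_le_compat; trivial; apply Cmod_ge_0. }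
apply C11_intro.
- unfold cball. intros; lra.
- lra.
- intros a Ha. generalize (B _ _ (M1 a Ha) (N1 a Ha)). lra.
- intros a Ha. apply Rle_trans with (1 := Cmod_triangle _ _).
  generalize (B _ _ (M2 a Ha) (N1 a Ha)) (B _ _ (M1 a Ha) (N2 a Ha)). lra.
- intros a b Ha Hb.
  replace (f a * g a - f b * g b - (f' b * g b + f b * g' b) * (a - b))%C with
   (((f a - f b - f' b * (a - b)) * g b + f b * (g a - g b - g' b * (a - b)))
     + (f a - f b) * (g a - g b))%C by ring.
  apply Rle_trans with (1 := Cmod_triangle _ _).
  apply Rle_trans with (M * N * Cmod (a - b) ^ 2 + M * N * Cmod (a - b) ^ 2
    + M * N * Cmod (a - b) ^ 2); [|lra].
  apply Rplus_le_compat.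
  + apply Rle_trans with (1 := Cmod_triangle _ _). rewrite !Cmod_mult.
    apply Rplus_le_compat.
    * replace (M * N * Cmod (a - b) ^ 2) with (M * Cmod (a - b) ^ 2 * N) by ring.
      apply Rmult_le_compat; auto; apply Cmod_ge_0.
    * rewrite Rmult_assoc. apply Rmult_le_compat; auto; apply Cmod_ge_0.
  + rewrite Cmod_mult.
    replace (M * N * Cmod (a - b) ^ 2) with ((M * Cmod (a - b)) * (N * Cmod (a - b))) by ring.
    apply Rmult_le_compat; auto; apply Cmod_ge_0.
Qed.

Lemma hol_is_derive f f' z : hol f f' -> Cmod z < 1 ->
  is_derive (K := C_AbsRing) (V := C_NormedModule) f z (f' z).
Proof.
intros Hf Hz.
set (r := (1 + Cmod z) / 2).
destruct (Hf r ltac:(unfold r; lra)) as [M HM].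
assert (HM0 := C11_ge0 _ _ _ _ HM).
split; [apply is_linear_scal_l|].
intros x Hx.
apply (is_filter_lim_locally_unique (V := AbsRing_NormedModule C_AbsRing)) in Hx. subst x.
intros eps.
assert (He : 0 < eps / (M + 1)) by (apply Rdiv_lt_0_compat; [apply cond_pos|lra]).
assert (Hr : 0 < r - Cmod z) by (unfold r; lra).
exists (mkposreal _ (Rmin_glb_lt _ _ _ He Hr)).
intros y Hy. change (Cmod (y - z) < Rmin (eps / (M + 1)) (r - Cmod z)) in Hy.
assert (Hy1 := Rlt_le_trans _ _ _ Hy (Rmin_l _ _)).
assert (Hy2 := Rlt_le_trans _ _ _ Hy (Rmin_r _ _)).
change (Cmod (f y + - f z + - ((y + - z) * f' z))%C <= eps * Cmod (y + - z)%C).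
replace (f y + - f z + - ((y + - z) * f' z))%C
  with (f y - f z - f' z * (y - z))%C by ring.
change (y + - z)%C with (y - z)%C.
apply Rle_trans with (M * Cmod (y - z) ^ 2).
- apply (C11_taylor _ _ _ _ HM); unfold cball.
  + generalize (Cmod_triangle_inv y z). lra.
  + unfold r. lra.
- assert (E : eps / (M + 1) * (M + 1) = eps) by (field; lra).
  assert (H0 := Cmod_ge_0 (y - z)).
  assert (M * Cmod (y - z) <= eps) by (generalize (cond_pos eps); nra).
  replace (M * Cmod (y - z) ^ 2) with (M * Cmod (y - z) * Cmod (y - z)) by ring.
  now apply Rmult_le_compat_r.
Qed.

Lemma Cder_hol f f' u t l : hol f f' -> Cmod (u t) < 1 -> Cder u t l ->
  Cder (fun s => f (u s)) t (f' (u t) * l)%C.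
Proof.
intros Hf Hz Hu.
set (r := (1 + Cmod (u t)) / 2).
destruct (Hf r ltac:(unfold r; lra)) as [M HM].
assert (HM0 := C11_ge0 _ _ _ _ HM).
apply Cder_iff_eps. intros eps.
assert (Hl := Cmod_ge_0 l).
(* [e1] controls the linearization error of [u], which is multiplied by f'. [e2] keeps [u y] in the
   disc of radius r and controls the quadratic remainder of f. *)
set (e1 := Rmin 1 (eps / (2 * (M + 1)))).
assert (He1 : 0 < e1).
{ apply Rmin_glb_lt; [lra|]. apply Rdiv_lt_0_compat; [apply cond_pos|lra]. }
set (e2 := Rmin (r - Cmod (u t)) (eps / (2 * (M + 1) * (1 + Cmod l)))).
assert (He2 : 0 < e2).
{ apply Rmin_glb_lt; [unfold r; lra|]. apply Rdiv_lt_0_compat; [apply cond_pos|nra]. }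
generalize (filter_and _ _
  (proj1 (Cder_iff_eps _ _ _) Hu (mkposreal _ He1))
  (proj1 (Ccont_iff_eps _ _) (Cder_cont _ _ _ Hu) (mkposreal _ He2))).
apply filter_imp. simpl. intros y [Hy1 Hy2].
assert (Hy3 := Rlt_le_trans _ _ _ Hy2 (Rmin_l _ _)).
assert (Hy4 := Rlt_le_trans _ _ _ Hy2 (Rmin_r _ _)).
assert (K1 : cball r (u y)).
{ unfold cball. generalize (Cmod_triangle_inv (u y) (u t)). lra. }
assert (K2 : cball r (u t)) by (unfold cball, r; lra).
replace (f (u y) - f (u t) - f' (u t) * l * (y - t)%R)%C with
  ((f (u y) - f (u t) - f' (u t) * (u y - u t)) + f' (u t) * (u y - u t - l * (y - t)%R))%C by ring.
apply Rle_trans with (1 := Cmod_triangle _ _). rewrite Cmod_mult.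
assert (K3 := C11_taylor _ _ _ _ HM _ _ K1 K2).
assert (K4 := C11_bound' _ _ _ _ HM _ K2).
assert (K5 : Cmod (u y - u t) <= (1 + Cmod l) * Rabs (y - t)).
{ replace (u y - u t)%C with ((u y - u t - l * (y - t)%R) + l * (y - t)%R)%C by ring.
  apply Rle_trans with (1 := Cmod_triangle _ _). rewrite Cmod_mult, Cmod_R.
  assert (e1 <= 1) by apply Rmin_l. generalize (Rabs_pos (y - t)). nra. }
assert (He1' : e1 <= eps / (2 * (M + 1))) by apply Rmin_r.
set (D := Rabs (y - t)) in *.
assert (HD : 0 <= D) by apply Rabs_pos.
set (x := Cmod (u y - u t)) in *.
assert (Hx : 0 <= x) by apply Cmod_ge_0.
assert (Q1 : M * x ^ 2 <= eps / 2 * D).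
{ assert (E : eps / (2 * (M + 1) * (1 + Cmod l)) * ((M + 1) * (1 + Cmod l)) = eps / 2)
    by (field; lra).
  apply Rle_trans with ((M + 1) * x * x); [nra|].
  apply Rle_trans with ((M + 1) * x * ((1 + Cmod l) * D)).
  - apply Rmult_le_compat_l; nra.
  - replace ((M + 1) * x * ((1 + Cmod l) * D)) with (x * ((M + 1) * (1 + Cmod l)) * D) by ring.
    apply Rmult_le_compat_r; trivial. rewrite <- E.
    apply Rmult_le_compat_r; [nra|lra]. }
assert (Q2 : Cmod (f' (u t)) * Cmod (u y - u t - l * (y - t)%R) <= eps / 2 * D).
{ assert (E : eps / (2 * (M + 1)) * (M + 1) = eps / 2) by (field; lra).
  assert (HF := Cmod_ge_0 (f' (u t))).
  apply Rle_trans with ((M + 1) * (e1 * D)).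
  - apply Rmult_le_compat; trivial; [apply Cmod_ge_0|lra].
  - replace ((M + 1) * (e1 * D)) with (e1 * (M + 1) * D) by ring.
    apply Rmult_le_compat_r; trivial. rewrite <- E. apply Rmult_le_compat_r; lra. }
lra.
Qed.

Lemma Ccont_local_lip (f : C -> C) u t :
  (forall r, r < 1 -> exists M, 0 <= M /\ forall a b, cball r a -> cball r b ->
    Cmod (f a - f b) <= M * Cmod (a - b)) ->
  Cmod (u t) < 1 -> Ccont u t -> Ccont (fun s => f (u s)) t.
Proof.
intros Hf Hu Hc. set (r := (1 + Cmod (u t)) / 2).
destruct (Hf r ltac:(unfold r; lra)) as [M [HM0 HM]].
apply Ccont_iff_eps. intros eps.
assert (He : 0 < Rmin (r - Cmod (u t)) (eps / (M + 1))).
{ apply Rmin_glb_lt; [unfold r; lra|]. apply Rdiv_lt_0_compat; [apply cond_pos|lra]. }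
generalize (proj1 (Ccont_iff_eps _ _) Hc (mkposreal _ He)). apply filter_imp.
simpl. intros y Hy.
assert (Hy1 := Rlt_le_trans _ _ _ Hy (Rmin_l _ _)).
assert (Hy2 := Rlt_le_trans _ _ _ Hy (Rmin_r _ _)).
apply Rle_lt_trans with (M * Cmod (u y - u t)).
- apply HM; unfold cball.
  + generalize (Cmod_triangle_inv (u y) (u t)). lra.
  + unfold r. lra.
- assert (E : eps / (M + 1) * (M + 1) = eps) by (field; lra).
  assert (H0 := Cmod_ge_0 (u y - u t)). generalize (cond_pos eps). nra.
Qed.

Lemma Ccont_hol f f' u t : hol f f' -> Cmod (u t) < 1 -> Ccont u t ->
  Ccont (fun s => f (u s)) t.
Proof.
intros Hf. apply Ccont_local_lip. intros r Hr. destruct (Hf r Hr) as [M []]. now exists M.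
Qed.

Lemma Ccont_hol' f f' u t : hol f f' -> Cmod (u t) < 1 -> Ccont u t ->
  Ccont (fun s => f' (u s)) t.
Proof.
intros Hf. apply Ccont_local_lip. intros r Hr. destruct (Hf r Hr) as [M []]. now exists M.
Qed.

(** * Circle means and the Cauchy formula *)

Definition mean (u : R -> C) : C := (/ RtoC (2 * PI) * CInt u 0 (2 * PI))%C.

Lemma two_PI_neq0 : RtoC (2 * PI) <> RtoC 0.
Proof. intros E. apply RtoC_inj in E. generalize PI_RGT_0. lra. Qed.

Lemma mean_ext u v : (forall t, u t = v t) -> mean u = mean v.
Proof. intros H. unfold mean. now rewrite (CInt_ext u v). Qed.

Lemma mean_plus u v : (forall t, Ccont u t) -> (forall t, Ccont v t) ->
  mean (fun s => u s + v s)%C = (mean u + mean v)%C.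
Proof. intros Hu Hv. unfold mean. rewrite CInt_plus by trivial. ring. Qed.

Lemma mean_scal c u : (forall t, Ccont u t) ->
  mean (fun s => c * u s)%C = (c * mean u)%C.
Proof. intros Hu. unfold mean. rewrite CInt_scal by trivial. ring. Qed.

Lemma mean_minus u v : (forall t, Ccont u t) -> (forall t, Ccont v t) ->
  mean (fun s => u s - v s)%C = (mean u - mean v)%C.
Proof.
intros Hu Hv. rewrite (mean_ext _ (fun s => u s + (- RtoC 1) * v s)%C) by (intros; ring).
rewrite mean_plus, mean_scal; trivial.
- ring.
- intros t. apply Ccont_mult; [apply Ccont_const|apply Hv].
Qed.

Lemma mean_const c : mean (fun _ => c) = c.
Proof.
unfold mean, CInt. rewrite !RInt_const.
transitivity (/ RtoC (2 * PI) * (RtoC (2 * PI) * c))%C.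
- f_equal. apply injective_projections; simpl;
    unfold scal; simpl; unfold mult; simpl; unfold Re, Im; ring.
- field. exact two_PI_neq0.
Qed.

Lemma mean_le u M : (forall t, Ccont u t) -> (forall t, Cmod (u t) <= M) ->
  Cmod (mean u) <= M.
Proof.
intros Hu H. unfold mean. rewrite Cmod_mult, Cmod_inv by exact two_PI_neq0.
rewrite Cmod_R. assert (HP := PI_RGT_0). rewrite Rabs_pos_eq by lra.
apply Rle_trans with (/ (2 * PI) * ((2 * PI - 0) * M)).
- apply Rmult_le_compat_l; [apply Rlt_le, Rinv_0_lt_compat; lra|].
  apply Cmod_CInt_le_const; auto. lra.
- right. field. lra.
Qed.

Lemma Re_mean_le u v : (forall t, Ccont u t) -> (forall t, Ccont v t) ->
  (forall t, Re (u t) <= Re (v t)) -> Re (mean u) <= Re (mean v).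
Proof.
intros Hu Hv H. unfold mean. assert (HP := PI_RGT_0).
rewrite <- RtoC_inv by lra.
assert (E : forall z : C, Re (RtoC (/ (2 * PI)) * z)%C = / (2 * PI) * Re z).
{ intros z. simpl. unfold Re. ring. }
rewrite !E. apply Rmult_le_compat_l; [apply Rlt_le, Rinv_0_lt_compat; lra|].
apply RInt_le; [lra|now apply ex_RInt_Re|now apply ex_RInt_Re|].
intros x _. apply H.
Qed.

Lemma mean_derive u u' : (forall t, Cder u t (u' t)) -> (forall t, Ccont u' t) ->
  u (2 * PI) = u 0 -> mean u' = RtoC 0.
Proof.
intros H Hc E. unfold mean. rewrite (CInt_derive u) by trivial. rewrite E. ring.
Qed.

Definition cis (t : R) : C := (cos t, sin t).

Lemma Cmod_cis t : Cmod (cis t) = 1.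
Proof.
unfold Cmod, cis. simpl. replace (_ + _) with 1; [apply sqrt_1|].
generalize (sin2_cos2 t). unfold Rsqr. lra.
Qed.

Lemma cis_conj t : (cis t * Cconj (cis t))%C = RtoC 1.
Proof. rewrite <- Cmod2_conj, Cmod_cis. f_equal. ring. Qed.

Lemma Cder_cis t : Cder cis t (Ci * cis t)%C.
Proof.
split; simpl; unfold Re, Im; simpl.
- replace (0 * cos t - 1 * sin t) with (1 * - sin t) by ring.
  apply (is_derive_Reals cos). rewrite Rmult_1_l. apply derivable_pt_lim_cos.
- replace (0 * sin t + 1 * cos t) with (cos t) by ring.
  apply (is_derive_Reals sin). apply derivable_pt_lim_sin.
Qed.

Lemma Cder_conj_cis t : Cder (fun s => Cconj (cis s)) t (- Ci * Cconj (cis t))%C.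
Proof.
destruct (Cder_cis t) as [H1 H2]. split.
- simpl in *. unfold Re, Im in *; simpl in *.
  replace (- 0 * cos t - - (1) * - sin t) with (0 * cos t - 1 * sin t) by ring. exact H1.
- simpl in *. unfold Re, Im in *; simpl in *.
  replace (- 0 * - sin t + - (1) * cos t) with (- (0 * sin t + 1 * cos t)) by ring.
  apply (is_derive_opp (V := R_NormedModule)). exact H2.
Qed.

Lemma Cder_pow u t l n : Cder u t (l * u t)%C ->
  Cder (fun s => u s ^ n)%C t (RtoC (INR n) * l * u t ^ n)%C.
Proof.
intros H. induction n as [|n IH].
- simpl. replace (0 * l * 1)%C with (RtoC 0) by ring. apply Cder_const.
- rewrite S_INR, RtoC_plus. simpl.
  replace ((INR n + 1) * l * (u t * u t ^ n))%C
    with (l * u t * u t ^ n + u t * (INR n * l * u t ^ n))%C by ring.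
  now apply Cder_mult.
Qed.

Lemma Ccont_cis t : Ccont cis t.
Proof. exact (Cder_cont _ _ _ (Cder_cis t)). Qed.

Lemma Ccont_conj u t : Ccont u t -> Ccont (fun s => Cconj (u s)) t.
Proof.
intros [H1 H2]. split; simpl; trivial.
now apply (continuous_opp (V := R_NormedModule)).
Qed.

Lemma Ccont_pow u t n : Ccont u t -> Ccont (fun s => u s ^ n)%C t.
Proof.
intros H. induction n as [|n IH]; simpl; [apply Ccont_const|].
now apply Ccont_mult.
Qed.

Lemma cis_period : cis (2 * PI) = cis 0.
Proof. unfold cis. now rewrite cos_2PI, sin_2PI, cos_0, sin_0. Qed.

Lemma Ccont_cis_conj n m t : Ccont (fun s => cis s ^ n * Cconj (cis s) ^ m)%C t.
Proof.
apply Ccont_mult; apply Ccont_pow; [|apply Ccont_conj]; apply Ccont_cis.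
Qed.

Lemma mean_cis n m : mean (fun t => cis t ^ n * Cconj (cis t) ^ m)%C =
  if Nat.eq_dec n m then RtoC 1 else RtoC 0.
Proof.
destruct (Nat.eq_dec n m) as [->|Hnm].
- rewrite (mean_ext _ (fun _ => RtoC 1)); [apply mean_const|].
  intros t. rewrite <- Cpow_mult_l, cis_conj. apply Cpow_1_l.
(* Differentiating the integrand multiplies it by [c], and the derivative of a periodic function has
   mean zero. *)
- set (c := (RtoC (INR n - INR m) * Ci)%C).
  assert (Hc : c <> RtoC 0).
  { apply Cmult_neq_0.
    - intros E. apply RtoC_inj in E. apply Hnm, INR_eq. lra.
    - intros E. injection E. lra. }
  assert (H : mean (fun t => c * (cis t ^ n * Cconj (cis t) ^ m))%C = RtoC 0).
  { apply (mean_derive (fun t => cis t ^ n * Cconj (cis t) ^ m)%C).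
    - intros t. unfold c.
      replace ((INR n - INR m)%R * Ci * (cis t ^ n * Cconj (cis t) ^ m))%C with
       ((RtoC (INR n) * Ci * cis t ^ n) * Cconj (cis t) ^ m
          + cis t ^ n * (RtoC (INR m) * (- Ci) * Cconj (cis t) ^ m))%C
        by (rewrite RtoC_minus; ring).
      apply (Cder_mult (fun t => cis t ^ n)%C (fun t => Cconj (cis t) ^ m)%C).
      + apply Cder_pow, Cder_cis.
      + apply (Cder_pow (fun t => Cconj (cis t))), Cder_conj_cis.
    - intros t. apply Ccont_mult; [apply Ccont_const|apply Ccont_cis_conj].
    - now rewrite cis_period. }
  rewrite mean_scal in H by (intros; apply Ccont_cis_conj).
  replace (mean _) with (/ c * (c * mean (fun t => cis t ^ n * Cconj (cis t) ^ m)))%C.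
  + rewrite H. ring.
  + field. exact Hc.
Qed.

Fixpoint Csum (a : nat -> C) (n : nat) : C :=
  match n with O => RtoC 0 | S n => (Csum a n + a n)%C end.

Lemma Ccont_Csum (a : nat -> R -> C) N t : (forall n, Ccont (a n) t) ->
  Ccont (fun s => Csum (fun n => a n s) N) t.
Proof.
intros H. induction N as [|N IH]; simpl; [apply Ccont_const|].
now apply Ccont_plus.
Qed.

Lemma mean_Csum (a : nat -> R -> C) N : (forall n t, Ccont (a n) t) ->
  mean (fun s => Csum (fun n => a n s) N) = Csum (fun n => mean (a n)) N.
Proof.
intros H. induction N as [|N IH]; simpl; [apply mean_const|].
rewrite mean_plus, IH; trivial. intros t. now apply Ccont_Csum.
Qed.

Lemma Csum_ext a b N : (forall n, (n < N)%nat -> a n = b n) -> Csum a N = Csum b N.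
Proof.
intros H. induction N as [|N IH]; simpl; trivial.
rewrite IH by auto. now rewrite H by lia.
Qed.

Lemma Csum_mult_r a c N : (Csum a N * c)%C = Csum (fun n => a n * c)%C N.
Proof.
induction N as [|N IH]; simpl; [ring|]. rewrite <- IH. ring.
Qed.

Lemma Csum_delta (c : nat -> C) n N :
  Csum (fun m => c m * (if Nat.eq_dec m n then RtoC 1 else RtoC 0))%C N
  = if lt_dec n N then c n else RtoC 0.
Proof.
induction N as [|N IH]; simpl.
- destruct (lt_dec n 0); [lia|reflexivity].
- rewrite IH. destruct (Nat.eq_dec N n) as [->|H].
  + destruct (lt_dec n n); [lia|]. destruct (lt_dec n (S n)); [ring|lia].
  + destruct (lt_dec n N), (lt_dec n (S N)); try lia; ring.
Qed.

(** * The Cauchy kernel and the Cauchy formula *)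

Definition circ (r t : R) : C := (RtoC r * cis t)%C.

Lemma Cmod_circ r t : 0 <= r -> Cmod (circ r t) = r.
Proof.
intros Hr. unfold circ. rewrite Cmod_mult, Cmod_cis, Cmod_R, Rabs_pos_eq; trivial. ring.
Qed.

Lemma Ccont_circ r t : Ccont (circ r) t.
Proof. apply Ccont_mult; [apply Ccont_const|apply Ccont_cis]. Qed.

Lemma Ccont_hol_circ f f' r t : hol f f' -> 0 <= r < 1 -> Ccont (fun s => f (circ r s)) t.
Proof.
intros Hf Hr. apply (Ccont_hol f f' (circ r) t Hf); [|apply Ccont_circ].
rewrite Cmod_circ; lra.
Qed.

(** With zeta = [circ r t] one has d zeta = i zeta dt, so the mean of f against [kern] is the Cauchy
    integral of f(zeta) / (zeta - w), divided by 2 pi i. *)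
Definition kern (r : R) (w : C) (t : R) : C := (circ r t / (circ r t - w))%C.

Section Kernel.

Variables (r : R) (w : C).
Hypothesis Hr : 0 < r.
Hypothesis Hw : Cmod w < r.

Lemma circ_minus_ge t : r - Cmod w <= Cmod (circ r t - w).
Proof.
apply Rle_trans with (2 := Cmod_triangle_inv _ _). rewrite Cmod_circ by lra. lra.
Qed.

Lemma circ_minus_neq0 t : (circ r t - w)%C <> RtoC 0.
Proof. apply Cmod_gt_0. generalize (circ_minus_ge t). lra. Qed.

Lemma Cmod_kern_le t : Cmod (kern r w t) <= r / (r - Cmod w).
Proof.
unfold kern. rewrite Cmod_div by apply circ_minus_neq0. rewrite Cmod_circ by lra.
apply Rmult_le_compat_l; [lra|]. apply Rinv_le_contravar; [lra|apply circ_minus_ge].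
Qed.

Lemma Ccont_kern t : Ccont (kern r w) t.
Proof.
set (m := r - Cmod w). assert (Hm : 0 < m) by (unfold m; lra).
apply (Ccont_lip (fun z => z / (z - w))%C (fun z => m <= Cmod (z - w)) (Cmod w / m ^ 2) (circ r)).
- apply Rmult_le_pos; [apply Cmod_ge_0|]. apply Rlt_le, Rinv_0_lt_compat. nra.
- intros a b Ha Hb.
  assert (Ha0 : (a - w)%C <> RtoC 0) by (apply Cmod_gt_0; lra).
  assert (Hb0 : (b - w)%C <> RtoC 0) by (apply Cmod_gt_0; lra).
  replace (a / (a - w) - b / (b - w))%C with (- (w * (a - b)) / ((a - w) * (b - w)))%C
    by (field; split; trivial).
  rewrite Cmod_div by now apply Cmult_neq_0. rewrite Cmod_opp, !Cmod_mult.
  replace (Cmod w / m ^ 2 * Cmod (a - b)) with (Cmod w * Cmod (a - b) * / m ^ 2)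
    by (unfold Rdiv; ring).
  apply Rmult_le_compat_l.
  + apply Rmult_le_pos; apply Cmod_ge_0.
  + apply Rinv_le_contravar; [nra|]. simpl. rewrite Rmult_1_r.
    apply Rmult_le_compat; lra.
- apply circ_minus_ge.
- apply Ccont_circ.
Qed.

(** Iterates kern = 1 + (w / r) conj(cis t) kern. The remainder is exact, so no interchange of a
    series with an integral arises. *)
Lemma kern_expand t N :
  kern r w t = (Csum (fun n => (w / r) ^ n * Cconj (cis t) ^ n) N
    + ((w / r) ^ N * Cconj (cis t) ^ N) * kern r w t)%C.
Proof.
assert (Hr0 : RtoC r <> RtoC 0) by (intros E; apply RtoC_inj in E; lra).
assert (H : ((w / r) * Cconj (cis t) * kern r w t + 1)%C = kern r w t).
{ unfold kern. assert (H1 := circ_minus_neq0 t).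
  replace (w / r * Cconj (cis t) * (circ r t / (circ r t - w)))%C
    with (w * (cis t * Cconj (cis t)) / (circ r t - w))%C
    by (unfold circ in *; field; split; trivial).
  rewrite cis_conj. field. trivial. }
induction N as [|N IH]; simpl; [ring|].
rewrite IH at 1. set (q := (w / r)%C) in *. set (e := Cconj (cis t)) in *.
rewrite <- H at 1. ring.
Qed.

(** With g = 1 this gives the total mass of the kernel; with g a holomorphic function on the circle
    it gives the Taylor expansion. *)
Lemma mean_kern_expand g B N : (forall t, Ccont g t) -> 0 <= B ->
  (forall t, Cmod (g t) <= B) ->
  Cmod (mean (fun t => g t * kern r w t)%C
    - Csum (fun n => mean (fun t => g t * Cconj (cis t) ^ n) * (w / r) ^ n)%C N)
  <= B * (Cmod w / r) ^ N * (r / (r - Cmod w)).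
Proof.
intros Hg HB HgB.
assert (Hr0 : RtoC r <> RtoC 0) by (intros E; apply RtoC_inj in E; lra).
assert (Hcj : forall n t, Ccont (fun s => g s * Cconj (cis s) ^ n)%C t).
{ intros n t. apply Ccont_mult; trivial. apply Ccont_pow, Ccont_conj, Ccont_cis. }
set (R1 := fun t => (((w / r) ^ N * Cconj (cis t) ^ N) * kern r w t)%C).
assert (HR1 : forall t, Ccont R1 t).
{ intros t. apply Ccont_mult; [|apply Ccont_kern].
  apply Ccont_mult; [apply Ccont_const|apply Ccont_pow, Ccont_conj, Ccont_cis]. }
rewrite (mean_ext _ (fun t => Csum (fun n => (w / r) ^ n * (g t * Cconj (cis t) ^ n))%C N
  + g t * R1 t)%C).
- rewrite mean_plus.
  + rewrite (mean_Csum (fun n t => (w / r) ^ n * (g t * Cconj (cis t) ^ n))%C).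
    * rewrite (Csum_ext (fun n => mean (fun t => (w / r) ^ n * (g t * Cconj (cis t) ^ n)))%C
        (fun n => mean (fun t => g t * Cconj (cis t) ^ n) * (w / r) ^ n)%C).
      2:{ intros n _. rewrite mean_scal by apply Hcj. ring. }
      set (S1 := Csum _ N). replace (S1 + mean (fun t => g t * R1 t) - S1)%C
        with (mean (fun t => g t * R1 t)%C) by ring.
      apply mean_le.
      -- intros t. now apply Ccont_mult.
      -- intros t. unfold R1. rewrite !Cmod_mult, !Cmod_pow, Cmod_conj, Cmod_cis, pow1, Rmult_1_r.
         rewrite Cmod_div, Cmod_R, (Rabs_pos_eq r) by (trivial; lra).
         rewrite Rmult_assoc. apply Rmult_le_compat; auto; try apply Cmod_ge_0.
         ++ apply Rmult_le_pos; [|apply Cmod_ge_0]. apply pow_le.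
            apply Rmult_le_pos; [apply Cmod_ge_0|]. apply Rlt_le, Rinv_0_lt_compat; lra.
         ++ apply Rmult_le_compat_l; [|apply Cmod_kern_le]. apply pow_le.
            apply Rmult_le_pos; [apply Cmod_ge_0|]. apply Rlt_le, Rinv_0_lt_compat; lra.
    * intros n t. apply Ccont_mult; [apply Ccont_const|apply Hcj].
  + intros t. apply (Ccont_Csum (fun n t => (w / r) ^ n * (g t * Cconj (cis t) ^ n))%C).
    intros n. apply Ccont_mult; [apply Ccont_const|apply Hcj].
  + intros t. now apply Ccont_mult.
- intros t. rewrite (kern_expand t N) at 1. fold (R1 t).
  transitivity (Csum (fun n => (w / r) ^ n * Cconj (cis t) ^ n)%C N * g t + g t * R1 t)%C; [ring|].
  rewrite Csum_mult_r. f_equal. apply Csum_ext. intros n _. ring.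
Qed.

Lemma ratio_lt1 : 0 <= Cmod w / r < 1.
Proof.
split.
- apply Rmult_le_pos; [apply Cmod_ge_0|]. apply Rlt_le, Rinv_0_lt_compat; lra.
- apply Rmult_lt_reg_r with r; trivial. unfold Rdiv. rewrite Rmult_assoc, Rinv_l; lra.
Qed.

Lemma kern_remainder_small B e : 0 <= B -> 0 < e ->
  exists N0, forall N, (N0 <= N)%nat -> B * (Cmod w / r) ^ N * (r / (r - Cmod w)) <= e.
Proof.
intros HB He.
set (K := B * (r / (r - Cmod w))).
assert (HK : 0 <= K).
{ apply Rmult_le_pos; trivial. apply Rlt_le, Rdiv_lt_0_compat; lra. }
destruct (geom_small (Cmod w / r) K e) as [N HN]; trivial; [apply ratio_lt1|].
exists N. intros n Hn. apply Rle_trans with (2 := HN n Hn). right. unfold K. ring.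
Qed.

Lemma mean_kern : mean (kern r w) = RtoC 1.
Proof.
apply eq_of_Cmod_le_eps. intros e He.
destruct (kern_remainder_small 1 e ltac:(lra) He) as [N0 HN].
apply Rle_trans with (2 := HN (S N0) ltac:(lia)).
assert (H := mean_kern_expand (fun _ => RtoC 1) 1 (S N0)).
rewrite (mean_ext _ (kern r w)) in H by (intros; ring).
rewrite (Csum_ext _ (fun n => (w / r) ^ n * (if Nat.eq_dec n 0 then RtoC 1 else RtoC 0))%C) in H.
- rewrite Csum_delta in H. destruct (lt_dec 0 (S N0)); [|lia].
  apply H.
  + intros; apply Ccont_const.
  + lra.
  + intros. rewrite Cmod_1. lra.
- intros n _. rewrite (mean_ext _ (fun t => cis t ^ 0 * Cconj (cis t) ^ n)%C) by reflexivity.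
  rewrite mean_cis. destruct (Nat.eq_dec 0 n), (Nat.eq_dec n 0); try lia; ring.
Qed.

End Kernel.

(* Along the homotopy [w + s (circ r t - w)], [0 <= s <= 1], the mean of [f] against the kernel
   has zero derivative, since its integrand is a [t]-derivative. *)
Lemma cauchy_formula f f' r w : hol f f' -> 0 < r < 1 -> Cmod w < r ->
  f w = mean (fun t => f (circ r t) * kern r w t)%C.
Proof.
intros Hf Hr Hw.
set (b := fun s t => (w + RtoC s * (circ r t - w))%C).
assert (Hb : forall s t, 0 <= s <= 1 -> Cmod (b s t) <= r).
{ intros s t Hs. unfold b.
  replace (w + s * (circ r t - w))%C with (RtoC (1 - s) * w + RtoC s * circ r t)%C
    by (rewrite RtoC_minus; ring).
  apply Rle_trans with (1 := Cmod_triangle _ _).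
  rewrite !Cmod_mult, !Cmod_R, Cmod_circ, !Rabs_pos_eq by lra. nra. }
assert (bc : forall s t, Ccont (b s) t).
{ intros s t. apply Ccont_plus; [apply Ccont_const|].
  apply Ccont_mult; [apply Ccont_const|].
  apply Ccont_minus; [apply Ccont_circ|apply Ccont_const]. }
assert (fc : forall s t, 0 <= s <= 1 -> Ccont (fun t => f (b s t)) t).
{ intros s t Hs. apply (Ccont_hol f f' (b s)); auto. generalize (Hb s t Hs). lra. }
assert (fc' : forall s t, 0 <= s <= 1 -> Ccont (fun t => f' (b s t)) t).
{ intros s t Hs. apply (Ccont_hol' f f' (b s)); auto. generalize (Hb s t Hs). lra. }
assert (kc : forall t, Ccont (kern r w) t) by (apply Ccont_kern; lra).
assert (zero : forall s, 0 <= s <= 1 -> mean (fun t => f' (b s t) * circ r t)%C = RtoC 0).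
(* The t-derivative of f(b s t) is s i f'(b s t) circ r t, which gives the claim after division by
   s. At s = 0 the integrand is a constant multiple of cis t. *)
{ intros s Hs. destruct (Req_dec s 0) as [->|Hs0].
  - rewrite (mean_ext _ (fun t => (f' w * r) * (cis t ^ 1 * Cconj (cis t) ^ 0))%C).
    + rewrite mean_scal by (intros; apply Ccont_cis_conj). rewrite mean_cis. simpl. ring.
    + intros t. unfold b, circ. replace (w + 0 * (r * cis t - w))%C with w by ring. simpl. ring.
  - assert (H : mean (fun t => (s * Ci) * (f' (b s t) * circ r t))%C = RtoC 0).
    { apply (mean_derive (fun t => f (b s t))).
      - intros t. replace (s * Ci * (f' (b s t) * circ r t))%C
          with (f' (b s t) * (s * (Ci * circ r t)))%C by ring.
        apply Cder_hol; trivial.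
        + generalize (Hb s t Hs). lra.
        + replace (s * (Ci * circ r t))%C with
            (0 + (0 * (circ r t - w) + s * ((0 * cis t + r * (Ci * cis t)) - 0)))%C
            by (unfold circ; ring).
          apply Cder_plus; [apply Cder_const|].
          apply (Cder_mult (fun _ => RtoC s) (fun t => circ r t - w)%C); [apply Cder_const|].
          apply Cder_minus; [|apply Cder_const].
          apply (Cder_mult (fun _ => RtoC r) cis); [apply Cder_const|apply Cder_cis].
      - intros t. apply Ccont_mult; [apply Ccont_const|].
        apply Ccont_mult; [auto|apply Ccont_circ].
      - unfold b, circ. now rewrite cis_period. }
    rewrite mean_scal in H.
    2:{ intros t. apply Ccont_mult; [auto|apply Ccont_circ]. }
    assert (Hs' : RtoC s <> RtoC 0) by (intros E; apply RtoC_inj in E; lra).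
    assert (Hci : Ci <> RtoC 0) by (intros E; injection E; lra).
    replace (mean _) with (/ (s * Ci) * (s * Ci * mean (fun t => f' (b s t) * circ r t)))%C
      by (field; split; trivial).
    rewrite H. ring. }
set (Fm := fun s => mean (fun t => f (b s t) * kern r w t)%C).
destruct (Hf r ltac:(lra)) as [M HM].
assert (HM0 := C11_ge0 _ _ _ _ HM).
set (Kb := r / (r - Cmod w)).
assert (HKb : 0 <= Kb) by (apply Rlt_le, Rdiv_lt_0_compat; lra).
(* The first-order part of an increment of [Fm] is the vanishing mean [zero] and the rest is
   quadratic, so [chain_bound] applies with m = 0. *)
assert (chain : Cmod (Fm 1 - Fm 0) <= 0 * 1).
{ apply (chain_bound (fun s s' => Cmod (Fm s' - Fm s)) 1 0 (M * (2 * r) ^ 2 * Kb)).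
  - lra.
  - apply Rmult_le_pos; trivial. apply Rmult_le_pos; trivial. apply pow2_ge_0.
  - intros s1 s2 s3 _ _. replace (Fm s3 - Fm s1)%C with ((Fm s2 - Fm s1) + (Fm s3 - Fm s2))%C by ring.
    apply Cmod_triangle.
  - intros s s' Hs Hs'. rewrite Rmult_0_l, Rplus_0_l.
    set (rem := fun t => (f (b s' t) - f (b s t) - f' (b s t) * (b s' t - b s t))%C).
    assert (remc : forall t, Ccont rem t).
    { intros t. apply Ccont_minus; [apply Ccont_minus; apply fc; lra|].
      apply Ccont_mult; [apply fc'; lra|]. now apply Ccont_minus. }
    replace (Fm s' - Fm s)%C with (mean (fun t => rem t * kern r w t)%C).
    + apply mean_le.
      * intros t. now apply Ccont_mult.
      * intros t. rewrite Cmod_mult.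
        replace (M * (2 * r) ^ 2 * Kb * (s' - s) ^ 2) with ((M * ((s' - s) * (2 * r)) ^ 2) * Kb) by ring.
        apply Rmult_le_compat; try apply Cmod_ge_0; [|apply Cmod_kern_le; lra].
        apply Rle_trans with (M * Cmod (b s' t - b s t) ^ 2).
        -- apply HM; apply Hb; lra.
        -- apply Rmult_le_compat_l; trivial. apply pow_incr. split; [apply Cmod_ge_0|].
           replace (b s' t - b s t)%C with (RtoC (s' - s) * (circ r t - w))%C
             by (unfold b; rewrite RtoC_minus; ring).
           rewrite Cmod_mult, Cmod_R, Rabs_pos_eq by lra.
           apply Rmult_le_compat_l; [lra|].
           apply Rle_trans with (1 := Cmod_minus_le _ _). rewrite Cmod_circ; lra.
    + unfold Fm.
      rewrite (mean_ext (fun t => rem t * kern r w t)%C (fun t =>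
        (f (b s' t) * kern r w t - f (b s t) * kern r w t)
          - RtoC (s' - s) * (f' (b s t) * circ r t))%C).
      * rewrite mean_minus.
        -- rewrite mean_minus.
           ++ rewrite mean_scal.
              ** rewrite zero by lra. ring.
              ** intros t. apply Ccont_mult; [apply fc'; lra|apply Ccont_circ].
           ++ intros t. apply Ccont_mult; [apply fc; lra|apply kc].
           ++ intros t. apply Ccont_mult; [apply fc; lra|apply kc].
        -- intros t. apply Ccont_minus; (apply Ccont_mult; [apply fc; lra|apply kc]).
        -- intros t. apply Ccont_mult; [apply Ccont_const|].
           apply Ccont_mult; [apply fc'; lra|apply Ccont_circ].
      * intros t. unfold rem.
        (* The factor circ r t - w from the increment of b cancels the denominator of the kernel and
           leaves the integrand of [zero]. *)
        assert (E : ((circ r t - w) * kern r w t)%C = circ r t).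
        { unfold kern. field. apply circ_minus_neq0; lra. }
        replace (b s' t - b s t)%C with (RtoC (s' - s) * (circ r t - w))%C
          by (unfold b; rewrite RtoC_minus; ring).
        replace (RtoC (s' - s) * (f' (b s t) * circ r t))%C
          with (RtoC (s' - s) * (f' (b s t) * ((circ r t - w) * kern r w t)))%C
          by (now rewrite E).
        ring. }
rewrite Rmult_0_l in chain.
assert (E1 : Fm 1 = mean (fun t => f (circ r t) * kern r w t)%C).
{ apply mean_ext. intros t. do 2 f_equal. unfold b. ring. }
assert (E0 : Fm 0 = f w).
{ unfold Fm. rewrite (mean_ext _ (fun t => f w * kern r w t)%C).
  - rewrite mean_scal by trivial. rewrite mean_kern by lra. ring.
  - intros t. do 2 f_equal. unfold b. ring. }
rewrite <- E1, <- E0. symmetry. apply eq_of_Cmod_le_eps. intros e He. lra.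
Qed.

Lemma mean_value f f' r : hol f f' -> 0 < r < 1 ->
  mean (fun t => f (circ r t)) = f 0.
Proof.
intros Hf Hr. rewrite (cauchy_formula f f' r 0); trivial.
- apply mean_ext. intros t. unfold kern.
  assert (H := circ_minus_neq0 r 0 ltac:(lra) ltac:(rewrite Cmod_0; lra) t).
  replace (circ r t - 0)%C with (circ r t) in * by ring.
  field. exact H.
- rewrite Cmod_0. lra.
Qed.

(** * Fourier coefficients and Bessel's inequality *)

Definition fourier (g : R -> C) (n : nat) : C := mean (fun t => g t * Cconj (cis t) ^ n)%C.

Lemma Ccont_fourier g n t : (forall t, Ccont g t) ->
  Ccont (fun t => g t * Cconj (cis t) ^ n)%C t.
Proof.
intros H. apply Ccont_mult; trivial. apply Ccont_pow, Ccont_conj, Ccont_cis.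
Qed.

Lemma Cmod_fourier_le g n M : (forall t, Ccont g t) -> (forall t, Cmod (g t) <= M) ->
  Cmod (fourier g n) <= M.
Proof.
intros Hg HM. apply mean_le.
- intros t. now apply Ccont_fourier.
- intros t. rewrite Cmod_mult, Cmod_pow, Cmod_conj, Cmod_cis, pow1, Rmult_1_r. apply HM.
Qed.

Lemma fourier_minus g h n : (forall t, Ccont g t) -> (forall t, Ccont h t) ->
  fourier (fun t => g t - h t)%C n = (fourier g n - fourier h n)%C.
Proof.
intros Hg Hh. unfold fourier. rewrite <- mean_minus by (intros; now apply Ccont_fourier).
apply mean_ext. intros t. ring.
Qed.

Lemma fourier_Csum (c : nat -> C) N n :
  fourier (fun t => Csum (fun m => c m * cis t ^ m)%C N) n
  = if lt_dec n N then c n else RtoC 0.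
Proof.
rewrite <- Csum_delta. unfold fourier.
rewrite (mean_ext _ (fun t => Csum (fun m => c m * (cis t ^ m * Cconj (cis t) ^ n))%C N)).
- rewrite (mean_Csum (fun m t => c m * (cis t ^ m * Cconj (cis t) ^ n))%C).
  + apply Csum_ext. intros m _. rewrite mean_scal by (intros; apply Ccont_cis_conj).
    now rewrite mean_cis.
  + intros m t. apply Ccont_mult; [apply Ccont_const|apply Ccont_cis_conj].
- intros t. rewrite Csum_mult_r. apply Csum_ext. intros m _. ring.
Qed.

Lemma Ccont_trig_poly (c : nat -> C) N t :
  Ccont (fun t => Csum (fun m => c m * cis t ^ m)%C N) t.
Proof.
apply (Ccont_Csum (fun m t => c m * cis t ^ m)%C). intros n.
apply Ccont_mult; [apply Ccont_const|apply Ccont_pow, Ccont_cis].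
Qed.

Lemma fourier_of_uniform g (c : nat -> C) n : (forall t, Ccont g t) ->
  (forall e, 0 < e -> exists N, (n < N)%nat /\
    forall t, Cmod (g t - Csum (fun m => c m * cis t ^ m)%C N) <= e) ->
  fourier g n = c n.
Proof.
intros Hg H. apply eq_of_Cmod_le_eps. intros e He. destruct (H e He) as [N [HN HgN]].
assert (E := fourier_Csum c N n). destruct (lt_dec n N); [|lia].
rewrite <- E, <- fourier_minus; trivial.
- apply Cmod_fourier_le; trivial.
  intros t. apply Ccont_minus; [apply Hg|apply Ccont_trig_poly].
- intros t. apply Ccont_trig_poly.
Qed.

Fixpoint Rsum (a : nat -> R) (n : nat) : R :=
  match n with O => 0 | S n => Rsum a n + a n end.

Lemma Re_mean_conj u : Re (mean (fun t => Cconj (u t))) = Re (mean u).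
Proof.
unfold mean. rewrite <- RtoC_inv by (generalize PI_RGT_0; lra).
unfold CInt, Re, Im, Cconj. simpl. ring.
Qed.

(** The mean square of g minus its N-th partial sum is nonnegative. By induction it equals the mean
    square of g less the first N squared coefficients. *)
Lemma bessel g N : (forall t, Ccont g t) ->
  Rsum (fun n => Cmod (fourier g n) ^ 2) N <= Re (mean (fun t => g t * Cconj (g t))%C).
Proof.
intros Hg.
set (D := fun N t => (g t - Csum (fun m => fourier g m * cis t ^ m)%C N)%C).
assert (Dc : forall N t, Ccont (D N) t).
{ intros K t. apply Ccont_minus; [apply Hg|apply Ccont_trig_poly]. }
assert (DDc : forall N t, Ccont (fun t => D N t * Cconj (D N t))%C t).
{ intros K t. apply Ccont_mult; [apply Dc|apply Ccont_conj, Dc]. }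
assert (H : forall N, Re (mean (fun t => D N t * Cconj (D N t))%C)
  = Re (mean (fun t => g t * Cconj (g t))%C) - Rsum (fun n => Cmod (fourier g n) ^ 2) N).
{ clear N. induction N as [|N IH].
  - simpl Rsum. rewrite Rminus_0_r. f_equal. apply mean_ext. intros t. unfold D. simpl Csum.
    replace (g t - 0)%C with (g t) by ring. reflexivity.
  - change (Rsum (fun n => Cmod (fourier g n) ^ 2) (S N))
      with (Rsum (fun n => Cmod (fourier g n) ^ 2) N + Cmod (fourier g N) ^ 2).
    set (x := fourier g N).
    (* The partial sum in [D N] stops at index N - 1, so its N-th coefficient vanishes. *)
    assert (HD : fourier (D N) N = x).
    { unfold D. rewrite fourier_minus; trivial.
      - rewrite fourier_Csum. destruct (lt_dec N N); [lia|]. unfold x. ring.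
      - intros t. apply Ccont_trig_poly. }
    set (v := fun t => (Cconj x * (D N t * Cconj (cis t) ^ N))%C).
    assert (vc : forall t, Ccont v t).
    { intros t. apply Ccont_mult; [apply Ccont_const|]. apply Ccont_fourier, Dc. }
    rewrite (mean_ext _ (fun t => (D N t * Cconj (D N t) + x * Cconj x)
       - (v t + Cconj (v t)))%C).
    + rewrite mean_minus, mean_plus, mean_const.
      * rewrite mean_plus.
        -- assert (Ev : mean v = (Cconj x * x)%C).
           { unfold v. rewrite mean_scal; [|intros; apply Ccont_fourier, Dc].
             f_equal. exact HD. }
           assert (Ec : Re (mean (fun t => Cconj (v t))) = Re (mean v)).
           { apply Re_mean_conj. }
           assert (Ex := Cmod2_alt x).
           rewrite Ev in Ec.
           transitivity (Re (mean (fun t => D N t * Cconj (D N t))%C) + Re (x * Cconj x)%C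
             - (Re (mean v) + Re (mean (fun t => Cconj (v t))))).
           { unfold Re; simpl; ring. }
           rewrite IH, Ev, Ec, Ex. unfold Re, Im. simpl. ring.
        -- exact vc.
        -- intros t. now apply Ccont_conj.
      * intros t. apply DDc.
      * intros t. apply Ccont_const.
      * intros t. apply Ccont_plus; [apply DDc|apply Ccont_const].
      * intros t. apply Ccont_plus; [apply vc|now apply Ccont_conj].
    + intros t. unfold v.
      assert (E1 : D (S N) t = (D N t - x * cis t ^ N)%C) by (unfold D, x; simpl; ring).
      assert (E2 : (cis t ^ N * Cconj (cis t) ^ N)%C = RtoC 1).
      { rewrite <- Cpow_mult_l, cis_conj. apply Cpow_1_l. }
      rewrite E1. rewrite !Cminus_conj, !Cmult_conj, !Cpow_conj, !Cconj_conj.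
      transitivity (D N t * Cconj (D N t) + x * Cconj x * (cis t ^ N * Cconj (cis t) ^ N)
         - (Cconj x * (D N t * Cconj (cis t) ^ N) + x * (Cconj (D N t) * cis t ^ N)))%C.
      * ring.
      * rewrite E2. ring. }
assert (K : Re (mean (fun _ => RtoC 0)) <= Re (mean (fun t => D N t * Cconj (D N t))%C)).
{ apply Re_mean_le; [intros; apply Ccont_const|apply DDc|].
  intros t. rewrite <- Cmod2_conj. simpl. apply (pow2_ge_0 (Cmod (D N t))). }
rewrite H, mean_const in K. change (Re (RtoC 0)) with 0 in K. lra.
Qed.

(** * Power series in the Hardy space *)

(** The same componentwise form as [H2_fun], so that [f z] is convertible to a [CSeries]. *)
Definition CSeries (a : nat -> C) : C :=
  (Series (fun n => Re (a n)), Series (fun n => Im (a n))).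

Definition Csummable (a : nat -> C) : Prop := ex_series (fun n => Cmod (a n)).

Lemma Csummable_le a b : (forall n, Cmod (a n) <= b n) -> ex_series b -> Csummable a.
Proof.
intros H Hb. apply (ex_series_le (V := R_CompleteNormedModule) _ b); trivial.
intros n. change (Rabs (Cmod (a n)) <= b n).
rewrite Rabs_pos_eq by apply Cmod_ge_0. apply H.
Qed.

Lemma ex_series_Re a : Csummable a -> ex_series (fun n => Re (a n)).
Proof.
intros H. apply (ex_series_le (V := R_CompleteNormedModule) _ (fun n => Cmod (a n))); trivial.
intros n. apply re_le_Cmod.
Qed.

Lemma ex_series_Im a : Csummable a -> ex_series (fun n => Im (a n)).
Proof.
intros H. apply (ex_series_le (V := R_CompleteNormedModule) _ (fun n => Cmod (a n))); trivial.
intros n. apply im_le_Cmod.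
Qed.

Lemma CSeries_ext a b : (forall n, a n = b n) -> CSeries a = CSeries b.
Proof. intros H. unfold CSeries. f_equal; apply Series_ext; intros; now rewrite H. Qed.

(** Real and imaginary parts are bounded separately, whence the factor 2. *)
Lemma CSeries_le a b : (forall n, Cmod (a n) <= b n) -> ex_series b ->
  Cmod (CSeries a) <= 2 * Series b.
Proof.
intros H Hb. apply Rle_trans with (1 := Cmod_le_ReIm _). simpl.
assert (P : forall c : nat -> R, (forall n, Rabs (c n) <= b n) -> Rabs (Series c) <= Series b).
{ intros c Hc. apply Rle_trans with (Series (fun n => Rabs (c n))).
  - apply Series_Rabs. apply (ex_series_le (V := R_CompleteNormedModule) _ b); trivial.
    intros n. change (Rabs (Rabs (c n)) <= b n). now rewrite Rabs_Rabsolu.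
  - apply Series_le; trivial. intros n. split; [apply Rabs_pos|trivial]. }
assert (P1 := P (fun n => Re (a n)) (fun n => Rle_trans _ _ _ (re_le_Cmod _) (H n))).
assert (P2 := P (fun n => Im (a n)) (fun n => Rle_trans _ _ _ (im_le_Cmod _) (H n))).
lra.
Qed.

Lemma CSeries_minus a b : Csummable a -> Csummable b ->
  CSeries (fun n => a n - b n)%C = (CSeries a - CSeries b)%C.
Proof.
intros Ha Hb. unfold CSeries. apply injective_projections; simpl.
- exact (Series_minus _ _ (ex_series_Re _ Ha) (ex_series_Re _ Hb)).
- exact (Series_minus _ _ (ex_series_Im _ Ha) (ex_series_Im _ Hb)).
Qed.

Lemma CSeries_mult_r a (c : C) : Csummable a -> CSeries (fun n => a n * c)%C = (CSeries a * c)%C.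
Proof.
intros Ha. unfold CSeries.
assert (H1 := ex_series_Re _ Ha). assert (H2 := ex_series_Im _ Ha).
assert (E1 : forall k, ex_series (fun n => Re (a n) * k)).
{ intros k. now apply ex_series_scal_r. }
assert (E2 : forall k, ex_series (fun n => Im (a n) * k)).
{ intros k. now apply ex_series_scal_r. }
apply injective_projections; simpl.
- rewrite <- !Series_scal_r, <- Series_minus by auto. reflexivity.
- rewrite <- !Series_scal_r, <- Series_plus by auto. reflexivity.
Qed.

Lemma CSeries_split a N : Csummable a ->
  CSeries a = (Csum a N + CSeries (fun n => a (N + n)%nat))%C.
Proof.
intros Ha. induction N as [|N IH].
- simpl Csum. rewrite Cplus_0_l. now apply CSeries_ext.
- rewrite IH. simpl. rewrite <- Cplus_assoc. f_equal.
  assert (Hs : Csummable (fun n => a (N + n)%nat))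
    by exact (proj1 (ex_series_incr_n (V := R_NormedModule) (fun n => Cmod (a n)) N) Ha).
  apply injective_projections; simpl.
  + rewrite Series_incr_1 by now apply ex_series_Re. rewrite Nat.add_0_r. f_equal.
    apply Series_ext. intros n. now rewrite Nat.add_succ_r.
  + rewrite Series_incr_1 by now apply ex_series_Im. rewrite Nat.add_0_r. f_equal.
    apply Series_ext. intros n. now rewrite Nat.add_succ_r.
Qed.

(** Each of the n terms of 1 + t + ... + t^(n-1) = (1 - t^n) / (1 - t) is at least t^n. In
    particular n t^n stays below 1 / (1 - t). *)
Lemma n_pow_le t n : 0 <= t < 1 -> INR n * t ^ n * (1 - t) <= 1 - t ^ n.
Proof.
intros Ht. induction n as [|n IH].
- simpl. lra.
- rewrite S_INR. simpl.
  assert (0 <= t ^ n) by (apply pow_le; lra).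
  assert (t * t ^ n <= 1).
  { assert (t ^ n <= 1) by (rewrite <- (pow1 n); apply pow_incr; lra). nra. }
  assert (INR n * t ^ n * (1 - t) * t <= (1 - t ^ n) * t) by (apply Rmult_le_compat_r; lra).
  nra.
Qed.

(** For p = t^4 one has n^2 p^n = (n t^n)^2 t^(2n), where the first factor is bounded and the second
    is geometric. *)
Lemma ex_series_sq_pow r : r < 1 -> exists p, 0 < p < 1 /\ r <= p /\
  ex_series (fun n => INR n ^ 2 * p ^ n).
Proof.
(* Then (1 - x)^4 >= 1 - 4 x = max(r, 0) >= r. *)
intros Hr. set (x := (1 - Rmax r 0) / 4).
assert (H0 : 0 <= Rmax r 0 < 1) by (split; [apply Rmax_r|apply Rmax_lub_lt; lra]).
assert (Hx : 0 < x <= 1 / 4) by (unfold x; lra).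
set (t := 1 - x). assert (Ht : 0 < t < 1) by (unfold t; lra).
exists (t ^ 4). split; [|split].
- split; [apply pow_lt; lra|]. simpl. assert (t * t < 1) by nra.
  assert (0 < t * t) by nra. nra.
- apply Rle_trans with (1 - 4 * x).
  + unfold x. generalize (Rmax_l r 0). lra.
  + assert (1 - 2 * x <= t ^ 2) by (unfold t; nra).
    replace (t ^ 4) with (t ^ 2 * t ^ 2) by ring. nra.
- apply (ex_series_le (V := R_CompleteNormedModule) _ (fun n => (/ (1 - t)) ^ 2 * (t ^ 2) ^ n)).
  + intros n. change (Rabs (INR n ^ 2 * (t ^ 4) ^ n) <= (/ (1 - t)) ^ 2 * (t ^ 2) ^ n).
    assert (E : INR n ^ 2 * (t ^ 4) ^ n = (INR n * t ^ n) ^ 2 * (t ^ 2) ^ n).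
    { rewrite Rpow_mult_distr, <- !pow_mult, Rmult_assoc, <- pow_add. do 2 f_equal. lia. }
    assert (Hp : 0 <= INR n * t ^ n) by (apply Rmult_le_pos; [apply pos_INR|apply pow_le; lra]).
    assert (Hq : 0 <= (t ^ 2) ^ n) by (apply pow_le, pow2_ge_0).
    rewrite E, Rabs_pos_eq by (apply Rmult_le_pos; [apply pow2_ge_0|trivial]).
    apply Rmult_le_compat_r; trivial. apply pow_incr. split; trivial.
    apply Rmult_le_reg_r with (1 - t); [lra|]. rewrite Rinv_l by lra.
    apply Rle_trans with (1 := n_pow_le t n ltac:(lra)).
    generalize (pow_le t n ltac:(lra)). lra.
  + apply (ex_series_scal_l (V := R_NormedModule)). apply ex_series_geom.
    rewrite Rabs_pos_eq; nra.
Qed.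

(** The remainder for n + 1 is a times the one for n plus n b^(n-1) (a - b)^2, and n^2 + n <= (n +
    1)^2. The power p^(n-2) is written as a quotient to avoid truncated subtraction. *)
Lemma pow_taylor (a b : C) p n : 0 < p < 1 -> Cmod a <= p -> Cmod b <= p ->
  Cmod (a ^ n - b ^ n - INR n * b ^ pred n * (a - b))
    <= INR n ^ 2 * p ^ n / p ^ 2 * Cmod (a - b) ^ 2.
Proof.
intros Hp Ha Hb.
set (D := Cmod (a - b) ^ 2). assert (HD : 0 <= D) by apply pow2_ge_0.
destruct n as [|n].
{ simpl. replace (1 - 1 - 0 * 1 * (a - b))%C with (RtoC 0) by ring. rewrite Cmod_0. right. field. lra. }
induction n as [|n IH].
{ simpl. replace (a * 1 - b * 1 - 1 * 1 * (a - b))%C with (RtoC 0) by ring. rewrite Cmod_0.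
  apply Rmult_le_pos; trivial. apply Rlt_le, Rdiv_lt_0_compat; nra. }
simpl pred in *.
replace (a ^ S (S n) - b ^ S (S n) - INR (S (S n)) * b ^ S n * (a - b))%C with
  (a * (a ^ S n - b ^ S n - INR (S n) * b ^ n * (a - b)) + INR (S n) * b ^ n * (a - b) ^ 2)%C
  by (rewrite (S_INR (S n)), RtoC_plus; simpl; ring).
apply Rle_trans with (1 := Cmod_triangle _ _). rewrite !Cmod_mult, !Cmod_pow, Cmod_R.
fold D. rewrite (Rabs_pos_eq (INR (S n))) by apply pos_INR.
set (k := INR (S n)) in *. assert (Hk : 0 <= k) by apply pos_INR.
replace (INR (S (S n))) with (k + 1) by (unfold k; now rewrite (S_INR (S n))).
assert (Hpn : 0 <= p ^ n) by (apply pow_le; lra).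
assert (Hbn : Cmod b ^ n <= p ^ n) by (apply pow_incr; split; [apply Cmod_ge_0|trivial]).
assert (K1 : Cmod a * Cmod (a ^ S n - b ^ S n - k * b ^ n * (a - b))
  <= p * (k ^ 2 * p ^ S n / p ^ 2 * D)).
{ apply Rmult_le_compat; trivial; apply Cmod_ge_0. }
assert (K2 : k * Cmod b ^ n * D <= k * p ^ n * D).
{ apply Rmult_le_compat_r; trivial. apply Rmult_le_compat_l; trivial. }
apply Rle_trans with ((k ^ 2 + k) * p ^ n * D).
- replace ((k ^ 2 + k) * p ^ n * D) with (p * (k ^ 2 * p ^ S n / p ^ 2 * D) + k * p ^ n * D)
    by (simpl; field; lra). lra.
- replace ((k + 1) ^ 2 * p ^ S (S n) / p ^ 2 * D) with ((k + 1) ^ 2 * p ^ n * D)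
    by (simpl; field; lra).
  apply Rmult_le_compat_r; trivial. apply Rmult_le_compat_r; trivial. nra.
Qed.

Lemma H2_norm_ge0 (f : H2) : 0 <= H2_norm f.
Proof. apply sqrt_pos. Qed.

(** The factor [INR n] kills the term n = 0, where [pred] is truncated. *)
Definition H2_deriv (f : H2) (z : C) : C :=
  CSeries (fun n => coef f n * (INR n * z ^ pred n))%C.

Lemma Cmod_coef_pow_le (f : H2) z p n : 0 <= p -> Cmod z <= p ->
  Cmod (coef f n * z ^ n) <= H2_norm f * p ^ n.
Proof.
intros Hp Hz. rewrite Cmod_mult, Cmod_pow.
apply Rmult_le_compat; try apply Cmod_ge_0.
- apply pow_le, Cmod_ge_0.
- apply Cmod_coef_le_norm.
- apply pow_incr. split; [apply Cmod_ge_0|trivial].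
Qed.

(** Stated with the constant of [pow_taylor], so that one series bounds both the derivative and the
    Taylor remainder in [H2_C11]. *)
Lemma Cmod_coef_deriv_le (f : H2) z p n : 0 < p < 1 -> Cmod z <= p ->
  Cmod (coef f n * (INR n * z ^ pred n)) <= H2_norm f * (INR n ^ 2 * p ^ n / p ^ 2).
Proof.
intros Hp Hz. rewrite !Cmod_mult, Cmod_pow, Cmod_R.
rewrite (Rabs_pos_eq (INR n)) by apply pos_INR.
apply Rmult_le_compat; try apply Cmod_ge_0.
- apply Rmult_le_pos; [apply pos_INR|]. apply pow_le, Cmod_ge_0.
- apply Cmod_coef_le_norm.
- destruct n as [|n]; [simpl; right; field; lra|]. simpl pred.
  assert (Hk : 1 <= INR (S n)) by (rewrite S_INR; generalize (pos_INR n); lra).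
  set (k := INR (S n)) in *.
  replace (k ^ 2 * p ^ S n / p ^ 2) with (k * (p ^ n * (k * / p))) by (simpl; field; lra).
  apply Rmult_le_compat_l; [lra|].
  apply Rle_trans with (p ^ n * 1).
  + rewrite Rmult_1_r. apply pow_incr. split; [apply Cmod_ge_0|trivial].
  + apply Rmult_le_compat_l; [apply pow_le; lra|].
    assert (1 <= / p) by (rewrite <- Rinv_1; apply Rinv_le_contravar; lra). nra.
Qed.

Lemma ex_series_geom_pos p : 0 <= p < 1 -> ex_series (fun n => p ^ n).
Proof. intros Hp. apply ex_series_geom. rewrite Rabs_pos_eq; lra. Qed.

Lemma Csummable_H2 (f : H2) z : Cmod z < 1 -> Csummable (fun n => coef f n * z ^ n)%C.
Proof.
intros Hz. apply Csummable_le with (fun n => H2_norm f * Cmod z ^ n).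
- intros n. apply Cmod_coef_pow_le; [apply Cmod_ge_0|lra].
- apply (ex_series_scal_l (V := R_NormedModule)). apply ex_series_geom_pos.
  split; [apply Cmod_ge_0|trivial].
Qed.

Lemma Csummable_H2_deriv (f : H2) z : Cmod z < 1 ->
  Csummable (fun n => coef f n * (INR n * z ^ pred n))%C.
Proof.
intros Hz. destruct (ex_series_sq_pow _ Hz) as [p [Hp [Hzp Hs]]].
apply Csummable_le with (fun n => H2_norm f * (INR n ^ 2 * p ^ n / p ^ 2)).
- intros n. now apply Cmod_coef_deriv_le.
- apply (ex_series_scal_l (V := R_NormedModule)). now apply ex_series_scal_r.
Qed.

(* The constant is uniform in [f]: evaluations and their increments are bounded functionals. *)
Lemma H2_C11 r : r < 1 -> exists K, 0 <= K /\
  forall f : H2, C11 (cball r) f (H2_deriv f) (K * H2_norm f).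
Proof.
intros Hr. destruct (ex_series_sq_pow r Hr) as [p [Hp [Hrp Hs]]].
set (S1 := Series (fun n => p ^ n)).
set (S2 := Series (fun n => INR n ^ 2 * p ^ n / p ^ 2)).
assert (G1 : ex_series (fun n => p ^ n)) by (apply ex_series_geom_pos; lra).
assert (G2 : ex_series (fun n => INR n ^ 2 * p ^ n / p ^ 2)) by (now apply ex_series_scal_r).
assert (P : forall a, ex_series a -> (forall n, 0 <= a n) -> 0 <= Series a).
{ intros a Ha Hn. apply Rle_trans with (Series (fun _ : nat => 0 * 0)).
  - rewrite Series_scal_l. lra.
  - apply Series_le; trivial. intros n. split; [lra|]. rewrite Rmult_0_l. trivial. }
assert (HS1 : 0 <= S1) by (apply P; trivial; intros; apply pow_le; lra).
assert (HS2 : 0 <= S2).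
{ apply P; trivial. intros n. apply Rmult_le_pos.
  - apply Rmult_le_pos; [apply pow2_ge_0|apply pow_le; lra].
  - apply Rlt_le, Rinv_0_lt_compat. nra. }
(* 3 comes from [C11_intro] and 2 from [CSeries_le]; [S1] bounds the values, [S2] the derivative and
   the Taylor remainder. *)
exists (3 * (2 * (S1 + S2))). split; [lra|]. intros f.
assert (Hf := H2_norm_ge0 f). rewrite Rmult_assoc.
assert (0 <= H2_norm f * S1) by (apply Rmult_le_pos; trivial).
assert (0 <= H2_norm f * S2) by (apply Rmult_le_pos; trivial).
apply C11_intro.
- unfold cball. intros; lra.
- nra.
- intros a Ha. unfold cball in Ha.
  apply Rle_trans with (2 * Series (fun n => H2_norm f * p ^ n)).
  + apply CSeries_le.
    * intros n. apply Cmod_coef_pow_le; lra.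
    * now apply (ex_series_scal_l (V := R_NormedModule)).
  + rewrite Series_scal_l. change (Series (pow p)) with S1. lra.
- intros a Ha. unfold cball in Ha.
  apply Rle_trans with (2 * Series (fun n => H2_norm f * (INR n ^ 2 * p ^ n / p ^ 2))).
  + apply CSeries_le.
    * intros n. apply Cmod_coef_deriv_le; lra.
    * now apply (ex_series_scal_l (V := R_NormedModule)).
  + rewrite Series_scal_l. fold S2. lra.
- intros a b Ha Hb. unfold cball in Ha, Hb.
  assert (Ha1 := Csummable_H2 f a ltac:(lra)). assert (Hb1 := Csummable_H2 f b ltac:(lra)).
  assert (Hb2 := Csummable_H2_deriv f b ltac:(lra)).
  set (D := Cmod (a - b) ^ 2). assert (HD : 0 <= D) by apply pow2_ge_0.
  assert (E : (f a - f b - H2_deriv f b * (a - b))%C = CSeries (fun n =>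
     coef f n * (a ^ n - b ^ n - INR n * b ^ pred n * (a - b)))%C).
  { rewrite (CSeries_ext _ (fun n => (coef f n * a ^ n - coef f n * b ^ n)
      - (coef f n * (INR n * b ^ pred n)) * (a - b))%C) by (intros; ring).
    unfold H2_deriv. rewrite <- CSeries_mult_r by trivial.
    change (H2_fun f a) with (CSeries (fun n => coef f n * a ^ n)%C).
    change (H2_fun f b) with (CSeries (fun n => coef f n * b ^ n)%C).
    rewrite <- CSeries_minus by trivial.
    rewrite <- CSeries_minus; trivial.
    - apply Csummable_le with (fun n => Cmod (coef f n * a ^ n) + Cmod (coef f n * b ^ n)).
      + intros n. apply Cmod_minus_le.
      + now apply (ex_series_plus (V := R_NormedModule)).
    - apply Csummable_le with (fun n => Cmod (coef f n * (INR n * b ^ pred n)) * Cmod (a - b)).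
      + intros n. rewrite <- Cmod_mult. lra.
      + now apply ex_series_scal_r. }
  rewrite E.
  apply Rle_trans with (2 * Series (fun n => H2_norm f * (INR n ^ 2 * p ^ n / p ^ 2) * D)).
  + apply CSeries_le.
    * intros n. rewrite Cmod_mult, Rmult_assoc. apply Rmult_le_compat; try apply Cmod_ge_0.
      -- apply Cmod_coef_le_norm.
      -- apply pow_taylor; lra.
    * apply ex_series_scal_r. now apply (ex_series_scal_l (V := R_NormedModule)).
  + rewrite Series_scal_r, Series_scal_l. fold S2. rewrite <- Rmult_assoc.
    apply Rmult_le_compat_r; trivial. nra.
Qed.

Lemma H2_hol (f : H2) : hol f (H2_deriv f).
Proof.
intros r Hr. destruct (H2_C11 r Hr) as [K [_ H]]. eexists. apply H.
Qed.

Lemma H2_C_derive (f : H2) z : Cmod z < 1 -> C_derive f z = H2_deriv f z.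
Proof. intros Hz. apply is_C_derive_unique, hol_is_derive; trivial. apply H2_hol. Qed.

Lemma H2_tail (f : H2) r e : 0 <= r < 1 -> 0 < e -> exists N0, forall N z, (N0 <= N)%nat ->
  Cmod z <= r -> Cmod (f z - Csum (fun n => coef f n * z ^ n)%C N) <= e.
Proof.
intros Hr He. assert (Hf := H2_norm_ge0 f).
set (K := 2 * H2_norm f / (1 - r)).
assert (HK : 0 <= K).
{ apply Rmult_le_pos; [lra|]. apply Rlt_le, Rinv_0_lt_compat; lra. }
destruct (geom_small r K e Hr HK He) as [N0 HN].
exists N0. intros N z HN0 Hz.
change (H2_fun f z) with (CSeries (fun n => coef f n * z ^ n)%C).
rewrite (CSeries_split _ N) by (apply Csummable_H2; lra).
set (s := Csum _ N). set (u := CSeries _). replace (s + u - s)%C with u by ring.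
apply Rle_trans with (2 * Series (fun n => (H2_norm f * r ^ N) * r ^ n)).
- apply CSeries_le.
  + intros n. rewrite Rmult_assoc, <- pow_add. apply Cmod_coef_pow_le; lra.
  + apply (ex_series_scal_l (V := R_NormedModule)). now apply ex_series_geom_pos.
- rewrite Series_scal_l, Series_geom by (rewrite Rabs_pos_eq; lra).
  apply Rle_trans with (2 := HN N HN0). right. unfold K. field. lra.
Qed.

Lemma fourier_H2 (f : H2) r n : 0 <= r < 1 ->
  fourier (fun t => f (circ r t)) n = (coef f n * RtoC r ^ n)%C.
Proof.
intros Hr. apply (fourier_of_uniform _ (fun n => coef f n * RtoC r ^ n)%C).
- intros t. now apply (Ccont_hol_circ f (H2_deriv f)), Hr; apply H2_hol.
- intros e He. destruct (H2_tail f r e Hr He) as [N0 HN]. exists (n + N0 + 1)%nat.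
  split; [lia|]. intros t.
  rewrite (Csum_ext _ (fun m => coef f m * circ r t ^ m)%C).
  + apply HN; [lia|]. rewrite Cmod_circ; lra.
  + intros m _. unfold circ. rewrite Cpow_mult_l. ring.
Qed.

(** Cauchy's estimate. It turns pointwise bounds on one circle, later the one of radius 1/2, into
    bounds on single coefficients. *)
Lemma coef_le_sup (f : H2) r n M : 0 <= r < 1 ->
  (forall z, Cmod z = r -> Cmod (f z) <= M) -> Cmod (coef f n) * r ^ n <= M.
Proof.
intros Hr HM. replace (Cmod (coef f n) * r ^ n) with (Cmod (coef f n * RtoC r ^ n)).
- rewrite <- fourier_H2 by trivial. apply Cmod_fourier_le.
  + intros t. apply (Ccont_hol_circ f (H2_deriv f)); trivial. apply H2_hol.
  + intros t. apply HM, Cmod_circ. lra.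
- rewrite Cmod_mult, Cmod_pow, Cmod_R, Rabs_pos_eq by lra. reflexivity.
Qed.

Lemma Rsum_sum_n (a : nat -> R) n : sum_n a n = Rsum a (S n).
Proof.
induction n as [|n IH].
- rewrite sum_O. simpl. ring.
- rewrite sum_Sn, IH. reflexivity.
Qed.

Lemma Rsum_le a b N : (forall n, (n < N)%nat -> a n <= b n) -> Rsum a N <= Rsum b N.
Proof.
intros H. induction N as [|N IH]; simpl; [lra|].
generalize (IH (fun n Hn => H n (Nat.lt_lt_succ_r _ _ Hn))) (H N (Nat.lt_succ_diag_r N)). lra.
Qed.

Lemma Rsum_scal k a N : Rsum (fun n => k * a n) N = k * Rsum a N.
Proof. induction N as [|N IH]; simpl; [ring|]. rewrite IH. ring. Qed.

Lemma Rsum_pos a N : (forall n, 0 <= a n) -> 0 <= Rsum a N.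
Proof. intros H. induction N as [|N IH]; simpl; [lra|]. generalize (H N). lra. Qed.

Lemma Rsum_plus a b N : Rsum (fun n => a n + b n) N = Rsum a N + Rsum b N.
Proof. induction N as [|N IH]; simpl; [ring|]. rewrite IH. ring. Qed.

Lemma Rsum_ext a b N : (forall n, a n = b n) -> Rsum a N = Rsum b N.
Proof. intros H. induction N as [|N IH]; simpl; trivial. now rewrite IH, H. Qed.

Lemma Rsum_incr a N P : (forall n, 0 <= a n) -> (N <= P)%nat -> Rsum a N <= Rsum a P.
Proof.
intros Ha H. induction H as [|P H IH]; [lra|]. simpl. generalize (Ha P). lra.
Qed.

Lemma Rsum_sqmod_le (f : H2) N : Rsum (fun n => Cmod (coef f n) ^ 2) N <= H2_norm f ^ 2.
Proof.
unfold H2_norm. rewrite pow2_sqrt by (apply (Series_sqmod_ge0 (coef f)), coef_summable).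
apply Rle_trans with (Rsum (fun n => Cmod (coef f n) ^ 2) (S N)).
- simpl Rsum. generalize (pow2_ge_0 (Cmod (coef f N))). lra.
- rewrite <- Rsum_sum_n. apply (sum_sqmod_le_Series (coef f)), coef_summable.
Qed.

Lemma H2_norm_sq_le (f : H2) K :
  (forall N, Rsum (fun n => Cmod (coef f n) ^ 2) N <= K) -> H2_norm f ^ 2 <= K.
Proof.
intros H. unfold H2_norm. rewrite pow2_sqrt by (apply (Series_sqmod_ge0 (coef f)), coef_summable).
apply (sqmod_bounded (coef f)). intros N. rewrite Rsum_sum_n. apply H.
Qed.

(** * Taylor expansion and membership in the Hardy space *)

Section Expansion.

Variables (f f' : C -> C).
Hypothesis Hf : hol f f'.

Lemma hol_bound_circ r : 0 < r < 1 -> exists B, 0 <= B /\ forall t, Cmod (f (circ r t)) <= B.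
Proof.
intros Hr. destruct (Hf r ltac:(lra)) as [M HM]. exists M. split; [apply HM|].
intros t. apply HM. unfold cball. rewrite Cmod_circ; lra.
Qed.

Lemma hol_expand r w e : 0 < r < 1 -> 0 <= w < r -> 0 < e ->
  exists N0, forall N z, (N0 <= N)%nat -> Cmod z = w ->
  Cmod (f z - Csum (fun n => fourier (fun t => f (circ r t)) n * (z / r) ^ n)%C N) <= e.
Proof.
intros Hr Hw He. destruct (hol_bound_circ r Hr) as [B [HB HfB]].
destruct (kern_remainder_small r (RtoC w)) with (B := B) (e := e) as [N0 HN]; trivial.
- lra.
- rewrite Cmod_R, Rabs_pos_eq; lra.
- exists N0. intros N z HN0 Hz.
  apply Rle_trans with (2 := HN N HN0).
  rewrite (cauchy_formula f f' r z) by (trivial; lra).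
  rewrite Cmod_R, Rabs_pos_eq by lra. rewrite <- Hz.
  apply mean_kern_expand; trivial; try lra.
  intros t. apply (Ccont_hol_circ f f'); [trivial|lra].
Qed.

(** Expanding f on the inner circle with the coefficients of the outer one gives a uniformly
    convergent trigonometric series, which determines the inner coefficients. *)
Lemma fourier_hol_radius r1 r2 n : 0 < r1 -> r1 < r2 -> r2 < 1 ->
  (fourier (fun t => f (circ r1 t)) n / RtoC r1 ^ n
    = fourier (fun t => f (circ r2 t)) n / RtoC r2 ^ n)%C.
Proof.
intros H1 H12 H2.
assert (N1 : RtoC r1 <> RtoC 0) by (intros E; apply RtoC_inj in E; lra).
assert (N2 : RtoC r2 <> RtoC 0) by (intros E; apply RtoC_inj in E; lra).
assert (N1' := Cpow_nz _ n N1). assert (N2' := Cpow_nz _ n N2).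
rewrite (fourier_of_uniform (fun t => f (circ r1 t))
  (fun n => fourier (fun t => f (circ r2 t)) n * (r1 / r2) ^ n)%C).
- unfold Cdiv. rewrite Cpow_mult_l, Cpow_inv by trivial. field. split; trivial.
- intros t. apply (Ccont_hol_circ f f'); trivial. lra.
- intros e He. destruct (hol_expand r2 r1 e) as [N0 HN]; trivial; try lra.
  exists (n + N0 + 1)%nat. split; [lia|]. intros t.
  rewrite (Csum_ext _ (fun m => fourier (fun t => f (circ r2 t)) m * (circ r1 t / r2) ^ m)%C).
  + apply HN; [lia|]. apply Cmod_circ. lra.
  + intros m _. unfold circ. rewrite <- Cmult_assoc, <- Cpow_mult_l. do 2 f_equal.
    field. trivial.
Qed.

(** The normalized Fourier coefficients do not depend on the radius, so they can be taken at 1/2;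
    Bessel on circles with r -> 1 then bounds their sum of squares. *)
Lemma H2_of_hol K :
  (forall r, 0 < r < 1 -> Re (mean (fun t => f (circ r t) * Cconj (f (circ r t)))%C) <= K) ->
  exists g : H2, (forall z, Cmod z < 1 -> g z = f z) /\ H2_norm g ^ 2 <= K.
Proof.
intros HK.
set (c := fun n => (fourier (fun t => f (circ (1 / 2) t)) n / RtoC (1 / 2) ^ n)%C).
assert (Hc : forall r n, 0 < r < 1 -> fourier (fun t => f (circ r t)) n = (c n * RtoC r ^ n)%C).
{ intros r n Hr.
  assert (Nr : RtoC r <> RtoC 0) by (intros E; apply RtoC_inj in E; lra).
  assert (Nr' := Cpow_nz _ n Nr).
  assert (E : (fourier (fun t => f (circ r t)) n / RtoC r ^ n)%C = c n).
  { unfold c. destruct (Rtotal_order r (1 / 2)) as [H|[->|H]]; trivial.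
    - apply fourier_hol_radius; lra.
    - symmetry. apply fourier_hol_radius; lra. }
  rewrite <- E. field. trivial. }
assert (Hb : forall N, Rsum (fun n => Cmod (c n) ^ 2) N <= K).
{ intros N. set (s := Rsum _ N).
  assert (Hs : 0 <= s) by (apply Rsum_pos; intros; apply pow2_ge_0).
  (* Bessel bounds the sum of |c n|^2 r^(2n); for n < N each weight is at least r^(2N), and this
     common factor tends to 1 with r. *)
  assert (Q : forall r, 0 < r < 1 -> (r ^ 2) ^ N * s <= K).
  { intros r Hr. apply Rle_trans with (2 := HK r Hr).
    apply Rle_trans with (2 := bessel (fun t => f (circ r t)) N
      (fun t => Ccont_hol_circ f f' r t Hf (conj (Rlt_le _ _ (proj1 Hr)) (proj2 Hr)))).
    unfold s. rewrite <- Rsum_scal. apply Rsum_le. intros n Hn.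
    rewrite Hc by trivial. rewrite Cmod_mult, Cmod_pow, Cmod_R, Rabs_pos_eq by lra.
    rewrite Rpow_mult_distr, Rmult_comm. apply Rmult_le_compat_l; [apply pow2_ge_0|].
    rewrite <- !pow_mult, (Nat.mul_comm n 2), !pow_mult.
    replace N with (n + (N - n))%nat by lia. rewrite pow_add.
    assert (0 <= (r ^ 2) ^ n) by (apply pow_le, pow2_ge_0).
    assert ((r ^ 2) ^ (N - n) <= 1).
    { rewrite <- (pow1 (N - n)). apply pow_incr. split; [apply pow2_ge_0|nra]. }
    nra. }
  assert (Ber : forall x n, 0 <= x <= 1 -> 1 - INR n * x <= (1 - x) ^ n).
  { intros x n Hx. induction n as [|n IH]; [simpl; lra|].
    rewrite S_INR. simpl. generalize (pos_INR n). intros.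
    assert (0 <= (1 - x) ^ n) by (apply pow_le; lra).
    assert (0 <= INR n * x) by (apply Rmult_le_pos; lra). nra. }
  apply le_epsilon. intros e He.
  (* With r = 1 - x, Bernoulli gives r^(2N) >= 1 - 2 N x, and this x makes the loss 2 N x s at most
     e. *)
  set (x := Rmin (1 / 2) (e / ((2 * INR N + 1) * (s + 1)))).
  assert (HN := pos_INR N).
  assert (Hx : 0 < x).
  { apply Rmin_glb_lt; [lra|]. apply Rdiv_lt_0_compat; trivial. nra. }
  assert (Hx2 : x <= 1 / 2) by apply Rmin_l.
  assert (Hx3 : x <= e / ((2 * INR N + 1) * (s + 1))) by apply Rmin_r.
  assert (Q1 := Q (1 - x) ltac:(lra)).
  assert (Q2 := Ber (2 * x - x ^ 2) N ltac:(nra)).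
  replace (1 - (2 * x - x ^ 2)) with ((1 - x) ^ 2) in Q2 by ring.
  assert (Q3 : x * ((2 * INR N + 1) * (s + 1)) <= e).
  { apply Rle_trans with (e / ((2 * INR N + 1) * (s + 1)) * ((2 * INR N + 1) * (s + 1))).
    - apply Rmult_le_compat_r; nra.
    - right. field. lra. }
  assert (Q4 : 1 - 2 * INR N * x <= ((1 - x) ^ 2) ^ N) by nra.
  assert (Q5 : (1 - 2 * INR N * x) * s <= K).
  { apply Rle_trans with (2 := Q1). now apply Rmult_le_compat_r. }
  assert (0 <= INR N * x) by (apply Rmult_le_pos; lra).
  assert (0 <= x * s) by (apply Rmult_le_pos; lra).
  nra. }
assert (Hsum : ex_series (fun n => Cmod (c n) ^ 2)).
{ apply (sqmod_bounded c K). intros N. rewrite Rsum_sum_n. apply Hb. }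
exists (mkH2 c Hsum). split.
- intros z Hz. apply eq_of_Cmod_le_eps. intros e He.
  assert (He2 : 0 < e / 2) by lra.
  set (r := (1 + Cmod z) / 2).
  assert (Hz0 := Cmod_ge_0 z).
  destruct (H2_tail (mkH2 c Hsum) (Cmod z) (e / 2)) as [N1 HN1]; [lra|lra|].
  destruct (hol_expand r (Cmod z) (e / 2)) as [N2 HN2]; [unfold r; lra|unfold r; lra|lra|].
  specialize (HN1 (N1 + N2)%nat z ltac:(lia) ltac:(lra)).
  specialize (HN2 (N1 + N2)%nat z ltac:(lia) eq_refl).
  rewrite (Csum_ext _ (fun n => coef (mkH2 c Hsum) n * z ^ n)%C) in HN2.
  + set (s := Csum _ _) in *.
    replace (mkH2 c Hsum z - f z)%C with ((mkH2 c Hsum z - s) - (f z - s))%C by ring.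
    apply Rle_trans with (1 := Cmod_minus_le _ _). lra.
  + intros n _. simpl.
    assert (Nr : RtoC r <> RtoC 0) by (intros E; apply RtoC_inj in E; unfold r in E; lra).
    rewrite Hc by (unfold r; lra). rewrite <- Cmult_assoc, <- Cpow_mult_l. do 2 f_equal.
    field. trivial.
- apply H2_norm_sq_le. exact Hb.
Qed.

End Expansion.

(** * Littlewood subordination *)

Fixpoint horner (a : nat -> C) (N : nat) (w : C) : C :=
  match N with
  | O => RtoC 0
  | S N => (a 0%nat + w * horner (fun n => a (S n)) N w)%C
  end.

(* [Re (majorant a N)] is the Poisson extension of the square modulus of the polynomial
   [horner a N] on the unit circle: with [g_n] the Horner tails it is
   [sum_n (2 g_n - a_n) conj a_n]. *)
Fixpoint majorant (a : nat -> C) (N : nat) (w : C) : C :=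
  match N with
  | O => RtoC 0
  | S N' => ((2 * horner a N w - a 0%nat) * Cconj (a 0%nat)
             + majorant (fun n => a (S n)) N' w)%C
  end.

Lemma Csum_S_l a N : Csum a (S N) = (a 0%nat + Csum (fun n => a (S n)) N)%C.
Proof.
induction N as [|N IH]; [simpl; ring|].
change (Csum a (S (S N))) with (Csum a (S N) + a (S N))%C. rewrite IH. simpl. ring.
Qed.

Lemma Rsum_S_l a N : Rsum a (S N) = a 0%nat + Rsum (fun n => a (S n)) N.
Proof.
induction N as [|N IH]; [simpl; ring|].
change (Rsum a (S (S N))) with (Rsum a (S N) + a (S N)). rewrite IH. simpl. ring.
Qed.

Lemma horner_Csum a N w : horner a N w = Csum (fun n => a n * w ^ n)%C N.
Proof.
revert a. induction N as [|N IH]; intros a; [reflexivity|].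
rewrite Csum_S_l. simpl horner. rewrite IH, (Cmult_comm w), Csum_mult_r.
simpl. f_equal; [ring|]. apply Csum_ext. intros n _. ring.
Qed.

Lemma hol_horner a N : exists h, hol (horner a N) h.
Proof.
revert a. induction N as [|N IH]; intros a.
- exists (fun _ => RtoC 0). exact (hol_const 0).
- destruct (IH (fun n => a (S n))) as [h Hh]. eexists.
  exact (hol_plus _ _ _ _ (hol_const (a 0%nat)) (hol_mult _ _ _ _ hol_id Hh)).
Qed.

Lemma hol_majorant a N : exists h, hol (majorant a N) h.
Proof.
revert a. induction N as [|N IH]; intros a.
- exists (fun _ => RtoC 0). exact (hol_const 0).
- destruct (IH (fun n => a (S n))) as [h Hh]. destruct (hol_horner a (S N)) as [k Hk].
  eexists.
  exact (hol_plus _ _ _ _ (hol_mult _ _ _ _ (hol_plus _ _ _ _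
      (hol_mult _ _ _ _ (hol_const 2) Hk) (hol_const (- a 0%nat)))
    (hol_const (Cconj (a 0%nat)))) Hh).
Qed.

Lemma Re_majorant_S (g a : C) :
  Re ((2 * g - a) * Cconj a)%C = Cmod g ^ 2 - Cmod (g - a) ^ 2.
Proof. rewrite !Cmod2_alt. simpl. unfold Re, Im. simpl. ring. Qed.

(** Here horner a (S N) w - a 0 is w times the Horner tail. The lower and the upper bound of the
    majorant are both inductions on this recursion. *)
Lemma majorant_step a N w : Re (majorant a (S N) w)
  = Cmod (horner a (S N) w) ^ 2 - Cmod w ^ 2 * Cmod (horner (fun n => a (S n)) N w) ^ 2
    + Re (majorant (fun n => a (S n)) N w).
Proof.
simpl majorant. rewrite re_plus, Re_majorant_S. do 2 f_equal.
simpl horner. rewrite <- Rpow_mult_distr, <- Cmod_mult. do 2 f_equal. ring.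
Qed.

(** Unfolding the recursion, every proper Horner tail contributes 1 - |w|^2 times its squared
    modulus. *)
Lemma majorant_ge a N w : Cmod w <= 1 -> Cmod (horner a N w) ^ 2 <= Re (majorant a N w).
Proof.
intros Hw. revert a. induction N as [|N IH]; intros a.
- simpl. rewrite Cmod_0. lra.
- rewrite majorant_step. generalize (IH (fun n => a (S n))).
  set (y := Cmod (horner (fun n => a (S n)) N w)). intros H.
  assert (Cmod w ^ 2 <= 1).
  { rewrite <- (pow1 2). apply pow_incr. split; [apply Cmod_ge_0|trivial]. }
  assert (0 <= y ^ 2) by apply pow2_ge_0. nra.
Qed.

(** Harnack's inequality for the Poisson extension, whose value at 0 is the sum on the right. The
    extra summand with |horner|^2 is what makes the induction close. *)
Lemma majorant_le a N w : Cmod w < 1 ->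
  (1 - Cmod w) * (Re (majorant a N w) + Cmod w * Cmod (horner a N w) ^ 2)
    <= (1 + Cmod w) * Rsum (fun n => Cmod (a n) ^ 2) N.
Proof.
intros Hw. assert (Hw0 := Cmod_ge_0 w). revert a. induction N as [|N IH]; intros a.
- simpl. rewrite Cmod_0. lra.
- rewrite majorant_step, Rsum_S_l. generalize (IH (fun n => a (S n))).
  set (y := Cmod (horner (fun n => a (S n)) N w)).
  set (x := Cmod (horner a (S N) w)). set (r := Cmod w) in *.
  set (s := Rsum _ N). set (m := Re _). intros H.
  assert (Hy : 0 <= y) by apply Cmod_ge_0. assert (Hx : 0 <= x) by apply Cmod_ge_0.
  (* From |x - r y| <= |a 0| and the identity (x - r y)^2 - (1 - r)(x^2 - r y^2) = r (x - y)^2. *)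
  assert (Ha : (1 - r) * (x ^ 2 - r * y ^ 2) <= Cmod (a 0%nat) ^ 2).
  { assert (Hxy : Rabs (x - r * y) <= Cmod (a 0%nat)).
    { unfold x, r, y. rewrite <- Cmod_mult.
      set (v := (w * horner (fun n => a (S n)) N w)%C).
      replace (horner a (S N) w) with (a 0%nat + v)%C by reflexivity.
      assert (K1 := Cmod_triangle (a 0%nat) v).
      assert (K2 := Cmod_triangle_inv v (- a 0%nat)).
      replace (v - - a 0%nat)%C with (a 0%nat + v)%C in K2 by ring.
      rewrite Cmod_opp in K2. apply Rabs_le. lra. }
    apply Rle_trans with ((x - r * y) ^ 2).
    - assert (0 <= r * (x - y) ^ 2) by (apply Rmult_le_pos; [trivial|apply pow2_ge_0]). nra.
    - rewrite <- (pow2_abs (x - r * y)). apply pow_incr. split; [apply Rabs_pos|trivial]. }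
  assert ((1 + r) * ((1 - r) * (x ^ 2 - r * y ^ 2)) <= (1 + r) * Cmod (a 0%nat) ^ 2)
    by (apply Rmult_le_compat_l; lra).
  nra.
Qed.

(** On the disc of radius r' that contains the values of phi, f is close to a Taylor polynomial
    whose squared modulus lies below the real part of [majorant]. Composed with phi this stays
    holomorphic, so its circle means equal its value at 0, which [majorant_le] bounds. *)
Lemma littlewood (f : H2) phi phi' : hol phi phi' ->
  (forall r, r < 1 -> exists r', r' < 1 /\ forall z, Cmod z <= r -> Cmod (phi z) <= r') ->
  exists g : H2, (forall z, Cmod z < 1 -> g z = f (phi z)) /\
    H2_norm g ^ 2 <= (1 + Cmod (phi 0)) / (1 - Cmod (phi 0)) * H2_norm f ^ 2.
Proof.
intros Hphi Hball.
assert (Hfp := hol_comp _ _ _ _ (H2_hol f) Hphi Hball).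
apply (H2_of_hol (fun z => f (phi z)) _ Hfp).
intros r Hr.
set (R0 := Cmod (phi 0)). assert (HR0 : 0 <= R0) by apply Cmod_ge_0.
assert (HR1 : R0 < 1).
{ destruct (Hball 0 ltac:(lra)) as [r' [Hr' H]].
  generalize (H 0%C ltac:(rewrite Cmod_0; lra)). fold R0. lra. }
destruct (Hball r ltac:(lra)) as [r' [Hr' Hphir]].
assert (Hr'0 : 0 <= r').
{ apply Rle_trans with (Cmod (phi 0)); [trivial|]. apply Hphir. rewrite Cmod_0. lra. }
assert (Hu : forall t, Cmod (phi (circ r t)) <= r').
{ intros t. apply Hphir. rewrite Cmod_circ; lra. }
destruct (H2_hol f r' Hr') as [B HB].
assert (HB0 := C11_ge0 _ _ _ _ HB).
set (A := (1 + R0) / (1 - R0) * H2_norm f ^ 2).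
apply le_epsilon. intros eps Heps.
(* An error e in f, where |f| <= B, changes |f|^2 by at most 2 B e <= eps when |f| > e; otherwise
   |f|^2 <= e B <= eps directly. *)
set (e := Rmin 1 (eps / (2 * B + 1))).
assert (He : 0 < e) by (apply Rmin_glb_lt; [lra|apply Rdiv_lt_0_compat; lra]).
assert (He2 : e * (2 * B + 1) <= eps).
{ apply Rle_trans with (eps / (2 * B + 1) * (2 * B + 1)).
  - apply Rmult_le_compat_r; [lra|apply Rmin_r].
  - right; field; lra. }
destruct (H2_tail f r' e (conj Hr'0 Hr') He) as [N HN].
set (v := fun t => (majorant (coef f) N (phi (circ r t)) + RtoC eps)%C).
destruct (hol_majorant (coef f) N) as [h Hh].
assert (Hmp := hol_comp _ _ _ _ Hh Hphi Hball).
assert (mc : forall t, Ccont (fun t => majorant (coef f) N (phi (circ r t))) t).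
{ intros t. apply (Ccont_hol_circ (fun z => majorant (coef f) N (phi z)) _ r t Hmp). lra. }
assert (fc : forall t, Ccont (fun t => f (phi (circ r t))) t).
{ intros t. apply (Ccont_hol_circ (fun z => f (phi z)) _ r t Hfp). lra. }
apply Rle_trans with (Re (mean v)).
- apply Re_mean_le.
  + intros t. apply Ccont_mult; [apply fc|apply Ccont_conj, fc].
  + intros t. apply Ccont_plus; [apply mc|apply Ccont_const].
  + intros t. rewrite <- Cmod2_conj. unfold v. rewrite re_plus, !re_RtoC.
    set (z := phi (circ r t)).
    assert (Hz : Cmod z <= r') by apply Hu.
    assert (K1 := HN N z (le_n N) Hz). rewrite <- horner_Csum in K1.
    assert (K2 := majorant_ge (coef f) N z ltac:(lra)).
    assert (K3 := C11_bound _ _ _ _ HB z Hz).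
    set (p := horner (coef f) N z) in *.
    assert (K4 : Cmod (f z) <= Cmod p + e).
    { generalize (Cmod_triangle_inv (f z) p). lra. }
    assert (K5 : Cmod (f z) ^ 2 <= Cmod p ^ 2 + eps); [|lra].
    assert (K6 := Cmod_ge_0 (f z)). assert (K7 := Cmod_ge_0 p).
    destruct (Rle_lt_dec (Cmod (f z)) e) as [Hs|Hs].
    * assert (e <= 1) by apply Rmin_l. assert (0 <= e * B) by nra. nra.
    * assert ((Cmod (f z) - e) ^ 2 <= Cmod p ^ 2) by (apply pow_incr; lra). nra.
- unfold v. rewrite mean_plus, mean_const; trivial; [|intros; apply Ccont_const].
  rewrite (mean_value (fun z => majorant (coef f) N (phi z)) _ r Hmp Hr).
  rewrite re_plus, re_RtoC. apply Rplus_le_compat_r.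
  assert (K1 := majorant_le (coef f) N (phi 0) HR1). fold R0 in K1.
  assert (K2 := Rsum_sqmod_le f N).
  apply Rmult_le_reg_l with (1 - R0); [lra|]. unfold A.
  replace ((1 - R0) * ((1 + R0) / (1 - R0) * H2_norm f ^ 2)) with ((1 + R0) * H2_norm f ^ 2)
    by (field; lra).
  assert (0 <= R0 * Cmod (horner (coef f) N (phi 0)) ^ 2)
    by (apply Rmult_le_pos; [trivial|apply pow2_ge_0]).
  nra.
Qed.

(** * The vector field and its trajectories *)

Lemma derive_nonpos_decr (f df : R -> R) a b : a <= b ->
  (forall x, a <= x <= b -> is_derive f x (df x)) ->
  (forall x, a <= x <= b -> df x <= 0) -> f b <= f a.
Proof.
intros Hab Hd Hn.
destruct (MVT_gen f a b df) as [c [Hc E]].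
- intros x Hx. apply Hd. rewrite Rmin_left, Rmax_right in Hx; lra.
- intros x Hx. rewrite Rmin_left, Rmax_right in Hx by lra.
  apply continuity_pt_filterlim, (ex_derive_continuous (V := R_NormedModule)).
  eexists. now apply Hd.
- rewrite Rmin_left, Rmax_right in Hc by lra.
  generalize (Hn c Hc). nra.
Qed.

(** Stated for |r|^2, which is differentiable also at zeros of r. The exponent 2 L + 1 comes from 2
    |r| b <= |r|^2 + b^2. *)
Lemma gronwall (r r' : R -> C) L b T : 0 <= L ->
  (forall t, 0 <= t <= T -> Cder r t (r' t)) ->
  (forall t, 0 <= t <= T -> Cmod (r' t) <= L * Cmod (r t) + b) ->
  forall t, 0 <= t <= T ->
  Cmod (r t) ^ 2 <= (Cmod (r 0) ^ 2 + b ^ 2 * t) * exp ((2 * L + 1) * t).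
Proof.
intros HL Hr Hb t Ht. set (c := 2 * L + 1).
assert (H : Cmod (r t) ^ 2 * exp (- c * t) - b ^ 2 * t
  <= Cmod (r 0) ^ 2 * exp (- c * 0) - b ^ 2 * 0).
{ apply (derive_nonpos_decr (fun t => Cmod (r t) ^ 2 * exp (- c * t) - b ^ 2 * t)
    (fun t => 2 * Re (Cconj (r t) * r' t)%C * exp (- c * t)
      + Cmod (r t) ^ 2 * (- c * exp (- c * t)) - b ^ 2)).
  - lra.
  - intros x Hx.
    apply (is_derive_minus (V := R_NormedModule)
      (fun t => Cmod (r t) ^ 2 * exp (- c * t)) (fun t => b ^ 2 * t)).
    + apply (is_derive_mult (K := R_AbsRing) (fun t => Cmod (r t) ^ 2) (fun t => exp (- c * t))).
      * apply is_derive_Cmod2, Hr. lra.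
      * auto_derive; trivial. ring.
      * intros; apply Rmult_comm.
    + auto_derive; trivial. ring.
  - intros x Hx.
    assert (K1 := Hb x ltac:(lra)).
    assert (K2 : Re (Cconj (r x) * r' x)%C <= Cmod (r x) * (L * Cmod (r x) + b)).
    { apply Rle_trans with (1 := Re_le_Cmod _). rewrite Cmod_mult, Cmod_conj.
      apply Rmult_le_compat_l; [apply Cmod_ge_0|trivial]. }
    set (y := Cmod (r x)) in *. set (e := exp (- c * x)).
    assert (He : 0 < e <= 1).
    { split; [apply exp_pos|]. rewrite <- exp_0. unfold e.
      destruct (Req_dec x 0) as [->|Hx0]; [right; f_equal; ring|].
      apply Rlt_le, exp_increasing. assert (0 < c * x) by (apply Rmult_lt_0_compat; unfold c; lra).
      lra. }
    assert (K3 : 2 * Re (Cconj (r x) * r' x)%C - c * y ^ 2 <= b ^ 2).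
    { assert (0 <= (y - b) ^ 2) by apply pow2_ge_0. unfold c. nra. }
    assert (0 <= b ^ 2) by apply pow2_ge_0.
    assert (K4 : e * (2 * Re (Cconj (r x) * r' x)%C - c * y ^ 2) <= e * b ^ 2)
      by (apply Rmult_le_compat_l; lra).
    nra. }
rewrite Rmult_0_r, exp_0 in H.
assert (E : exp (- c * t) * exp (c * t) = 1).
{ rewrite <- exp_plus. replace (- c * t + c * t) with 0 by ring. apply exp_0. }
assert (Hp := exp_pos (c * t)).
replace (Cmod (r t) ^ 2) with (Cmod (r t) ^ 2 * exp (- c * t) * exp (c * t)) by (rewrite Rmult_assoc, E; ring).
apply Rmult_le_compat_r; lra.
Qed.

(** The mean value theorem is applied to the real and imaginary parts separately, whence the factor
    2. *)
Lemma curve_mean_value (u u' : R -> C) l m s t : s <= t ->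
  (forall x, s <= x <= t -> Cder u x (u' x)) ->
  (forall x, s <= x <= t -> Cmod (u' x - l) <= m) ->
  Cmod (u t - u s - l * RtoC (t - s)) <= 2 * m * (t - s).
Proof.
intros Hst Hd Hm.
assert (P : forall (f f' : R -> R) k, (forall x, s <= x <= t -> is_derive f x (f' x)) ->
  (forall x, s <= x <= t -> Rabs (f' x - k) <= m) -> Rabs (f t - f s - k * (t - s)) <= m * (t - s)).
{ intros f f' k Hf Hk. destruct (MVT_gen f s t f') as [c [Hc E]].
  - intros x Hx. apply Hf. rewrite Rmin_left, Rmax_right in Hx; lra.
  - intros x Hx. rewrite Rmin_left, Rmax_right in Hx by lra.
    apply continuity_pt_filterlim, (ex_derive_continuous (V := R_NormedModule)).
    eexists. now apply Hf.
  - rewrite Rmin_left, Rmax_right in Hc by lra. rewrite E.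
    replace (f' c * (t - s) - k * (t - s)) with ((f' c - k) * (t - s)) by ring.
    rewrite Rabs_mult, (Rabs_pos_eq (t - s)) by lra.
    apply Rmult_le_compat_r; [lra|auto]. }
apply Rle_trans with (1 := Cmod_le_ReIm _).
assert (P1 := P (fun s => Re (u s)) (fun s => Re (u' s)) (Re l)
  (fun x Hx => proj1 (Hd x Hx)) (fun x Hx => Rle_trans _ _ _ (re_le_Cmod (u' x - l)%C) (Hm x Hx))).
assert (P2 := P (fun s => Im (u s)) (fun s => Im (u' s)) (Im l)
  (fun x Hx => proj2 (Hd x Hx)) (fun x Hx => Rle_trans _ _ _ (im_le_Cmod (u' x - l)%C) (Hm x Hx))).
replace (Re (u t - u s - l * RtoC (t - s))%C)
  with (Re (u t) - Re (u s) - Re l * (t - s)) by (simpl; unfold Re, Im; ring).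
replace (Im (u t - u s - l * RtoC (t - s))%C)
  with (Im (u t) - Im (u s) - Im l * (t - s)) by (simpl; unfold Re, Im; ring).
lra.
Qed.

(** The solution is the complex exponential of the primitive of g, written out in real and imaginary
    parts. *)
Lemma linear_ode (g : R -> C) : (forall t, Ccont g t) ->
  exists E : R -> C, E 0 = RtoC 1 /\ forall t, Cder E t (g t * E t)%C.
Proof.
intros Hg. set (A := fun t => CInt g 0 t).
exists (fun t => (exp (Re (A t)) * cos (Im (A t)), exp (Re (A t)) * sin (Im (A t)))).
split.
- unfold A. rewrite CInt_point. simpl. rewrite exp_0, cos_0, sin_0.
  unfold RtoC. f_equal; ring.
- intros t. destruct (Cder_CInt g 0 t Hg) as [H1 H2]. fold (A t) in *.
  change (is_derive (fun s => Re (A s)) t (Re (g t))) in H1.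
  change (is_derive (fun s => Im (A s)) t (Im (g t))) in H2.
  split; simpl.
  + evar_last.
    * apply (is_derive_mult (K := R_AbsRing) (fun t => exp (Re (A t))) (fun t => cos (Im (A t)))).
      -- apply (is_derive_comp (V := R_NormedModule) exp (fun t => Re (A t))); [|exact H1].
         apply is_derive_Reals, derivable_pt_lim_exp.
      -- apply (is_derive_comp (V := R_NormedModule) cos (fun t => Im (A t))); [|exact H2].
         apply is_derive_Reals, derivable_pt_lim_cos.
      -- intros; apply Rmult_comm.
    * unfold plus, mult, scal; simpl; unfold mult; simpl. unfold Re, Im. ring.
  + evar_last.
    * apply (is_derive_mult (K := R_AbsRing) (fun t => exp (Re (A t))) (fun t => sin (Im (A t)))).
      -- apply (is_derive_comp (V := R_NormedModule) exp (fun t => Re (A t))); [|exact H1].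
         apply is_derive_Reals, derivable_pt_lim_exp.
      -- apply (is_derive_comp (V := R_NormedModule) sin (fun t => Im (A t))); [|exact H2].
         apply is_derive_Reals, derivable_pt_lim_sin.
      -- intros; apply Rmult_comm.
    * unfold plus, mult, scal; simpl; unfold mult; simpl. unfold Re, Im. ring.
Qed.

Lemma exp_decay_le a s t : 0 <= a -> s <= t -> exp (- (a * t)) <= exp (- (a * s)).
Proof.
intros Ha Hst. destruct (Req_dec (a * t) (a * s)) as [->|Hne]; [lra|].
apply Rlt_le, exp_increasing. assert (a * s <= a * t) by (apply Rmult_le_compat_l; lra). lra.
Qed.

Section Flow.

Variable G : H2.
Hypothesis HG : forall z, Cmod z < 1 ->
  2 * Re (Cconj z * G z)%C + (1 - Cmod z ^ 2) * Re (H2_deriv G z) <= 0.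

Let K := Cmod (G 0).

(* On a ray the hypothesis says that [Re (conj z G (s z)) / (1 - s^2 |z|^2)] decreases in [s]. *)
Lemma radial_bound z : Cmod z < 1 ->
  Re (Cconj z * G z)%C <= (1 - Cmod z ^ 2) * Cmod z * K.
Proof.
intros Hz. assert (Hz0 := Cmod_ge_0 z).
set (x := Cmod z) in *.
set (p := fun s => Re (Cconj z * G (RtoC s * z)%C)%C).
set (d := fun s => 1 - s ^ 2 * x ^ 2).
assert (Hs : forall s, 0 <= s <= 1 -> Cmod (s * z) <= x).
{ intros s Hs. rewrite Cmod_mult, Cmod_R, Rabs_pos_eq by lra. fold x. nra. }
assert (Hd : forall s, 0 <= s <= 1 -> 0 < d s).
{ intros s Hs'. unfold d. assert (s ^ 2 <= 1) by nra. assert (x ^ 2 < 1) by nra.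
  assert (0 <= x ^ 2) by apply pow2_ge_0. nra. }
assert (H : p 1 / d 1 <= p 0 / d 0).
{ apply (derive_nonpos_decr (fun s => p s / d s) (fun s =>
   (Re (Cconj z * (H2_deriv G (s * z) * z)) * d s - p s * (- (2 * s * x ^ 2))) / d s ^ 2)).
  - lra.
  - intros s Hs'. apply (is_derive_div (fun s => p s) (fun s => d s)).
    + assert (Hc : Cder (fun s => (Cconj z * G (s * z))%C) s
        (0 * G (s * z) + Cconj z * (H2_deriv G (s * z) * z))%C).
      { apply (Cder_mult (fun _ => Cconj z) (fun s => G (s * z)%C)); [apply Cder_const|].
        apply (Cder_hol G (H2_deriv G) (fun s => (RtoC s * z)%C)).
        - apply H2_hol.
        - generalize (Hs s Hs'). lra.
        - assert (Hl : Cder (fun s => RtoC s * z)%C s (1 * z + s * 0)%C); [|now ring_simplify (1 * z + s * 0)%C in Hl].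
          apply (Cder_mult (fun s => RtoC s) (fun _ => z)); [|apply Cder_const].
          split; simpl.
          + apply (is_derive_id (K := R_AbsRing)).
          + apply (is_derive_const (V := R_NormedModule)). }
      replace (0 * G (s * z) + Cconj z * (H2_deriv G (s * z) * z))%C
        with (Cconj z * (H2_deriv G (s * z) * z))%C in Hc by ring.
      exact (proj1 Hc).
    + unfold d. auto_derive; trivial. ring.
    + generalize (Hd s Hs'). lra.
  - intros s Hs'.
    apply Rmult_le_reg_r with (d s ^ 2).
    { generalize (Hd s Hs'). intros. apply pow_lt. lra. }
    unfold Rdiv. rewrite Rmult_assoc, Rinv_l, Rmult_0_l, Rmult_1_r.
    2:{ apply pow_nonzero. generalize (Hd s Hs'). lra. }
    (* Multiplied by |z|^2, the hypothesis at s z says that the numerator of the derivative of p / d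
       is nonpositive. *)
    assert (Hk := HG (s * z)%C ltac:(generalize (Hs s Hs'); lra)).
    assert (E1 : Cmod (s * z) ^ 2 = s ^ 2 * x ^ 2).
    { rewrite Cmod_mult, Cmod_R, Rpow_mult_distr, pow2_abs. reflexivity. }
    rewrite E1 in Hk. fold (d s) in Hk.
    assert (E2 : Re (Cconj (s * z) * G (s * z))%C = s * p s).
    { unfold p. simpl. unfold Re, Im. simpl. ring. }
    rewrite E2 in Hk.
    assert (E3 : Re (Cconj z * (H2_deriv G (s * z) * z))%C = x ^ 2 * Re (H2_deriv G (s * z))).
    { unfold x. rewrite Cmod2_alt. simpl. unfold Re, Im. simpl. ring. }
    rewrite E3. assert (0 <= x ^ 2) by apply pow2_ge_0. nra. }
assert (E1 : p 1 = Re (Cconj z * G z)%C).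
{ unfold p. now rewrite Cmult_1_l. }
assert (E0 : p 0 <= x * K).
{ unfold p. rewrite Cmult_0_l. apply Rle_trans with (1 := Re_le_Cmod _).
  rewrite Cmod_mult, Cmod_conj. apply Rle_refl. }
assert (D0 : d 0 = 1) by (unfold d; ring).
assert (D1 : d 1 = 1 - x ^ 2) by (unfold d; ring).
assert (H1 := Hd 1 ltac:(lra)).
rewrite D0, E1, Rdiv_1_r in H. rewrite D1 in H, H1.
apply Rmult_le_reg_r with (/ (1 - x ^ 2)); [now apply Rinv_0_lt_compat|].
replace ((1 - x ^ 2) * x * K * / (1 - x ^ 2)) with (x * K) by (field; lra).
apply Rle_trans with (1 := H). exact E0.
Qed.

Section Extension.

Variable rho : R.
Hypothesis Hrho : 0 < rho < 1.

(** Division by this factor is the radial retraction onto the disc of radius [rho]. *)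
Definition proj_scale (z : C) : R := Rmax 1 (Cmod z / rho).
Definition disc_proj (z : C) : C := (z * RtoC (/ proj_scale z))%C.

Lemma proj_scale_ge1 z : 1 <= proj_scale z.
Proof. apply Rmax_l. Qed.

Lemma Cmod_disc_proj z : Cmod (disc_proj z) = Cmod z / proj_scale z.
Proof.
unfold disc_proj. rewrite Cmod_mult, Cmod_R, Rabs_pos_eq; [reflexivity|].
generalize (proj_scale_ge1 z). intros. apply Rlt_le, Rinv_0_lt_compat. lra.
Qed.

Lemma Cmod_disc_proj_le z : Cmod (disc_proj z) <= rho.
Proof.
rewrite Cmod_disc_proj. assert (H := proj_scale_ge1 z).
apply Rmult_le_reg_r with (proj_scale z); [lra|].
unfold Rdiv. rewrite Rmult_assoc, Rinv_l, Rmult_1_r by lra.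
assert (H1 : Cmod z / rho <= proj_scale z) by apply Rmax_r.
replace (Cmod z) with (rho * (Cmod z / rho)) by (field; lra).
apply Rmult_le_compat_l; lra.
Qed.

Lemma disc_proj_id z : Cmod z <= rho -> disc_proj z = z.
Proof.
intros Hz. unfold disc_proj. replace (proj_scale z) with 1; [rewrite Rinv_1; ring|].
symmetry. apply Rmax_left. apply Rmult_le_reg_r with rho; [lra|].
unfold Rdiv. rewrite Rmult_assoc, Rinv_l; lra.
Qed.

(** With scales m of z and n of w, the difference is (disc_proj z (n - m) + (z - w)) / n. The scale
    has Lipschitz constant 1 / rho, which |disc_proj z| <= rho compensates. *)
Lemma disc_proj_lip z w : Cmod (disc_proj z - disc_proj w) <= 2 * Cmod (z - w).
Proof.
assert (Hm := proj_scale_ge1 z). assert (Hn := proj_scale_ge1 w).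
assert (Hz := Cmod_disc_proj_le z).
set (m := proj_scale z) in *. set (n := proj_scale w) in *.
assert (Nm : RtoC m <> RtoC 0) by (intros E; apply RtoC_inj in E; lra).
assert (Nn : RtoC n <> RtoC 0) by (intros E; apply RtoC_inj in E; lra).
assert (Hmn : Rabs (n - m) <= Cmod (z - w) / rho).
{ assert (H1 := Cmod_triangle_inv z w). assert (H2 := Cmod_triangle_inv w z).
  rewrite (Cmod_minus_sym w z) in H2.
  assert (P : forall a b, a - b <= Cmod (z - w) -> a / rho <= b / rho + Cmod (z - w) / rho).
  { intros a b Hab. replace (b / rho + Cmod (z - w) / rho) with ((b + Cmod (z - w)) / rho) by (field; lra).
    apply Rmult_le_compat_r; [apply Rlt_le, Rinv_0_lt_compat|]; lra. }
  assert (P1 := P _ _ H1). assert (P2 := P _ _ H2).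
  assert (0 <= Cmod (z - w) / rho).
  { apply Rmult_le_pos; [apply Cmod_ge_0|apply Rlt_le, Rinv_0_lt_compat; lra]. }
  apply Rabs_le. unfold m, n, proj_scale, Rmax.
  destruct (Rle_dec 1 (Cmod z / rho)), (Rle_dec 1 (Cmod w / rho)); lra. }
assert (Hin : 0 < / n <= 1).
{ split; [apply Rinv_0_lt_compat; lra|]. rewrite <- Rinv_1. apply Rinv_le_contravar; lra. }
replace (disc_proj z - disc_proj w)%C
  with ((disc_proj z * RtoC (n - m) + (z - w)) * RtoC (/ n))%C.
2:{ unfold disc_proj. fold m n. rewrite !RtoC_inv, RtoC_minus by lra. field. split; trivial. }
rewrite Cmod_mult, Cmod_R, Rabs_pos_eq by lra.
assert (H0 := Cmod_ge_0 (z - w)).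
assert (Hd : Cmod (disc_proj z * RtoC (n - m)) <= Cmod (z - w)).
{ rewrite Cmod_mult, Cmod_R.
  replace (Cmod (z - w)) with (rho * (Cmod (z - w) / rho)) by (field; lra).
  apply Rmult_le_compat; trivial; [apply Cmod_ge_0|apply Rabs_pos]. }
assert (Ht := Cmod_triangle (disc_proj z * RtoC (n - m)) (z - w)).
assert (H4 := Cmod_ge_0 (disc_proj z * RtoC (n - m) + (z - w))).
nra.
Qed.

(* A globally Lipschitz field equal to [G] on [|z| <= rho]; the inward term is strong enough
   to keep [Re (conj z F z) <= K (1 - |z|^2)] on the whole plane. *)
Definition ext_field (z : C) : C := (G (disc_proj z) - 3 * K * (z - disc_proj z))%C.

Lemma ext_field_lip : exists L, 0 < L /\
  forall a b, Cmod (ext_field a - ext_field b) <= L * Cmod (a - b).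
Proof.
destruct (H2_hol G rho ltac:(lra)) as [M HM]. assert (HM0 := C11_ge0 _ _ _ _ HM).
assert (HK : 0 <= K) by apply Cmod_ge_0.
exists (2 * M + 9 * K + 1). split; [lra|]. intros a b. unfold ext_field.
replace (G (disc_proj a) - 3 * K * (a - disc_proj a) - (G (disc_proj b) - 3 * K * (b - disc_proj b)))%C
  with ((G (disc_proj a) - G (disc_proj b))
    - (RtoC (3 * K)) * ((a - b) - (disc_proj a - disc_proj b)))%C by (rewrite RtoC_mult; ring).
apply Rle_trans with (1 := Cmod_minus_le _ _).
assert (H1 := C11_lip _ _ _ _ HM _ _ (Cmod_disc_proj_le a) (Cmod_disc_proj_le b)).
assert (H2 := disc_proj_lip a b). assert (H3 := Cmod_minus_le (a - b) (disc_proj a - disc_proj b)).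
rewrite Cmod_mult, Cmod_R, Rabs_pos_eq by lra.
assert (H4 := Cmod_ge_0 (a - b)).
assert (3 * K * Cmod (a - b - (disc_proj a - disc_proj b)) <= 3 * K * (3 * Cmod (a - b)))
  by (apply Rmult_le_compat_l; lra).
assert (M * Cmod (disc_proj a - disc_proj b) <= M * (2 * Cmod (a - b)))
  by (apply Rmult_le_compat_l; lra).
nra.
Qed.

Lemma ext_field_eq z : Cmod z <= rho -> ext_field z = G z.
Proof. intros Hz. unfold ext_field. rewrite disc_proj_id by trivial. ring. Qed.

Lemma ext_field_inward z : Re (Cconj z * ext_field z)%C <= K * (1 - Cmod z ^ 2).
Proof.
assert (HK : 0 <= K) by apply Cmod_ge_0. assert (Hz := Cmod_ge_0 z).
destruct (Rle_lt_dec (Cmod z) rho) as [H|H].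
- rewrite ext_field_eq by trivial.
  apply Rle_trans with (1 := radial_bound z ltac:(lra)).
  assert (0 <= K * (1 - Cmod z ^ 2)) by (apply Rmult_le_pos; nra). nra.
- set (x := Cmod z) in *. set (w := disc_proj z).
  assert (Em : proj_scale z = x / rho).
  { apply Rmax_right. apply Rmult_le_reg_r with rho; [lra|].
    unfold Rdiv. rewrite Rmult_assoc, Rinv_l; fold x; lra. }
  assert (Hw : Cmod w = rho).
  { unfold w. rewrite Cmod_disc_proj, Em. fold x. field. lra. }
  assert (Ez : z = (RtoC (x / rho) * w)%C).
  { unfold w, disc_proj. rewrite Em.
    transitivity (z * RtoC (x / rho * / (x / rho)))%C.
    - rewrite Rinv_r; [ring|]. intros E. assert (0 < x / rho) by (apply Rdiv_lt_0_compat; lra). lra.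
    - rewrite RtoC_mult. ring. }
  assert (Hr := radial_bound w ltac:(rewrite Hw; lra)). rewrite Hw in Hr.
  assert (E : Re (Cconj z * ext_field z)%C
    = x / rho * Re (Cconj w * G w)%C - 3 * K * (x ^ 2 - x * rho)).
  { unfold ext_field. fold w.
    assert (Ew : Cmod w ^ 2 = rho ^ 2) by now rewrite Hw.
    assert (P : forall (v g : C) (k a : R), Re (Cconj (k * v) * (g - 3 * a * (k * v - v)))%C
      = k * Re (Cconj v * g)%C - 3 * a * (k ^ 2 - k) * Cmod v ^ 2).
    { intros v g k a. rewrite Cmod2_alt. simpl. unfold Re, Im. simpl. ring. }
    rewrite Ez, P, Ew. field. lra. }
  rewrite E.
  assert (H1 : x / rho * Re (Cconj w * G w)%C <= x / rho * ((1 - rho ^ 2) * rho * K)).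
  { apply Rmult_le_compat_l; trivial. apply Rlt_le, Rdiv_lt_0_compat; lra. }
  replace (x / rho * ((1 - rho ^ 2) * rho * K)) with (K * (x * (1 - rho ^ 2))) in H1 by (field; lra).
  (* Put x = rho + d and a = 1 - rho. Right minus left is a^2 rho + d rho^2 + a^2 - a d + 2 d^2. The
     coefficient 3 of the inward term reduces the negative terms to - a d, which the squares
     absorb. *)
  assert (H2 : x * (1 - rho ^ 2) - 3 * (x ^ 2 - x * rho) <= 1 - x ^ 2).
  { set (d := x - rho). replace x with (rho + d) by (unfold d; ring).
    assert (Hd : 0 < d) by (unfold d; lra).
    assert (A1 : 0 <= (1 - rho) ^ 2 * rho) by (apply Rmult_le_pos; [apply pow2_ge_0|lra]).
    assert (A2 : 0 <= d * rho ^ 2) by (apply Rmult_le_pos; [lra|apply pow2_ge_0]).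
    assert (A3 : 0 <= d * rho) by (apply Rmult_le_pos; lra).
    assert (A4 : 0 <= ((1 - rho) - d) ^ 2) by apply pow2_ge_0.
    assert (A5 : 0 <= (1 - rho) ^ 2) by apply pow2_ge_0.
    assert (A6 : 0 <= d ^ 2) by apply pow2_ge_0.
    lra. }
  assert (K * (x * (1 - rho ^ 2) - 3 * (x ^ 2 - x * rho)) <= K * (1 - x ^ 2))
    by (apply Rmult_le_compat_l; lra).
  lra.
Qed.

End Extension.

(** The extended field has global solutions, and [ext_field_inward] gives the lower bound for 1 -
    |u|^2 at all times t >= 0. Up to time T this keeps u in the disc where the field equals G. *)
Lemma local_solution z T : Cmod z < 1 -> 0 <= T -> exists u : R -> C,
  u 0 = z /\ forall t, 0 <= t <= T -> Cder u t (G (u t)) /\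
    (1 - Cmod z ^ 2) * exp (- (2 * K * t)) <= 1 - Cmod (u t) ^ 2.
Proof.
intros Hz HT. assert (HK : 0 <= K) by apply Cmod_ge_0. assert (Hz0 := Cmod_ge_0 z).
set (q := (1 - Cmod z ^ 2) * exp (- (2 * K * T))).
assert (Hz2 : 0 < 1 - Cmod z ^ 2) by nra.
assert (Hq : 0 < q) by (apply Rmult_lt_0_compat; [trivial|apply exp_pos]).
(* [q] is the lower bound at time T, and this choice gives 1 - rho^2 <= q. *)
set (rho := 1 - Rmin (1 / 2) (q / 2)).
assert (Hr1 : 0 < Rmin (1 / 2) (q / 2)) by (apply Rmin_glb_lt; lra).
assert (Hr2 : Rmin (1 / 2) (q / 2) <= 1 / 2) by apply Rmin_l.
assert (Hr3 : Rmin (1 / 2) (q / 2) <= q / 2) by apply Rmin_r.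
assert (Hrho : 0 < rho < 1) by (unfold rho; lra).
assert (Hrq : 1 - rho ^ 2 <= q) by (unfold rho; nra).
destruct (ext_field_lip rho Hrho) as [L [HL HF]].
destruct (picard (ext_field rho) L z HL HF) as [u [Hu0 Hu]].
exists u. split; trivial.
assert (Hd : forall t, 0 <= t -> Cder u t (ext_field rho (u t))).
{ intros t Ht. generalize (Hu t). now rewrite Rmax_left. }
assert (Hy : forall t, 0 <= t -> 1 - Cmod z ^ 2 <= (1 - Cmod (u t) ^ 2) * exp (2 * K * t)).
{ intros t Ht.
  assert (H : - ((1 - Cmod (u t) ^ 2) * exp (2 * K * t)) <= - ((1 - Cmod (u 0) ^ 2) * exp (2 * K * 0))).
  { apply (derive_nonpos_decr (fun t => - ((1 - Cmod (u t) ^ 2) * exp (2 * K * t)))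
     (fun t => - ((0 - 2 * Re (Cconj (u t) * ext_field rho (u t))%C) * exp (2 * K * t)
        + (1 - Cmod (u t) ^ 2) * (2 * K * exp (2 * K * t))))); trivial.
    - intros x Hx. apply (is_derive_opp (V := R_NormedModule) (fun t => (1 - Cmod (u t) ^ 2) * exp (2 * K * t))).
      apply (is_derive_mult (K := R_AbsRing) (fun t => 1 - Cmod (u t) ^ 2) (fun t => exp (2 * K * t))).
      + apply (is_derive_minus (V := R_NormedModule) (fun _ => 1) (fun t => Cmod (u t) ^ 2)).
        * apply (is_derive_const (V := R_NormedModule)).
        * apply is_derive_Cmod2, Hd. lra.
      + auto_derive; trivial. ring.
      + intros; apply Rmult_comm.
    - intros x Hx. assert (Hi := ext_field_inward rho Hrho (u x)).
      assert (He := exp_pos (2 * K * x)). nra. }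
  rewrite Hu0, Rmult_0_r, exp_0 in H. lra. }
assert (Hexp : forall t, exp (2 * K * t) * exp (- (2 * K * t)) = 1).
{ intros t. rewrite <- exp_plus, Rplus_opp_r. apply exp_0. }
assert (Hyt : forall t, 0 <= t -> (1 - Cmod z ^ 2) * exp (- (2 * K * t)) <= 1 - Cmod (u t) ^ 2).
{ intros t Ht. assert (H := Hy t Ht). assert (E := Hexp t). assert (He := exp_pos (- (2 * K * t))).
  replace (1 - Cmod (u t) ^ 2)
    with ((1 - Cmod (u t) ^ 2) * exp (2 * K * t) * exp (- (2 * K * t))) by (rewrite Rmult_assoc, E; ring).
  apply Rmult_le_compat_r; lra. }
intros t Ht. split; [|apply Hyt; lra].
rewrite <- (ext_field_eq rho Hrho); [apply Hd; lra|].
apply Cmod_le_sq; [lra|].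
assert (H := Hyt t ltac:(lra)).
assert (Hm := exp_decay_le (2 * K) t T ltac:(lra) ltac:(lra)).
assert (q <= (1 - Cmod z ^ 2) * exp (- (2 * K * t))) by (apply Rmult_le_compat_l; lra).
lra.
Qed.

(** Gronwall for the difference of two solutions. The constant precedes the curves, so that it gives
    uniqueness and also Lipschitz dependence of the flow on the initial value. *)
Lemma solution_lip r T : r < 1 -> exists M, 0 <= M /\ forall u v : R -> C,
  (forall t, 0 <= t <= T -> Cder u t (G (u t)) /\ Cmod (u t) <= r) ->
  (forall t, 0 <= t <= T -> Cder v t (G (v t)) /\ Cmod (v t) <= r) ->
  forall t, 0 <= t <= T -> Cmod (u t - v t) <= M * Cmod (u 0 - v 0).
Proof.
intros Hr. destruct (H2_hol G r Hr) as [M HM]. assert (HM0 := C11_ge0 _ _ _ _ HM).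
exists (exp ((2 * M + 1) * Rabs T)). split; [apply Rlt_le, exp_pos|].
intros u v Hu Hv t Ht.
assert (H := gronwall (fun t => u t - v t)%C (fun t => G (u t) - G (v t))%C M 0 T HM0
  (fun t Ht => Cder_minus _ _ _ _ _ (proj1 (Hu t Ht)) (proj1 (Hv t Ht)))).
assert (H1 : Cmod (u t - v t) ^ 2 <= (Cmod (u 0 - v 0) ^ 2 + 0 ^ 2 * t) * exp ((2 * M + 1) * t)).
{ apply H; trivial. intros s Hs. rewrite Rplus_0_r. apply (C11_lip _ _ _ _ HM); [apply Hu|apply Hv]; trivial. }
apply Cmod_le_sq.
- apply Rmult_le_pos; [apply Rlt_le, exp_pos|apply Cmod_ge_0].
- rewrite Rpow_mult_distr, Rmult_comm. apply Rle_trans with (1 := H1).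
  replace (Cmod (u 0 - v 0) ^ 2 + 0 ^ 2 * t) with (Cmod (u 0 - v 0) ^ 2) by ring.
  apply Rmult_le_compat_l; [apply pow2_ge_0|].
  replace (exp ((2 * M + 1) * Rabs T) ^ 2) with (exp ((2 * M + 1) * (2 * Rabs T))).
  + destruct (Req_dec t (2 * Rabs T)) as [<-|Hne]; [lra|].
    assert (H2 := Rle_abs T). apply Rlt_le, exp_increasing. nra.
  + simpl. rewrite Rmult_1_r, <- exp_plus. f_equal. ring.
Qed.

Lemma solution_unique u v r T : r < 1 ->
  (forall t, 0 <= t <= T -> Cder u t (G (u t)) /\ Cmod (u t) <= r) ->
  (forall t, 0 <= t <= T -> Cder v t (G (v t)) /\ Cmod (v t) <= r) ->
  u 0 = v 0 -> forall t, 0 <= t <= T -> u t = v t.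
Proof.
intros Hr Hu Hv E t Ht. destruct (solution_lip r T Hr) as [M [HM H]].
apply eq_of_Cmod_le_eps. intros e He.
apply Rle_trans with (1 := H u v Hu Hv t Ht). rewrite E.
replace (v 0 - v 0)%C with (RtoC 0) by ring. rewrite Cmod_0. lra.
Qed.

Lemma trap_radius r T : r < 1 -> exists r', r' < 1 /\ forall z w t,
  Cmod z <= r -> 0 <= t <= T ->
  (1 - Cmod z ^ 2) * exp (- (2 * K * t)) <= 1 - Cmod w ^ 2 -> Cmod w <= r'.
Proof.
intros Hr. set (r0 := Rmax r 0).
assert (Hr0 : 0 <= r0 < 1) by (split; [apply Rmax_r|apply Rmax_lub_lt; lra]).
assert (HK : 0 <= K) by apply Cmod_ge_0.
set (q := (1 - r0 ^ 2) * exp (- (2 * K * Rabs T))).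
assert (Hq : 0 < q) by (apply Rmult_lt_0_compat; [nra|apply exp_pos]).
(* With m = min(1, q), the square of 1 - m/2 is at least 1 - m >= 1 - q >= |w|^2. *)
exists (1 - Rmin 1 q / 2).
assert (H1 : 0 < Rmin 1 q) by (apply Rmin_glb_lt; lra).
assert (H2 := Rmin_l 1 q). assert (H3 := Rmin_r 1 q).
split; [lra|]. intros z w t Hz Ht Hw.
assert (Hz0 := Cmod_ge_0 z). assert (Hzr : Cmod z <= r0) by (apply Rle_trans with (1 := Hz); apply Rmax_l).
apply Cmod_le_sq; [lra|].
assert (Hqt : q <= (1 - Cmod z ^ 2) * exp (- (2 * K * t))).
{ apply Rmult_le_compat; [nra|apply Rlt_le, exp_pos|nra|].
  apply exp_decay_le; [lra|]. generalize (Rle_abs T). lra. }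
nra.
Qed.

Definition flow_curve (z : C) (u : R -> C) : Prop :=
  u 0 = z /\ forall t, 0 <= t -> Cder u t (G (u t)) /\
    (1 - Cmod z ^ 2) * exp (- (2 * K * t)) <= 1 - Cmod (u t) ^ 2.

Lemma flow_curve_exists z : Cmod z < 1 -> exists u, flow_curve z u.
Proof.
intros Hz.
destruct (choice (fun T u => u 0 = z /\ forall t, 0 <= t <= Rmax T 0 -> Cder u t (G (u t)) /\
    (1 - Cmod z ^ 2) * exp (- (2 * K * t)) <= 1 - Cmod (u t) ^ 2)) as [U HU].
{ intros T. apply local_solution; [trivial|apply Rmax_r]. }
assert (Huniq : forall T1 T2 t, 0 <= t -> t <= T1 -> t <= T2 -> U T1 t = U T2 t).
{ intros T1 T2 t Ht H1 H2. destruct (trap_radius (Cmod z) t Hz) as [r' [Hr' Htr]].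
  apply (solution_unique (U T1) (U T2) r' t Hr'); [| |now rewrite (proj1 (HU T1)), (proj1 (HU T2))|lra].
  - intros s Hs. assert (Hs1 : 0 <= s <= Rmax T1 0) by (split; [|apply Rle_trans with (2 := Rmax_l _ _)]; lra).
    split; [now apply (proj2 (HU T1))|]. apply (Htr z _ s); [lra|lra|now apply (proj2 (HU T1))].
  - intros s Hs. assert (Hs1 : 0 <= s <= Rmax T2 0) by (split; [|apply Rle_trans with (2 := Rmax_l _ _)]; lra).
    split; [now apply (proj2 (HU T2))|]. apply (Htr z _ s); [lra|lra|now apply (proj2 (HU T2))]. }
(* [U T] solves the equation on [0, T]. The margin 1 keeps s below the end of the interval used, and
   by uniqueness the pieces agree where they overlap. *)
exists (fun s => U (Rmax s 0 + 1) s). split.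
- apply HU.
- intros t Ht. rewrite (Rmax_left t 0) by trivial.
  assert (Ht1 : forall T, t <= T -> 0 <= t <= Rmax T 0).
  { intros T HT. split; trivial. apply Rle_trans with (1 := HT), Rmax_l. }
  split; [|apply (proj2 (HU (t + 1))), Ht1; lra].
  (* A neighbourhood of 0 contains negative times, where uniqueness says nothing; there the
     definition itself reads [U (0 + 1)]. Near t > 0 everything is compared with [U (t + 2)]. *)
  destruct (Req_dec t 0) as [->|Hne].
  + apply (Cder_ext_loc (U (0 + 1))); [|apply (proj2 (HU (0 + 1))), Ht1; lra].
    exists (mkposreal 1 Rlt_0_1). intros y Hy. change (Rabs (y - 0) < 1) in Hy.
    apply Rabs_def2 in Hy. destruct (Rle_lt_dec 0 y) as [H|H].
    * rewrite (Rmax_left y 0) by trivial. apply Huniq; lra.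
    * rewrite (Rmax_right y 0) by lra. reflexivity.
  + rewrite (Huniq (t + 1) (t + 2) t) by lra.
    apply (Cder_ext_loc (U (t + 2))); [|apply (proj2 (HU (t + 2))), Ht1; lra].
    assert (Hp : 0 < Rmin t 1) by (apply Rmin_glb_lt; lra).
    exists (mkposreal _ Hp). intros y Hy. change (Rabs (y - t) < Rmin t 1) in Hy.
    assert (H1 := Rmin_l t 1). assert (H2 := Rmin_r t 1).
    apply Rabs_def2 in Hy. rewrite (Rmax_left y 0) by lra. apply Huniq; lra.
Qed.

End Flow.

(** * The flow *)

(** Interface between the differential equation and the operators; the trap radius and the Lipschitz
    constant are uniform for times in [0, T]. *)
Record is_flow (G : H2) (phi phi' : R -> C -> C) : Prop := {
  flow_0 : forall z, Cmod z < 1 -> phi 0 z = z;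
  flow_Cder : forall z t, Cmod z < 1 -> 0 <= t ->
    Cder (fun s => phi s z) t (G (phi t z));
  flow_trap : forall r T, r < 1 -> exists r', r' < 1 /\
    forall z t, Cmod z <= r -> 0 <= t <= T -> Cmod (phi t z) <= r';
  flow_plus : forall s t z, 0 <= s -> 0 <= t -> Cmod z < 1 ->
    phi (t + s) z = phi t (phi s z);
  flow_hol : forall t, 0 <= t -> hol (phi t) (phi' t);
  flow_lip : forall r T, r < 1 -> exists M, 0 <= M /\
    forall a b t, Cmod a <= r -> Cmod b <= r -> 0 <= t <= T ->
      Cmod (phi t a - phi t b) <= M * Cmod (a - b)
}.

Lemma Cder_shift u s t l : Cder u (t + s) l -> Cder (fun x => u (x + s)) t l.
Proof.
assert (P : forall (g : R -> R) k, is_derive g (t + s) k -> is_derive (fun x => g (x + s)) t k).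
{ intros g k Hg. evar_last.
  - apply (is_derive_comp (V := R_NormedModule) g (fun x => x + s)); [exact Hg|].
    apply (is_derive_plus (V := R_NormedModule) (fun x => x) (fun _ => s)).
    + apply (is_derive_id (K := R_AbsRing)).
    + apply (is_derive_const (V := R_NormedModule)).
  - unfold scal, plus, one, zero; simpl; unfold mult; simpl. ring. }
intros [H1 H2].
split; [apply (P (fun y => Re (u y)))|apply (P (fun y => Im (u y)))]; assumption.
Qed.

Lemma flow_exists (G : H2) :
  (forall z, Cmod z < 1 ->
    2 * Re (Cconj z * G z)%C + (1 - Cmod z ^ 2) * Re (H2_deriv G z) <= 0) ->
  exists phi phi', is_flow G phi phi'.
Proof.
intros HG.
destruct (choice (fun z u => Cmod z < 1 -> flow_curve G z u)) as [P HP].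
{ intros z. destruct (Rlt_dec (Cmod z) 1) as [H|H].
  - destruct (flow_curve_exists G HG z H) as [u Hu]. now exists u.
  - exists (fun _ => RtoC 0). tauto. }
assert (F0 : forall z, Cmod z < 1 -> P z 0 = z) by (intros z Hz; apply (HP z Hz)).
assert (F1 : forall z t, Cmod z < 1 -> 0 <= t -> Cder (P z) t (G (P z t))).
{ intros z t Hz Ht. now apply (proj2 (HP z Hz)). }
assert (F2 : forall r T, r < 1 -> exists r', r' < 1 /\
    forall z t, Cmod z <= r -> 0 <= t <= T -> Cmod (P z t) <= r').
{ intros r T Hr. destruct (trap_radius G r T Hr) as [r' [Hr' H]]. exists r'. split; trivial.
  intros z t Hz Ht. apply (H z _ t Hz Ht). apply (proj2 (HP z ltac:(lra))). lra. }
assert (Fd : forall z t, Cmod z < 1 -> 0 <= t -> Cmod (P z t) < 1).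
{ intros z t Hz Ht. destruct (F2 (Cmod z) t Hz) as [r' [Hr' H]].
  generalize (H z t (Rle_refl _) ltac:(lra)). lra. }
assert (F3 : forall s t z, 0 <= s -> 0 <= t -> Cmod z < 1 -> P z (t + s) = P (P z s) t).
{ intros s t z Hs Ht Hz.
  destruct (F2 (Cmod z) (t + s) Hz) as [r1 [Hr1 H1]].
  destruct (F2 (Cmod (P z s)) t (Fd z s Hz Hs)) as [r2 [Hr2 H2]].
  apply (solution_unique G (fun x => P z (x + s)) (P (P z s)) (Rmax r1 r2) t).
  - now apply Rmax_lub_lt.
  - intros x Hx. split.
    + apply Cder_shift, F1; lra.
    + apply Rle_trans with (2 := Rmax_l _ _). apply H1; lra.
  - intros x Hx. split.
    + apply F1; [auto|lra].
    + apply Rle_trans with (2 := Rmax_r _ _). apply H2; lra.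
  - rewrite Rplus_0_l, F0; auto.
  - lra. }
assert (F5 : forall r T, r < 1 -> exists M, 0 <= M /\
    forall a b t, Cmod a <= r -> Cmod b <= r -> 0 <= t <= T ->
      Cmod (P a t - P b t) <= M * Cmod (a - b)).
{ intros r T Hr. destruct (F2 r T Hr) as [r' [Hr' Htr]].
  destruct (solution_lip G r' T Hr') as [M [HM HMl]]. exists M. split; trivial.
  intros a b t Ha Hb Ht. rewrite <- (F0 a), <- (F0 b) at 2 by lra.
  apply HMl; trivial; intros s Hs; (split; [apply F1; lra|now apply Htr]). }
(* The derivative of the flow solves the linearized equation. *)
destruct (choice (fun z E => Cmod z < 1 -> E 0 = RtoC 1 /\
  forall t, 0 <= t -> Cder E t (H2_deriv G (P z t) * E t)%C)) as [Q HQ].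
{ intros z. destruct (Rlt_dec (Cmod z) 1) as [Hz|Hz].
  - destruct (linear_ode (fun s => H2_deriv G (P z (Rmax s 0)))) as [E [HE0 HE]].
    + intros t. apply (Ccont_Rmax0 (fun s => H2_deriv G (P z s))). clear t.
      intros t Ht. apply (Ccont_hol' G _ (P z)); [apply H2_hol|auto|].
      eapply Cder_cont. now apply F1.
    + exists E. intros _. split; trivial. intros t Ht.
      generalize (HE t). now rewrite (Rmax_left t 0).
  - exists (fun _ => RtoC 0). tauto. }
exists (fun t z => P z t), (fun t z => Q z t).
split; auto.
intros T HT r0 Hr0. set (r := Rmax r0 0).
assert (Hr : r < 1) by (apply Rmax_lub_lt; lra).
destruct (F2 r T Hr) as [r' [Hr' Htr]].
destruct (F5 r T Hr) as [M [HM0 HM]].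
destruct (H2_hol G r' Hr') as [N HN]. assert (HN0 := C11_ge0 _ _ _ _ HN).
set (e := exp ((2 * N + 1) * T)).
assert (He : 1 <= e).
{ unfold e. apply Rle_trans with (exp 0); [rewrite exp_0; lra|]. destruct (Req_dec T 0) as [->|Hne]; [rewrite Rmult_0_r; lra|].
  apply Rlt_le, exp_increasing. nra. }
assert (HNM : 0 <= N * M ^ 2) by (apply Rmult_le_pos; [trivial|apply pow2_ge_0]).
(* The three summands bound the flow, its derivative [Q], and its Taylor remainder in z. *)
set (B := 1 + e + N * M ^ 2 * (T + 1) * e).
assert (HBe : 0 <= N * M ^ 2 * (T + 1) * e).
{ apply Rmult_le_pos; [|lra]. apply Rmult_le_pos; lra. }
exists (3 * B). apply (C11_sub _ (cball r)).
{ intros a Ha. apply Rle_trans with (1 := Ha). apply Rmax_l. }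
apply C11_intro; unfold cball; [intros; lra|unfold B; lra|..].
- intros a Ha. generalize (Htr a T Ha ltac:(lra)). unfold B. lra.
- intros a Ha. destruct (HQ a ltac:(lra)) as [Q0 Q1].
  assert (H := gronwall (Q a) (fun t => H2_deriv G (P a t) * Q a t)%C N 0 T HN0
    (fun t Ht => Q1 t (proj1 Ht))).
  assert (H1 : Cmod (Q a T) ^ 2 <= (Cmod (Q a 0) ^ 2 + 0 ^ 2 * T) * e).
  { apply H; [|lra]. intros t Ht. rewrite Cmod_mult, Rplus_0_r.
    apply Rmult_le_compat_r; [apply Cmod_ge_0|].
    apply (C11_bound' _ _ _ _ HN), Htr; lra. }
  rewrite Q0, Cmod_1 in H1. apply Rle_trans with e; [|unfold B; lra].
  apply Cmod_le_sq; [lra|]. nra.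
- intros a b Ha Hb. destruct (HQ b ltac:(lra)) as [Q0 Q1].
  set (D := Cmod (a - b) ^ 2). assert (HD : 0 <= D) by apply pow2_ge_0.
  (* The Taylor remainder of the flow in z. It vanishes at t = 0, and u' differs from G'(P b t) u by
     the Taylor remainder of G, at most N M^2 D. *)
  set (u := fun t => (P a t - P b t - Q b t * (a - b))%C).
  assert (H := gronwall u (fun t => G (P a t) - G (P b t)
     - (H2_deriv G (P b t) * Q b t * (a - b) + Q b t * 0))%C N (N * M ^ 2 * D) T HN0).
  assert (H1 : Cmod (u T) ^ 2 <= (Cmod (u 0) ^ 2 + (N * M ^ 2 * D) ^ 2 * T) * e).
  { apply H; [| |lra].
    - intros t Ht. apply Cder_minus; [apply Cder_minus; apply F1; lra|].
      apply (Cder_mult (Q b) (fun _ => a - b)%C); [apply Q1; lra|apply Cder_const].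
    - intros t Ht.
      assert (K1 : cball r' (P a t)) by (apply Htr; lra).
      assert (K2 : cball r' (P b t)) by (apply Htr; lra).
      replace (G (P a t) - G (P b t) - (H2_deriv G (P b t) * Q b t * (a - b) + Q b t * 0))%C
        with (H2_deriv G (P b t) * u t
          + (G (P a t) - G (P b t) - H2_deriv G (P b t) * (P a t - P b t)))%C by (unfold u; ring).
      apply Rle_trans with (1 := Cmod_triangle _ _). rewrite Cmod_mult.
      apply Rplus_le_compat.
      + apply Rmult_le_compat_r; [apply Cmod_ge_0|]. now apply (C11_bound' _ _ _ _ HN).
      + apply Rle_trans with (1 := C11_taylor _ _ _ _ HN _ _ K1 K2).
        rewrite Rmult_assoc. apply Rmult_le_compat_l; trivial.
        unfold D. rewrite <- Rpow_mult_distr. apply pow_incr.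
        split; [apply Cmod_ge_0|apply HM; lra]. }
  replace (u 0) with (RtoC 0) in H1.
  2:{ unfold u. rewrite !F0, Q0 by lra. ring. }
  rewrite Cmod_0 in H1.
  (* T + 1 and e dominate the square roots of T and e that the squared form of Gronwall leaves. *)
  apply Rle_trans with (N * M ^ 2 * (T + 1) * e * D).
  + apply Cmod_le_sq; [now apply Rmult_le_pos|].
    apply Rle_trans with (1 := H1).
    set (k := N * M ^ 2) in *.
    assert (0 <= k * D) by (apply Rmult_le_pos; trivial).
    assert (0 <= (k * D) ^ 2) by apply pow2_ge_0.
    replace ((0 ^ 2 + (k * D) ^ 2 * T) * e) with ((k * D) ^ 2 * (T * e)) by ring.
    replace ((k * (T + 1) * e * D) ^ 2) with ((k * D) ^ 2 * ((T + 1) ^ 2 * e ^ 2)) by ring.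
    apply Rmult_le_compat_l; trivial. apply Rmult_le_compat; nra.
  + apply Rmult_le_compat_r; trivial. unfold B. lra.
Qed.

Section FlowProperties.

Variables (G : H2) (phi phi' : R -> C -> C).
Hypothesis Hphi : is_flow G phi phi'.

Lemma flow_disc t z : 0 <= t -> Cmod z < 1 -> Cmod (phi t z) < 1.
Proof.
intros Ht Hz. destruct (flow_trap _ _ _ Hphi (Cmod z) t Hz) as [r' [Hr' H]].
generalize (H z t (Rle_refl _) ltac:(lra)). lra.
Qed.

Lemma flow_time_lip r T : r < 1 -> exists B, 0 <= B /\ forall z s t,
  Cmod z <= r -> 0 <= s <= t -> t <= T -> Cmod (phi t z - phi s z) <= B * (t - s).
Proof.
intros Hr. destruct (flow_trap _ _ _ Hphi r T Hr) as [r' [Hr' Htr]].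
destruct (H2_hol G r' Hr') as [M HM]. assert (HM0 := C11_ge0 _ _ _ _ HM).
exists (2 * M). split; [lra|]. intros z s t Hz Hs Ht.
replace (phi t z - phi s z)%C with (phi t z - phi s z - 0 * RtoC (t - s))%C by ring.
apply (curve_mean_value (fun s => phi s z) (fun s => G (phi s z))).
- lra.
- intros x Hx. apply (flow_Cder _ _ _ Hphi); lra.
- intros x Hx. replace (G (phi x z) - 0)%C with (G (phi x z)) by ring.
  apply (C11_bound _ _ _ _ HM), Htr; lra.
Qed.

(** The relation y = G x' makes y(phi_s z) the time derivative of x(phi_s z), and it is Lipschitz in
    s since y is Lipschitz on the trapping disc. *)
Lemma flow_taylor (x y : H2) r T : r < 1 ->
  (forall z, Cmod z < 1 -> y z = (G z * H2_deriv x z)%C) ->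
  exists B, 0 <= B /\ forall z s t, Cmod z <= r -> 0 <= s <= t -> t <= T ->
    Cmod (x (phi t z) - x (phi s z) - y (phi s z) * RtoC (t - s)) <= B * (t - s) ^ 2.
Proof.
intros Hr Hxy. destruct (flow_trap _ _ _ Hphi r T Hr) as [r' [Hr' Htr]].
destruct (flow_time_lip r T Hr) as [B [HB Hlip]].
destruct (H2_hol y r' Hr') as [M HM]. assert (HM0 := C11_ge0 _ _ _ _ HM).
assert (HMB : 0 <= M * B) by (apply Rmult_le_pos; trivial).
exists (2 * (M * B)). split; [lra|]. intros z s t Hz Hs Ht.
replace (2 * (M * B) * (t - s) ^ 2) with (2 * (M * B * (t - s)) * (t - s)) by ring.
apply (curve_mean_value (fun s => x (phi s z)) (fun s => y (phi s z))).
- lra.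
- intros v Hv. assert (Hd := flow_disc v z ltac:(lra) ltac:(lra)).
  rewrite Hxy by trivial. rewrite Cmult_comm.
  apply (Cder_hol x (H2_deriv x) (fun s => phi s z)); trivial.
  + apply H2_hol.
  + apply (flow_Cder _ _ _ Hphi); lra.
- intros v Hv. apply Rle_trans with (M * Cmod (phi v z - phi s z)).
  + apply (C11_lip _ _ _ _ HM); apply Htr; lra.
  + rewrite Rmult_assoc. apply Rmult_le_compat_l; trivial.
    apply Rle_trans with (1 := Hlip z s v Hz ltac:(lra) ltac:(lra)).
    apply Rmult_le_compat_l; lra.
Qed.

Lemma flow_analytic_semigroup : analytic_semigroup phi.
Proof.
split.
- exact flow_disc.
- intros t z Ht Hz. exists (phi' t z). apply hol_is_derive; trivial.
  now apply (flow_hol _ _ _ Hphi).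
- exact (flow_0 _ _ _ Hphi).
- exact (flow_plus _ _ _ Hphi).
- intros t z Ht Hz. change (Cmod z < 1) in Hz.
  set (r := (1 + Cmod z) / 2). assert (Hr : r < 1) by (unfold r; lra).
  destruct (flow_time_lip r (t + 1) Hr) as [B [HB HBl]].
  destruct (flow_lip _ _ _ Hphi r (t + 1) Hr) as [M [HM HMl]].
  apply (filterlim_locally (U := C_UniformSpace)). intros eps.
  (* The product ball bounds both coordinates of w - z by d, hence |w - z| <= 2 d; this accounts for
     the half of r - |z| and for the 2 M. *)
  set (d := Rmin (Rmin 1 ((r - Cmod z) / 2)) (eps / (2 * (B + 2 * M + 1)))).
  assert (Hd : 0 < d).
  { repeat apply Rmin_glb_lt; [lra|unfold r; lra|]. apply Rdiv_lt_0_compat; [apply cond_pos|lra]. }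
  exists (mkposreal _ Hd). intros [s w] [Hs Hw] [Hs0 Hw0]. simpl in *.
  change (Rabs (s - t) < d) in Hs.
  assert (Hwz : Cmod (w - z) <= 2 * d).
  { destruct Hw as [W1 W2]. change (Rabs (fst w - fst z) < d) in W1. change (Rabs (snd w - snd z) < d) in W2.
    apply Rle_trans with (1 := Cmod_le_ReIm _).
    change (Rabs (fst w - fst z) + Rabs (snd w - snd z) <= 2 * d). lra. }
  assert (D1 : d <= 1) by (eapply Rle_trans; [apply Rmin_l|apply Rmin_l]).
  assert (D2 : d <= (r - Cmod z) / 2) by (eapply Rle_trans; [apply Rmin_l|apply Rmin_r]).
  assert (D3 : d <= eps / (2 * (B + 2 * M + 1))) by apply Rmin_r.
  assert (Hwr : Cmod w <= r) by (generalize (Cmod_triangle_inv w z); lra).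
  assert (Hzr : Cmod z <= r) by (unfold r; lra).
  assert (K1 : Cmod (phi s z - phi t z) <= B * Rabs (s - t)).
  { destruct (Rle_lt_dec t s) as [H|H].
    - rewrite Rabs_pos_eq by lra. apply HBl; trivial; try lra. apply Rabs_def2 in Hs. lra.
    - rewrite Cmod_minus_sym, Rabs_minus_sym, Rabs_pos_eq by lra. apply HBl; lra. }
  assert (K2 : Cmod (phi s w - phi s z) <= M * Cmod (w - z)).
  { apply HMl; trivial. apply Rabs_def2 in Hs. lra. }
  assert (K : Cmod (phi s w - phi t z) < eps).
  { replace (phi s w - phi t z)%C with ((phi s w - phi s z) + (phi s z - phi t z))%C by ring.
    apply Rle_lt_trans with (1 := Cmod_triangle _ _).
    assert (E : eps / (2 * (B + 2 * M + 1)) * (B + 2 * M + 1) = eps / 2) by (field; lra).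
    assert (B * Rabs (s - t) <= B * d) by (apply Rmult_le_compat_l; lra).
    assert (M * Cmod (w - z) <= M * (2 * d)) by (apply Rmult_le_compat_l; lra).
    assert (d * (B + 2 * M + 1) <= eps / (2 * (B + 2 * M + 1)) * (B + 2 * M + 1))
      by (apply Rmult_le_compat_r; lra).
    generalize (cond_pos eps). lra. }
  split.
  + apply Rle_lt_trans with (2 := K). exact (re_le_Cmod (phi s w - phi t z)%C).
  + apply Rle_lt_trans with (2 := K). exact (im_le_Cmod (phi s w - phi t z)%C).
Qed.

End FlowProperties.

(** * The composition semigroup *)

(** Replaces the loss 2^n of [coef_le_sup] on the circle of radius 1/2 by one factor 2^N for all n
    <= N. *)
Lemma two_pow_half_pow n N : (n <= N)%nat -> 1 <= 2 ^ N * (1 / 2) ^ n.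
Proof.
intros Hn. replace N with (n + (N - n))%nat by lia. rewrite pow_add.
replace (2 ^ n * 2 ^ (N - n) * (1 / 2) ^ n) with (2 ^ (N - n) * (2 * (1 / 2)) ^ n)
  by (rewrite Rpow_mult_distr; ring).
replace (2 * (1 / 2)) with 1 by field. rewrite pow1, Rmult_1_r. apply pow_R1_Rle. lra.
Qed.

Lemma H2_fun_minus (f g : H2) z : Cmod z < 1 -> H2_fun (minus f g) z = (f z - g z)%C.
Proof.
intros Hz.
change (CSeries (fun n => (coef f n + - coef g n) * z ^ n)%C
  = (CSeries (fun n => coef f n * z ^ n) - CSeries (fun n => coef g n * z ^ n))%C).
rewrite <- CSeries_minus by now apply Csummable_H2.
apply CSeries_ext. intros n. ring.
Qed.

Lemma H2_fun_scal (k : C) (f : H2) z : Cmod z < 1 -> H2_fun (scal k f) z = (k * f z)%C.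
Proof.
intros Hz.
change (CSeries (fun n => (k * coef f n) * z ^ n)%C
  = (k * CSeries (fun n => coef f n * z ^ n))%C).
rewrite Cmult_comm, <- CSeries_mult_r by now apply Csummable_H2.
apply CSeries_ext. intros n. ring.
Qed.

Lemma H2_fun_plus (f g : H2) z : Cmod z < 1 -> H2_fun (plus f g) z = (f z + g z)%C.
Proof.
intros Hz. assert (H := H2_fun_minus (plus f g) g z Hz).
replace (minus (plus f g) g) with f in H.
- rewrite H. ring.
- apply H2_ext. intros n.
  change (coef f n = (coef f n + coef g n) + - coef g n)%C. ring.
Qed.

Lemma parallelogram (a b : C) :
  Cmod (a - b) ^ 2 = 2 * Cmod a ^ 2 + 2 * Cmod b ^ 2 - Cmod (a + b) ^ 2.
Proof. rewrite !Cmod2_alt. simpl. unfold Re, Im. ring. Qed.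

(* By the parallelogram law, almost-extremal norm and convergence of finitely many
   coefficients force norm convergence. *)
Lemma radon_riesz (f g : H2) N d e : 0 <= d ->
  H2_norm f ^ 2 - e <= Rsum (fun n => Cmod (coef f n) ^ 2) N ->
  (forall n, (n < N)%nat -> Cmod (coef g n - coef f n) <= d) ->
  H2_norm g ^ 2 <= H2_norm f ^ 2 + e ->
  H2_norm (minus g f) ^ 2 <= 6 * e + 4 * H2_norm f * d * INR N.
Proof.
intros Hd He Hn Hg. assert (Hf := H2_norm_ge0 f).
assert (HN : 4 * (H2_norm f ^ 2 - e) - 4 * H2_norm f * d * INR N
  <= Rsum (fun n => Cmod (coef g n + coef f n) ^ 2) N).
{ apply Rle_trans with (4 * Rsum (fun n => Cmod (coef f n) ^ 2) N
    + Rsum (fun _ => - (4 * H2_norm f * d)) N).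
  - assert (E : Rsum (fun _ => - (4 * H2_norm f * d)) N = - (4 * H2_norm f * d) * INR N).
    { clear. induction N as [|N IH]; [simpl; ring|]. rewrite S_INR. simpl. rewrite IH. ring. }
    rewrite E. lra.
  - rewrite <- Rsum_scal, <- Rsum_plus. apply Rsum_le. intros n Hn'.
    assert (H1 := Hn n Hn'). assert (H2 := Cmod_coef_le_norm f n).
    set (a := coef g n) in *. set (b := coef f n) in *.
    assert (H3 : 2 * Cmod b - Cmod (a - b) <= Cmod (a + b)).
    { replace (a + b)%C with (RtoC 2 * b - (b - a))%C by ring.
      rewrite (Cmod_minus_sym a b).
      replace (2 * Cmod b) with (Cmod (RtoC 2 * b)).
      - apply Cmod_triangle_inv.
      - rewrite Cmod_mult, Cmod_R, Rabs_pos_eq; lra. }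
    assert (H4 := Cmod_ge_0 b). assert (H5 := Cmod_ge_0 (a - b)). assert (H6 := Cmod_ge_0 (a + b)).
    assert (H7 : Cmod b * Cmod (a - b) <= H2_norm f * d) by (apply Rmult_le_compat; trivial).
    (* If 2 |b| <= |a - b|, the bound [H3] cannot be squared, but then 4 |b|^2 <= 2 |b| |a - b|
       makes the left-hand side nonpositive. *)
    destruct (Rle_lt_dec (2 * Cmod b) (Cmod (a - b))) as [Hc|Hc]; nra. }
apply H2_norm_sq_le. intros P.
apply Rle_trans with (Rsum (fun n => Cmod (coef (minus g f) n) ^ 2) (N + P)).
{ apply Rsum_incr; [intros; apply pow2_ge_0|lia]. }
assert (E : Rsum (fun n => Cmod (coef (minus g f) n) ^ 2) (N + P)
  + Rsum (fun n => Cmod (coef g n + coef f n) ^ 2) (N + P)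
  = 2 * Rsum (fun n => Cmod (coef g n) ^ 2) (N + P)
  + 2 * Rsum (fun n => Cmod (coef f n) ^ 2) (N + P)).
{ rewrite <- !Rsum_scal, <- !Rsum_plus.
  apply Rsum_ext. intros n. change (coef (minus g f) n) with (coef g n - coef f n)%C.
  rewrite parallelogram. ring. }
(* With F the norm of f, the final bound is 2 (F^2 + e) + 2 F^2 - (4 (F^2 - e) - 4 F d N). *)
assert (K1 := Rsum_incr (fun n => Cmod (coef g n + coef f n) ^ 2) N (N + P)
  (fun n => pow2_ge_0 _) ltac:(lia)).
assert (K2 := Rsum_sqmod_le g (N + P)). assert (K3 := Rsum_sqmod_le f (N + P)).
lra.
Qed.

Lemma Rsum_tail (f : H2) e : 0 < e -> exists N,
  H2_norm f ^ 2 - e <= Rsum (fun n => Cmod (coef f n) ^ 2) N.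
Proof.
intros He.
assert (H := Series_correct _ (coef_summable f)).
assert (Hl : is_lim_seq (sum_n (fun n => Cmod (coef f n) ^ 2)) (H2_norm f ^ 2)).
{ unfold H2_norm. rewrite pow2_sqrt by (apply (Series_sqmod_ge0 (coef f)), coef_summable).
  exact H. }
destruct (proj2 (is_lim_seq_spec _ _) Hl (mkposreal e He)) as [N HN].
exists (S N). rewrite <- Rsum_sum_n. specialize (HN N (le_n N)). simpl in HN.
apply Rabs_def2 in HN. simpl. lra.
Qed.

Definition l2 (N : nat) (c : nat -> C) : R := sqrt (Rsum (fun n => Cmod (c n) ^ 2) N).

Lemma l2_sq N c : l2 N c ^ 2 = Rsum (fun n => Cmod (c n) ^ 2) N.
Proof. apply pow2_sqrt. apply Rsum_pos. intros; apply pow2_ge_0. Qed.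

Lemma l2_triangle N a b : l2 N (fun n => a n + b n)%C <= l2 N a + l2 N b.
Proof.
assert (Ha : 0 <= l2 N a) by apply sqrt_pos. assert (Hb : 0 <= l2 N b) by apply sqrt_pos.
rewrite <- (sqrt_pow2 (l2 N a + l2 N b)) by lra. apply sqrt_le_1_alt.
destruct N as [|N].
- simpl Rsum. apply pow2_ge_0.
- rewrite <- Rsum_sum_n.
  apply (sum_sqmod_minkowski a b); trivial.
  + intros n. apply Cmod_triangle.
  + rewrite l2_sq, Rsum_sum_n. apply Rle_refl.
  + rewrite l2_sq, Rsum_sum_n. apply Rle_refl.
Qed.

Lemma l2_le N a K : 0 <= K -> (forall n, (n < N)%nat -> Cmod (a n) <= K) -> l2 N a <= K * INR N.
Proof.
intros HK H. unfold l2. assert (HN := pos_INR N).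
assert (0 <= K * INR N) by now apply Rmult_le_pos.
rewrite <- (sqrt_pow2 (K * INR N)) by trivial. apply sqrt_le_1_alt.
clear HN H0. induction N as [|N IH]; [simpl; lra|].
assert (IH' := IH (fun n Hn => H n (Nat.lt_lt_succ_r _ _ Hn))).
rewrite S_INR.
change (Rsum (fun n => Cmod (a n) ^ 2) (S N))
  with (Rsum (fun n => Cmod (a n) ^ 2) N + Cmod (a N) ^ 2).
assert (H1 := H N (Nat.lt_succ_diag_r N)). assert (H2 := Cmod_ge_0 (a N)).
assert (H3 := pos_INR N).
assert (Cmod (a N) ^ 2 <= K ^ 2) by (apply pow_incr; lra).
assert (0 <= K * INR N * K) by (apply Rmult_le_pos; [apply Rmult_le_pos|]; trivial). nra.
Qed.

Lemma l2_le_norm N (f : H2) : l2 N (coef f) <= H2_norm f.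
Proof.
unfold l2. rewrite <- (sqrt_pow2 (H2_norm f)) by apply H2_norm_ge0.
apply sqrt_le_1_alt, Rsum_sqmod_le.
Qed.

Lemma l2_scal N k a : l2 N (fun n => k * a n)%C = Cmod k * l2 N a.
Proof.
unfold l2. rewrite <- (sqrt_pow2 (Cmod k)) at 1 by apply Cmod_ge_0.
rewrite <- sqrt_mult_alt by apply pow2_ge_0. f_equal. rewrite <- Rsum_scal.
apply Rsum_ext. intros n. rewrite Cmod_mult. ring.
Qed.

Lemma l2_ext N a b : (forall n, a n = b n) -> l2 N a = l2 N b.
Proof.
intros H. unfold l2. f_equal. apply Rsum_ext. intros n. now rewrite H.
Qed.

Section Semigroup.

Variables (G : H2) (phi phi' : R -> C -> C) (T : R -> H2 -> H2).
Hypothesis Hphi : is_flow G phi phi'.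
Hypothesis HT : forall t f z, 0 <= t -> Cmod z < 1 -> T t f z = f (phi t z).
Hypothesis HTn : forall t f, 0 <= t ->
  H2_norm (T t f) ^ 2 <= (1 + Cmod (phi t 0)) / (1 - Cmod (phi t 0)) * H2_norm f ^ 2.

Lemma comp_bounded tau : exists M, 0 < M /\ forall t f, 0 <= t <= tau ->
  H2_norm (T t f) <= M * H2_norm f.
Proof.
destruct (flow_trap _ _ _ Hphi 0 tau ltac:(lra)) as [r' [Hr' Htr]].
set (M := 2 / (1 - r')).
assert (HM0 : 0 < M) by (apply Rdiv_lt_0_compat; lra).
(* The squared norm ratio is at most M, and M <= (1 + M)^2. *)
exists (1 + M). split; [lra|]. intros t f Ht.
assert (Hf := H2_norm_ge0 f).
assert (H := HTn t f ltac:(lra)).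
assert (H0 := Htr 0%C t ltac:(rewrite Cmod_0; lra) Ht).
assert (H1 := Cmod_ge_0 (phi t 0)). set (x := Cmod (phi t 0)) in *.
assert (HM : (1 + x) / (1 - x) <= M).
{ unfold M, Rdiv. apply Rmult_le_compat; [lra| |lra|].
  - apply Rlt_le, Rinv_0_lt_compat; lra.
  - apply Rinv_le_contravar; lra. }
apply Rsqr_incr_0_var; [|apply Rmult_le_pos; lra].
rewrite !Rsqr_pow2. apply Rle_trans with (1 := H). rewrite Rpow_mult_distr.
apply Rmult_le_compat_r; [apply pow2_ge_0|]. nra.
Qed.

Lemma comp_minus t f g : 0 <= t -> T t (minus f g) = minus (T t f) (T t g).
Proof.
intros Ht. apply H2_fun_inj. intros z Hz. change (Cmod z < 1) in Hz.
assert (Hd := flow_disc _ _ _ Hphi t z Ht Hz).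
rewrite H2_fun_minus, !HT, H2_fun_minus; trivial.
Qed.

(** An instance of [radon_riesz]: the coefficients converge since phi_s(z) - z is of order s on |z|
    = 1/2, and Littlewood's constant is at most 1 + 4 |phi_s(0)| = 1 + O(s). *)
Lemma comp_continuous_0 f e : 0 < e -> exists d, 0 < d /\
  forall s, 0 <= s <= d -> H2_norm (minus (T s f) f) <= e.
Proof.
intros He. assert (Hf := H2_norm_ge0 f).
(* [radon_riesz] returns 6 e1 = e^2 / 2, which leaves e^2 / 2 for the coefficients. *)
set (e1 := e ^ 2 / 12). assert (He1 : 0 < e1) by (unfold e1; nra).
destruct (Rsum_tail f e1 He1) as [N HN].
destruct (flow_time_lip _ _ _ Hphi (1 / 2) 1 ltac:(lra)) as [B [HB Hlip]].
destruct (flow_trap _ _ _ Hphi (1 / 2) 1 ltac:(lra)) as [r' [Hr' Htr]].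
destruct (H2_hol f r' Hr') as [M HM]. assert (HM0 := C11_ge0 _ _ _ _ HM).
assert (HNp := pos_INR N).
set (F := H2_norm f) in *.
assert (H2N : 0 < 2 ^ N) by (apply pow_lt; lra).
set (k1 := 2 ^ N * (M * B)).
assert (Hk1 : 0 <= k1) by (apply Rmult_le_pos; [lra|now apply Rmult_le_pos]).
set (k2 := 4 * F * k1 * INR N).
assert (Hk2 : 0 <= k2).
{ apply Rmult_le_pos; trivial. apply Rmult_le_pos; trivial. lra. }
set (k3 := 4 * B * F ^ 2).
assert (Hk3 : 0 <= k3) by (apply Rmult_le_pos; [lra|apply pow2_ge_0]).
(* In order: times at most 1 for the uniform constants, |phi_s(0)| <= 1/2, coefficient error at most
   e^2 / 2, and excess of the squared norm at most e1. *)
set (d := Rmin (Rmin 1 (1 / (2 * (B + 1)))) (Rmin (e ^ 2 / (2 * (k2 + 1))) (e1 / (k3 + 1)))).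
assert (D1 : d <= 1) by (eapply Rle_trans; [apply Rmin_l|apply Rmin_l]).
assert (D2 : d <= 1 / (2 * (B + 1))) by (eapply Rle_trans; [apply Rmin_l|apply Rmin_r]).
assert (D3 : d <= e ^ 2 / (2 * (k2 + 1))) by (eapply Rle_trans; [apply Rmin_r|apply Rmin_l]).
assert (D4 : d <= e1 / (k3 + 1)) by (eapply Rle_trans; [apply Rmin_r|apply Rmin_r]).
assert (Hd : 0 < d).
{ repeat apply Rmin_glb_lt; try apply Rdiv_lt_0_compat; try lra. nra. }
assert (E2 : 1 / (2 * (B + 1)) * (B + 1) = 1 / 2) by (field; lra).
assert (E3 : e ^ 2 / (2 * (k2 + 1)) * (k2 + 1) = e ^ 2 / 2) by (field; lra).
assert (E4 : e1 / (k3 + 1) * (k3 + 1) = e1) by (field; lra).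
exists d. split; trivial. intros s Hs.
assert (S2 : s * (B + 1) <= 1 / 2) by (rewrite <- E2; apply Rmult_le_compat_r; lra).
assert (S3 : s * (k2 + 1) <= e ^ 2 / 2) by (rewrite <- E3; apply Rmult_le_compat_r; lra).
assert (S4 : s * (k3 + 1) <= e1) by (rewrite <- E4; apply Rmult_le_compat_r; lra).
apply Rsqr_incr_0_var; [|lra]. rewrite !Rsqr_pow2.
assert (K : H2_norm (minus (T s f) f) ^ 2 <= 6 * e1 + 4 * F * (k1 * s) * INR N).
{ apply radon_riesz; trivial.
  - apply Rmult_le_pos; lra.
  - intros n Hn. change (coef (T s f) n - coef f n)%C with (coef (minus (T s f) f) n).
    assert (H := coef_le_sup (minus (T s f) f) (1 / 2) n (M * B * s) ltac:(lra)).
    apply Rmult_le_reg_r with ((1 / 2) ^ n); [apply half_pow_pos|].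
    apply Rle_trans with (M * B * s).
    + apply H. intros z Hz. rewrite H2_fun_minus, HT by lra.
      apply Rle_trans with (M * Cmod (phi s z - z)).
      * assert (E0 : z = phi 0 z) by (now rewrite (flow_0 _ _ _ Hphi) by lra).
        apply (C11_lip _ _ _ _ HM); [|rewrite E0]; apply Htr; lra.
      * rewrite Rmult_assoc. apply Rmult_le_compat_l; trivial.
        assert (Hl := Hlip z 0 s ltac:(lra) ltac:(lra) ltac:(lra)).
        rewrite (flow_0 _ _ _ Hphi) in Hl by lra. now rewrite Rminus_0_r in Hl.
    + unfold k1.
      assert (Hp := two_pow_half_pow n N ltac:(lia)).
      assert (0 <= M * B * s) by (apply Rmult_le_pos; [now apply Rmult_le_pos|lra]).
      replace (2 ^ N * (M * B) * s * (1 / 2) ^ n) with (M * B * s * (2 ^ N * (1 / 2) ^ n)) by ring.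
      nra.
  - apply Rle_trans with (1 := HTn s f ltac:(lra)). fold F.
    assert (Hx : Cmod (phi s 0) <= B * s).
    { assert (Hl := Hlip 0%C 0 s ltac:(rewrite Cmod_0; lra) ltac:(lra) ltac:(lra)).
      rewrite (flow_0 _ _ _ Hphi) in Hl by (rewrite Cmod_0; lra).
      rewrite Rminus_0_r in Hl. now replace (phi s 0 - 0)%C with (phi s 0) in Hl by ring. }
    assert (Hx0 := Cmod_ge_0 (phi s 0)). set (x := Cmod (phi s 0)) in *.
    assert (Hx2 : x <= 1 / 2) by lra.
    assert (Hk : (1 + x) / (1 - x) <= 1 + 4 * x).
    { apply Rmult_le_reg_r with (1 - x); [lra|]. unfold Rdiv. rewrite Rmult_assoc, Rinv_l by lra. nra. }
    assert (HF : 0 <= F ^ 2) by apply pow2_ge_0.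
    apply Rle_trans with ((1 + 4 * x) * F ^ 2); [now apply Rmult_le_compat_r|].
    assert (x * F ^ 2 <= B * s * F ^ 2) by now apply Rmult_le_compat_r.
    unfold k3 in S4. lra. }
apply Rle_trans with (1 := K).
replace (4 * F * (k1 * s) * INR N) with (k2 * s) by (unfold k2; ring).
unfold e1. lra.
Qed.

(** Composition operators multiply in reverse order, so the flow law is used with s and t
    exchanged. *)
Lemma comp_plus s t f : 0 <= s -> 0 <= t -> T (t + s) f = T t (T s f).
Proof.
intros Hs Ht. apply H2_fun_inj. intros z Hz. change (Cmod z < 1) in Hz.
assert (Hd := flow_disc _ _ _ Hphi t z Ht Hz).
rewrite !HT by (trivial; lra). now rewrite Rplus_comm, (flow_plus _ _ _ Hphi).
Qed.

Lemma comp_C0_semigroup : C0_semigroup (X := H2_CompleteNormedModule) T.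
Proof.
split.
- intros t Ht. split.
  + intros f g. apply H2_fun_inj. intros z Hz. change (Cmod z < 1) in Hz.
    assert (Hd := flow_disc _ _ _ Hphi t z Ht Hz).
    rewrite HT by trivial. etransitivity; [apply (H2_fun_plus f g); trivial|].
    symmetry. etransitivity; [apply (H2_fun_plus (T t f) (T t g)); trivial|].
    now rewrite !HT.
  + intros k f. apply H2_fun_inj. intros z Hz. change (Cmod z < 1) in Hz.
    assert (Hd := flow_disc _ _ _ Hphi t z Ht Hz).
    rewrite HT by trivial. etransitivity; [apply (H2_fun_scal k f); trivial|].
    symmetry. etransitivity; [apply (H2_fun_scal k (T t f)); trivial|].
    now rewrite !HT.
  + destruct (comp_bounded t) as [M [HM H]]. exists M. split; trivial.
    intros f. apply (H t f). lra.
- intros f. apply H2_fun_inj. intros z Hz. change (Cmod z < 1) in Hz.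
  rewrite HT by (trivial; lra). now rewrite (flow_0 _ _ _ Hphi).
- intros s t f. apply comp_plus.
- intros t f Ht. apply (filterlim_locally (U := H2_UniformSpace)). intros eps.
  destruct (comp_bounded (t + 1)) as [M [HM HMb]].
  assert (He : 0 < eps / (2 * (M + 1))) by (apply Rdiv_lt_0_compat; [apply cond_pos|lra]).
  destruct (comp_continuous_0 f _ He) as [d [Hd Hdf]].
  assert (Hd1 : 0 < Rmin d 1) by (apply Rmin_glb_lt; lra).
  exists (mkposreal _ Hd1). intros s Hs Hs0. change (Rabs (s - t) < Rmin d 1) in Hs.
  assert (L1 := Rmin_l d 1). assert (L2 := Rmin_r d 1).
  change (H2_norm (minus (T s f) (T t f)) < eps).
  (* T (a + b) f - T a f = T a (T b f - f). Taking a to be the smaller of s and t treats both sides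
     of t with one uniform operator bound. *)
  assert (Hbound : forall a b, 0 <= a <= t + 1 -> 0 <= b <= d ->
    H2_norm (minus (T (a + b) f) (T a f)) < eps).
  { intros a b Ha Hb. rewrite comp_plus, <- comp_minus by lra.
    apply Rle_lt_trans with (1 := HMb a _ Ha).
    assert (E : eps / (2 * (M + 1)) * (M + 1) = eps / 2) by (field; lra).
    assert (H1 := Hdf b Hb). assert (H2 := H2_norm_ge0 (minus (T b f) f)).
    assert (M * H2_norm (minus (T b f) f) <= (M + 1) * (eps / (2 * (M + 1))))
      by (apply Rmult_le_compat; lra).
    generalize (cond_pos eps). lra. }
  apply Rabs_def2 in Hs. destruct (Rle_lt_dec t s) as [H|H].
  + replace s with (t + (s - t)) by ring. apply Hbound; lra.
  + rewrite <- opp_minus, H2_norm_opp. replace t with (s + (t - s)) at 1 by ring.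
    apply Hbound; lra.
Qed.

(* The Taylor remainder in time is quadratic for each coefficient but not in norm, so the
   chain argument runs in the seminorms [l2 N]. *)
Lemma comp_increment (x y : H2) eps t : 0 <= t ->
  (forall z, Cmod z < 1 -> y z = (G z * H2_deriv x z)%C) ->
  (forall s, 0 <= s <= t -> H2_norm (minus (T s y) y) <= eps) ->
  H2_norm (minus (minus (T t x) x) (scal (RtoC t) y)) <= eps * t.
Proof.
intros Ht Hxy Heps.
assert (Heps0 : 0 <= eps).
{ apply Rle_trans with (2 := Heps 0 ltac:(lra)). apply H2_norm_ge0. }
destruct (flow_taylor _ _ _ Hphi x y (1 / 2) t ltac:(lra) Hxy) as [B [HB HBt]].
apply Rsqr_incr_0_var; [|now apply Rmult_le_pos]. rewrite !Rsqr_pow2.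
apply H2_norm_sq_le. intros N.
rewrite <- (l2_sq N (coef _)). apply pow_incr. split; [apply sqrt_pos|].
set (D := fun s s' n => (coef (T s' x) n - coef (T s x) n - RtoC (s' - s) * coef y n)%C).
rewrite (l2_ext N _ (D 0 t)).
2:{ intros n. unfold D. rewrite Rminus_0_r.
    replace (T 0 x) with x.
    - reflexivity.
    - apply H2_fun_inj. intros z Hz. change (Cmod z < 1) in Hz.
      rewrite HT by (trivial; lra). now rewrite (flow_0 _ _ _ Hphi). }
apply (chain_bound (fun s s' => l2 N (D s s')) t eps (2 ^ N * B * INR N)); trivial.
- apply Rmult_le_pos; [|apply pos_INR]. apply Rmult_le_pos; trivial. apply pow_le. lra.
- intros a b c _ _. rewrite (l2_ext N (D a c) (fun n => D a b n + D b c n)%C).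
  + apply l2_triangle.
  + intros n. unfold D. rewrite !RtoC_minus. ring.
- intros s s' Hs Hs'.
  (* [D s s'] splits into (s' - s)(T s y - y), at most eps (s' - s) in norm, and [w], which
     [flow_taylor] bounds quadratically on |z| = 1/2. *)
  set (w := minus (minus (T s' x) (T s x)) (scal (RtoC (s' - s)) (T s y)) : H2).
  rewrite (l2_ext N _ (fun n => RtoC (s' - s) * coef (minus (T s y) y) n + coef w n)%C).
  2:{ intros n. unfold D.
      change (coef w n) with ((coef (T s' x) n + - coef (T s x) n)
        + - (RtoC (s' - s) * coef (T s y) n))%C.
      change (coef (minus (T s y) y) n) with (coef (T s y) n + - coef y n)%C. ring. }
  apply Rle_trans with (1 := l2_triangle _ _ _).
  rewrite l2_scal, Cmod_R, Rabs_pos_eq by lra. apply Rplus_le_compat.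
  + rewrite Rmult_comm. apply Rmult_le_compat_r; [lra|].
    apply Rle_trans with (1 := l2_le_norm _ _). apply Heps. lra.
  + replace (2 ^ N * B * INR N * (s' - s) ^ 2) with (2 ^ N * (B * (s' - s) ^ 2) * INR N) by ring.
    assert (HBs : 0 <= B * (s' - s) ^ 2) by (apply Rmult_le_pos; [trivial|apply pow2_ge_0]).
    assert (H2N : 0 <= 2 ^ N) by (apply pow_le; lra).
    apply l2_le; [now apply Rmult_le_pos|].
    intros n Hn.
    assert (H := coef_le_sup w (1 / 2) n (B * (s' - s) ^ 2) ltac:(lra)).
    apply Rmult_le_reg_r with ((1 / 2) ^ n); [apply half_pow_pos|].
    apply Rle_trans with (B * (s' - s) ^ 2).
    * apply H. intros z Hz. unfold w.
      rewrite !H2_fun_minus, H2_fun_scal, !HT by (trivial; lra).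
      rewrite (Cmult_comm (RtoC (s' - s))). apply HBt; lra.
    * assert (Hp := two_pow_half_pow n N ltac:(lia)).
      replace (2 ^ N * (B * (s' - s) ^ 2) * (1 / 2) ^ n)
        with (B * (s' - s) ^ 2 * (2 ^ N * (1 / 2) ^ n)) by ring.
      nra.
Qed.

End Semigroup.

(** * The generator, and the Schwarz-Pick inequality *)

Lemma hol_deriv_unique f f' g g' z : hol f f' -> hol g g' ->
  (forall w, Cmod w < 1 -> f w = g w) -> Cmod z < 1 -> f' z = g' z.
Proof.
intros Hf Hg Hfg Hz.
rewrite <- (is_C_derive_unique f z (f' z)) by now apply hol_is_derive.
apply is_C_derive_unique.
apply (is_derive_ext_loc (K := C_AbsRing) (V := C_NormedModule) g); [|now apply hol_is_derive].
assert (Hp : 0 < 1 - Cmod z) by lra.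
exists (mkposreal _ Hp). intros y Hy. change (Cmod (y - z) < 1 - Cmod z) in Hy.
symmetry. apply Hfg. generalize (Cmod_triangle_inv y z). lra.
Qed.

Lemma H2_identity : exists e1 : H2, forall z, Cmod z < 1 -> e1 z = z.
Proof.
destruct (H2_of_hol (fun z => z) (fun _ => RtoC 1) hol_id 1) as [e1 [He _]].
- intros r Hr. rewrite (mean_ext _ (fun _ => RtoC (r ^ 2))).
  + rewrite mean_const, re_RtoC. nra.
  + intros t. rewrite <- Cmod2_conj, Cmod_circ by lra. reflexivity.
- now exists e1.
Qed.

Lemma H2_deriv_minus (f g : H2) z : Cmod z < 1 ->
  H2_deriv (minus f g) z = (H2_deriv f z - H2_deriv g z)%C.
Proof.
intros Hz. unfold H2_deriv. rewrite <- CSeries_minus by now apply Csummable_H2_deriv.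
apply CSeries_ext. intros n.
change (coef (minus f g) n) with (coef f n + - coef g n)%C. ring.
Qed.

Lemma H2_deriv_scal (k : C) (f : H2) z : Cmod z < 1 ->
  H2_deriv (scal k f) z = (k * H2_deriv f z)%C.
Proof.
intros Hz. unfold H2_deriv. rewrite Cmult_comm, <- CSeries_mult_r by now apply Csummable_H2_deriv.
apply CSeries_ext. intros n.
change (coef (scal k f) n) with (k * coef f n)%C. ring.
Qed.

Lemma filterlim_at_right_H2 (F : R -> H2) (y : H2) :
  filterlim F (at_right 0) (locally y) <->
  forall e, 0 < e -> exists d, 0 < d /\ forall t, 0 < t < d -> H2_norm (minus (F t) y) < e.
Proof.
rewrite (filterlim_locally (U := H2_UniformSpace)). split.
- intros H e He. destruct (H (mkposreal e He)) as [d Hd].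
  exists d. split; [apply cond_pos|]. intros t Ht. apply (Hd t); [|lra].
  change (Rabs (t - 0) < d). rewrite Rabs_pos_eq; lra.
- intros H eps. destruct (H eps (cond_pos eps)) as [d [Hd Hd']].
  exists (mkposreal d Hd). intros t Ht Ht0. apply Hd'. change (Rabs (t - 0) < d) in Ht.
  rewrite Rabs_pos_eq in Ht; lra.
Qed.

Lemma comp_generator G phi phi' (T : R -> H2 -> H2) : is_flow G phi phi' ->
  (forall t f z, 0 <= t -> Cmod z < 1 -> T t f z = f (phi t z)) ->
  (forall t f, 0 <= t ->
    H2_norm (T t f) ^ 2 <= (1 + Cmod (phi t 0)) / (1 - Cmod (phi t 0)) * H2_norm f ^ 2) ->
  is_generator (X := H2_CompleteNormedModule) (mult_derive G) T.
Proof.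
intros Hphi HT HTn x y. split.
- intros Hxy. apply filterlim_at_right_H2. intros e He.
  destruct (comp_continuous_0 G phi phi' T Hphi HT HTn y (e / 2)) as [d [Hd H]]; [lra|].
  exists d. split; trivial. intros t Ht.
  assert (K := comp_increment G phi phi' T Hphi HT x y (e / 2) t ltac:(lra)).
  assert (K' : H2_norm (minus (minus (T t x) x) (scal (RtoC t) y)) <= e / 2 * t).
  { apply K.
    - intros z Hz. rewrite <- H2_C_derive by trivial. now apply Hxy.
    - intros s Hs. apply H. lra. }
  set (u := minus (minus (T t x) x) (scal (RtoC t) y) : H2) in *.
  apply Rle_lt_trans with (H2_norm (H2_scal (RtoC (/ t)) u)).
  2:{ assert (Hn : H2_norm (H2_scal (RtoC (/ t)) u) = Cmod (RtoC (/ t)) * H2_norm u)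
      by exact (H2_norm_scal (RtoC (/ t)) u).
    rewrite Hn, Cmod_R, Rabs_pos_eq by (apply Rlt_le, Rinv_0_lt_compat; lra).
    apply Rle_lt_trans with (/ t * (e / 2 * t)).
    * apply Rmult_le_compat_l; [apply Rlt_le, Rinv_0_lt_compat; lra|trivial].
    * replace (/ t * (e / 2 * t)) with (e / 2) by (field; lra). lra. }
  right. f_equal. apply H2_ext. intros n.
  change (RtoC (/ t) * (coef (T t x) n + - coef x n) + - coef y n
    = RtoC (/ t) * ((coef (T t x) n + - coef x n) + - (RtoC t * coef y n)))%C.
  rewrite RtoC_inv by lra. field. intros E; apply RtoC_inj in E; lra.
(* Evaluation at z is a bounded functional, so the difference quotients of x(phi_t z) at t = 0 tend
   to y z; by the chain rule they also tend to G z x'(z). *)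
- intros Hlim z Hz. change (Cmod z < 1) in Hz. rewrite H2_C_derive by trivial.
  assert (Hlim' := proj1 (filterlim_at_right_H2 _ _) Hlim). clear Hlim.
  destruct (H2_C11 (Cmod z) Hz) as [K [HK HKf]].
  assert (Hder := Cder_hol x (H2_deriv x) (fun s => phi s z) 0 _ (H2_hol x)
    (flow_disc G phi phi' Hphi 0 z (Rle_refl 0) Hz) (flow_Cder _ _ _ Hphi z 0 Hz (Rle_refl 0))).
  assert (E0 := flow_0 _ _ _ Hphi z Hz). simpl in Hder. rewrite E0 in Hder.
  apply eq_of_Cmod_le_eps. intros e He.
  destruct (Hlim' (e / (2 * (K + 1)))) as [d [Hd Hdt]].
  { apply Rdiv_lt_0_compat; lra. }
  assert (He2 : 0 < e / 2) by lra.
  destruct (proj1 (Cder_iff_eps _ _ _) Hder (mkposreal _ He2)) as [d2 Hd2].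
  set (t := Rmin d d2 / 2).
  assert (Hmin : 0 < Rmin d d2) by (apply Rmin_glb_lt; [trivial|apply cond_pos]).
  assert (L1 := Rmin_l d d2). assert (L2 := Rmin_r d d2).
  assert (Ht : 0 < t < d) by (unfold t; lra).
  specialize (Hdt t Ht).
  specialize (Hd2 t). simpl in Hd2. rewrite E0 in Hd2.
  assert (K2 : Cmod (x (phi t z) - x z - H2_deriv x z * G z * RtoC (t - 0)) <= e / 2 * Rabs (t - 0)).
  { apply Hd2. change (Rabs (t - 0) < d2). rewrite Rabs_pos_eq; unfold t; lra. }
  rewrite Rminus_0_r, Rabs_pos_eq in K2 by lra.
  set (v := minus (scal (RtoC (/ t)) (minus (T t x) x)) y : H2).
  change (H2_norm v < e / (2 * (K + 1))) in Hdt.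
  assert (Ev : v z = (RtoC (/ t) * (x (phi t z) - x z) - y z)%C).
  { unfold v. now rewrite H2_fun_minus, H2_fun_scal, H2_fun_minus, HT by (trivial; lra). }
  assert (K1 : Cmod (v z) <= K * H2_norm v) by (apply (C11_bound _ _ _ _ (HKf v)), Rle_refl).
  assert (Nt : RtoC t <> RtoC 0) by (intros E; apply RtoC_inj in E; lra).
  replace (y z - G z * H2_deriv x z)%C with
    (RtoC (/ t) * (x (phi t z) - x z - H2_deriv x z * G z * t) - v z)%C.
  2:{ rewrite Ev, RtoC_inv by lra. field. trivial. }
  apply Rle_trans with (1 := Cmod_minus_le _ _).
  rewrite Cmod_mult, Cmod_R, Rabs_pos_eq by (apply Rlt_le, Rinv_0_lt_compat; lra).
  assert (K3 : / t * Cmod (x (phi t z) - x z - H2_deriv x z * G z * t) <= e / 2).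
  { apply Rle_trans with (/ t * (e / 2 * t)).
    - apply Rmult_le_compat_l; [apply Rlt_le, Rinv_0_lt_compat; lra|trivial].
    - right. field. lra. }
  assert (E : e / (2 * (K + 1)) * (K + 1) = e / 2) by (field; lra).
  assert (H0 := H2_norm_ge0 v). nra.
Qed.

(** * Self-maps and automorphisms of the disc *)

(** f h - f 0 is the mean of f against h / (zeta - h) on |zeta| = r, hence at most h / (r - h);
    division by h with r = 1 - h and h -> 0 gives the bound. *)
Lemma cauchy_estimate f f' : hol f f' -> (forall z, Cmod z < 1 -> Cmod (f z) <= 1) ->
  Cmod (f' 0) <= 1.
Proof.
intros Hf Hb.
destruct (Hf (1 / 2) ltac:(lra)) as [M HM]. assert (HM0 := C11_ge0 _ _ _ _ HM).
apply le_epsilon. intros e He.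
(* For h <= 1/4 one has h / (1 - 2 h) <= h (1 + 4 h). The Taylor remainder adds M h^2, so the total
   relative error is (4 + M) h. *)
set (h := Rmin (1 / 4) (e / (4 + M))).
assert (Hh : 0 < h) by (apply Rmin_glb_lt; [lra|apply Rdiv_lt_0_compat; lra]).
assert (Hh1 : h <= 1 / 4) by apply Rmin_l.
assert (Hh2 : h * (4 + M) <= e).
{ apply Rle_trans with (e / (4 + M) * (4 + M)).
  - apply Rmult_le_compat_r; [lra|apply Rmin_r].
  - right. field. lra. }
assert (Ch : Cmod h = h) by (rewrite Cmod_R; apply Rabs_pos_eq; lra).
set (r := 1 - h). assert (Hr : 0 < r < 1) by (unfold r; lra).
assert (fc : forall t, Ccont (fun t => f (circ r t)) t).
{ intros t. apply (Ccont_hol_circ f f'); [trivial|lra]. }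
assert (K1 : Cmod (f h - f 0) <= h / (r - h)).
{ rewrite (cauchy_formula f f' r h) by (trivial; rewrite ?Ch; unfold r; lra).
  rewrite <- (mean_value f f' r) by trivial.
  rewrite <- mean_minus; trivial.
  2:{ intros t. apply Ccont_mult; [trivial|]. apply Ccont_kern; rewrite ?Ch; unfold r; lra. }
  apply mean_le.
  - intros t. apply Ccont_minus; trivial. apply Ccont_mult; [trivial|].
    apply Ccont_kern; rewrite ?Ch; unfold r; lra.
  - intros t.
    assert (Hne := circ_minus_neq0 r h ltac:(lra) ltac:(rewrite Ch; unfold r; lra) t).
    assert (Hge := circ_minus_ge r h ltac:(lra) t). rewrite Ch in Hge.
    replace (f (circ r t) * kern r h t - f (circ r t))%C
      with (f (circ r t) * (h / (circ r t - h)))%C by (unfold kern; field; trivial).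
    rewrite Cmod_mult, Cmod_div, Ch by trivial.
    rewrite <- (Rmult_1_l (h / (r - h))).
    apply Rmult_le_compat; [apply Cmod_ge_0| | |].
    + apply Rlt_le, Rdiv_lt_0_compat; [lra|]. unfold r in *. lra.
    + apply Hb. rewrite Cmod_circ; lra.
    + apply Rmult_le_compat_l; [lra|]. apply Rinv_le_contravar; [unfold r; lra|trivial]. }
assert (K2 : Cmod (f h - f 0 - f' 0 * (h - 0)) <= M * Cmod (h - 0) ^ 2).
{ apply (C11_taylor _ _ _ _ HM); unfold cball; [rewrite Ch; lra|rewrite Cmod_0; lra]. }
replace (h - 0)%C with (RtoC h) in K2 by ring. rewrite Ch in K2.
assert (K3 := Cmod_triangle_inv (f' 0 * h) (f h - f 0)).
rewrite (Cmod_minus_sym (f' 0 * h)), Cmod_mult, Ch in K3.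
assert (K4 : h / (r - h) <= h * (1 + 4 * h)).
{ apply Rmult_le_compat_l; [lra|]. apply Rmult_le_reg_r with (r - h); [unfold r; lra|].
  rewrite Rinv_l by (unfold r; lra). unfold r. nra. }
assert (h * (h * (4 + M)) <= h * e) by (apply Rmult_le_compat_l; lra).
apply Rmult_le_reg_r with h; trivial. lra.
Qed.

(** The disc automorphism that sends 0 to w, with inverse [mobius (- w)]. *)
Definition mobius (w z : C) : C := ((z + w) / (1 + Cconj w * z))%C.
Definition mobius' (w z : C) : C := (RtoC (1 - Cmod w ^ 2) / (1 + Cconj w * z) ^ 2)%C.

Section Mobius.

Variable w : C.
Hypothesis Hw : Cmod w < 1.

Lemma mobius_den_ge z : Cmod z <= 1 -> 1 - Cmod w <= Cmod (1 + Cconj w * z).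
Proof.
intros Hz. replace (1 + Cconj w * z)%C with (1 - - (Cconj w * z))%C by ring.
apply Rle_trans with (2 := Cmod_triangle_inv _ _).
rewrite Cmod_opp, Cmod_mult, Cmod_conj, Cmod_1.
assert (Hw0 := Cmod_ge_0 w). assert (Hz0 := Cmod_ge_0 z). nra.
Qed.

Lemma mobius_den_neq0 z : Cmod z <= 1 -> (1 + Cconj w * z)%C <> RtoC 0.
Proof. intros Hz. apply Cmod_gt_0. generalize (mobius_den_ge z Hz). lra. Qed.

Lemma mobius_norm z : Cmod z <= 1 ->
  (1 - Cmod (mobius w z) ^ 2) * Cmod (1 + Cconj w * z) ^ 2 = (1 - Cmod w ^ 2) * (1 - Cmod z ^ 2).
Proof.
intros Hz. assert (Hn := mobius_den_neq0 z Hz).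
assert (Hp : 0 < Cmod (1 + Cconj w * z)) by (now apply Cmod_gt_0).
unfold mobius. rewrite Cmod_div by trivial.
transitivity (Cmod (1 + Cconj w * z) ^ 2 - Cmod (z + w) ^ 2); [field; lra|].
rewrite !Cmod2_alt. simpl. unfold Re, Im. ring.
Qed.

(** Uniform up to the unit circle: in [schwarz_pick] the outer automorphism is applied to values of
    a self-map for which no trapping radius is given. *)
Lemma mobius_C11 : exists M, C11 (cball 1) (mobius w) (mobius' w) M.
Proof.
set (m := 1 - Cmod w). assert (Hm : 0 < m <= 1) by (generalize (Cmod_ge_0 w); unfold m; lra).
assert (Hw0 := Cmod_ge_0 w).
assert (Hinv : 1 <= / m) by (rewrite <- Rinv_1; apply Rinv_le_contravar; lra).
assert (Hw2 : 0 <= 1 - Cmod w ^ 2 <= 1) by nra.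
assert (Hi : forall z, cball 1 z -> Cmod (/ (1 + Cconj w * z)) <= / m).
{ intros z Hz. rewrite Cmod_inv by now apply mobius_den_neq0.
  apply Rinv_le_contravar; [lra|now apply mobius_den_ge]. }
set (k := / m) in *. assert (Hk2 : k <= k ^ 2) by nra. assert (Hk3 : k ^ 2 <= k ^ 3) by nra.
exists (3 * (2 * k ^ 3)). apply C11_intro; unfold cball; trivial.
- lra.
- intros a Ha. unfold mobius, Cdiv. rewrite Cmod_mult.
  apply Rle_trans with (2 * k); [|lra].
  apply Rmult_le_compat; try apply Cmod_ge_0; [|now apply Hi].
  apply Rle_trans with (1 := Cmod_triangle _ _). lra.
- intros a Ha. unfold mobius'.
  assert (Hn := mobius_den_neq0 a Ha).
  replace (RtoC (1 - Cmod w ^ 2) / (1 + Cconj w * a) ^ 2)%C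
    with (RtoC (1 - Cmod w ^ 2) * (/ (1 + Cconj w * a) * / (1 + Cconj w * a)))%C by (field; trivial).
  rewrite !Cmod_mult, Cmod_R, Rabs_pos_eq by lra.
  assert (H1 := Hi a Ha). assert (H2 := Cmod_ge_0 (/ (1 + Cconj w * a))).
  set (y := Cmod (/ (1 + Cconj w * a))) in *.
  assert (y * y <= k ^ 2) by nra. assert (0 <= y * y) by nra. nra.
- intros a b Ha Hb. assert (Na := mobius_den_neq0 a Ha). assert (Nb := mobius_den_neq0 b Hb).
  assert (E : RtoC (1 - Cmod w ^ 2) = (1 - w * Cconj w)%C).
  { rewrite <- Cmod2_conj, RtoC_minus. reflexivity. }
  replace (mobius w a - mobius w b - mobius' w b * (a - b))%C with
    (- (RtoC (1 - Cmod w ^ 2) * Cconj w * (/ (1 + Cconj w * a) * (/ (1 + Cconj w * b)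
       * / (1 + Cconj w * b)))) * ((a - b) * (a - b)))%C.
  2:{ unfold mobius, mobius'. rewrite E. field. split; trivial. }
  rewrite Cmod_mult, Cmod_opp, !Cmod_mult, Cmod_R, Cmod_conj, Rabs_pos_eq by lra.
  replace (Cmod (a - b) * Cmod (a - b)) with (Cmod (a - b) ^ 2) by ring.
  apply Rmult_le_compat_r; [apply pow2_ge_0|].
  assert (H1 := Hi a Ha). assert (H2 := Cmod_ge_0 (/ (1 + Cconj w * a))).
  assert (H3 := Hi b Hb). assert (H4 := Cmod_ge_0 (/ (1 + Cconj w * b))).
  set (x := Cmod (/ (1 + Cconj w * a))) in *. set (y := Cmod (/ (1 + Cconj w * b))) in *.
  assert (Hy : 0 <= y * y <= k * k) by nra.
  assert (Hxy : 0 <= x * (y * y) <= k * (k * k)).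
  { split; [apply Rmult_le_pos; lra|]. apply Rmult_le_compat; lra. }
  assert (Hc : 0 <= (1 - Cmod w ^ 2) * Cmod w <= 1) by nra.
  apply Rle_trans with (1 * (k * (k * k))).
  + apply Rmult_le_compat; lra.
  + assert (0 <= k ^ 3) by nra. lra.
Qed.

Lemma mobius_hol : hol (mobius w) (mobius' w).
Proof.
intros r Hr. destruct mobius_C11 as [M HM]. exists M.
apply C11_sub with (cball 1); trivial. unfold cball. intros; lra.
Qed.

Lemma mobius_le1 z : Cmod z <= 1 -> Cmod (mobius w z) <= 1.
Proof.
intros Hz. assert (E := mobius_norm z Hz).
assert (Hp : 0 < Cmod (1 + Cconj w * z)) by (now apply Cmod_gt_0, mobius_den_neq0).
assert (Hw0 := Cmod_ge_0 w). assert (Hz0 := Cmod_ge_0 z).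
apply Cmod_le_sq; [lra|].
assert (0 <= (1 - Cmod w ^ 2) * (1 - Cmod z ^ 2)) by (apply Rmult_le_pos; nra).
assert (0 <= 1 - Cmod (mobius w z) ^ 2); [|lra].
apply Rmult_le_reg_r with (Cmod (1 + Cconj w * z) ^ 2); [now apply pow_lt|]. lra.
Qed.

Lemma mobius_trap r : r < 1 -> exists r', r' < 1 /\
  forall z, Cmod z <= r -> Cmod (mobius w z) <= r'.
Proof.
intros Hr. set (r0 := Rmax r 0).
assert (Hr0 : 0 <= r0 < 1) by (split; [apply Rmax_r|apply Rmax_lub_lt; lra]).
assert (Hw0 := Cmod_ge_0 w).
set (q := (1 - Cmod w ^ 2) * (1 - r0 ^ 2)).
assert (Hq : 0 < q <= 1).
{ assert (0 < 1 - Cmod w ^ 2 <= 1) by nra. assert (0 < 1 - r0 ^ 2 <= 1) by nra.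
  unfold q. split; [now apply Rmult_lt_0_compat|nra]. }
(* The denominator has modulus at most 2, so 1 - |mobius w z|^2 >= q / 4, while (1 - q/8)^2 >= 1 -
   q/4. *)
exists (1 - q / 8). split; [lra|]. intros z Hz.
assert (Hz0 := Cmod_ge_0 z). assert (Hzr : Cmod z <= r0) by (apply Rle_trans with (1 := Hz), Rmax_l).
assert (E := mobius_norm z ltac:(lra)).
assert (Hd : Cmod (1 + Cconj w * z) <= 2).
{ apply Rle_trans with (1 := Cmod_triangle _ _). rewrite Cmod_1, Cmod_mult, Cmod_conj. nra. }
assert (Hd0 := Cmod_ge_0 (1 + Cconj w * z)).
assert (Hq2 : q <= (1 - Cmod w ^ 2) * (1 - Cmod z ^ 2)) by (apply Rmult_le_compat_l; nra).
assert (H1 := mobius_le1 z ltac:(lra)). assert (H0 := Cmod_ge_0 (mobius w z)).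
apply Cmod_le_sq; [lra|].
set (x := Cmod (mobius w z)) in *. set (y := Cmod (1 + Cconj w * z)) in *.
assert (0 <= 1 - x ^ 2) by nra. assert (y ^ 2 <= 4) by nra.
assert (q <= (1 - x ^ 2) * 4) by nra.
nra.
Qed.

End Mobius.

(* Conjugating by disc automorphisms moves [w] to the origin, where the Cauchy estimate applies. *)
Lemma schwarz_pick (psi : H2) w : Cmod w < 1 -> (forall z, Cmod z < 1 -> Cmod (psi z) < 1) ->
  Cmod (H2_deriv psi w) * (1 - Cmod w ^ 2) ^ 2 <= Cmod (1 - Cconj w * psi w) ^ 2.
Proof.
intros Hw Hpsi.
assert (Hw' : Cmod (- w) < 1) by now rewrite Cmod_opp.
assert (Hin : hol (fun z => psi (mobius w z)) (fun z => H2_deriv psi (mobius w z) * mobius' w z)%C).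
{ apply hol_comp; [apply H2_hol|now apply mobius_hol|now apply mobius_trap]. }
assert (Hmob : forall z, Cmod z < 1 -> Cmod (mobius w z) < 1).
{ intros z Hz. destruct (mobius_trap w Hw (Cmod z) Hz) as [r' [Hr' H]].
  generalize (H z (Rle_refl _)). lra. }
(* Both automorphisms are centred at w, so the composite may move the origin. Its derivative there
   is psi'(w) (1 - |w|^2)^2 / (1 - conj w psi(w))^2, which equals 1 when psi is the identity. *)
assert (Hout : hol (fun z => mobius (- w) (psi (mobius w z)))
  (fun z => mobius' (- w) (psi (mobius w z)) * (H2_deriv psi (mobius w z) * mobius' w z))%C).
{ intros r Hr. destruct (Hin r Hr) as [N HN]. destruct (mobius_C11 _ Hw') as [M HM].
  apply (C11_comp (cball r) (cball 1) (mobius (- w)) (mobius' (- w)) M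
    (fun z => psi (mobius w z)) (fun z => H2_deriv psi (mobius w z) * mobius' w z)%C N); trivial.
  - unfold cball. intros; lra.
  - unfold cball. intros a Ha. apply Rlt_le, Hpsi, Hmob. lra. }
assert (K := cauchy_estimate _ _ Hout).
assert (E0 : mobius w 0 = w).
{ unfold mobius. replace (1 + Cconj w * 0)%C with (RtoC 1) by ring. field. }
assert (E1 : mobius' w 0 = RtoC (1 - Cmod w ^ 2)).
{ unfold mobius'. replace (1 + Cconj w * 0)%C with (RtoC 1) by ring. field. }
cbv beta in K. rewrite E0, E1 in K.
assert (Hpw := Hpsi w Hw).
set (D := (1 - Cconj w * psi w)%C).
assert (ED : (1 + Cconj (- w) * psi w)%C = D) by (unfold D; rewrite Copp_conj; ring).
assert (ND : D <> RtoC 0) by (rewrite <- ED; apply mobius_den_neq0; [trivial|lra]).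
assert (PD : 0 < Cmod D) by (now apply Cmod_gt_0).
assert (Hw0 := Cmod_ge_0 w). assert (Ho : 0 < 1 - Cmod w ^ 2) by nra.
unfold mobius' in K. rewrite Cmod_opp, ED, !Cmod_mult, Cmod_div, Cmod_pow, !Cmod_R, !Rabs_pos_eq in K
  by (try lra; now apply Cpow_nz).
assert (K' : (1 - Cmod w ^ 2) / Cmod D ^ 2 * (Cmod (H2_deriv psi w) * (1 - Cmod w ^ 2)) <= 1).
{ apply K. intros z Hz. apply mobius_le1; [now rewrite Cmod_opp|]. apply Rlt_le, Hpsi, Hmob, Hz. }
assert (P2 : 0 < Cmod D ^ 2) by now apply pow_lt.
apply Rmult_le_reg_r with (/ Cmod D ^ 2); [now apply Rinv_0_lt_compat|].
rewrite Rinv_r by lra. apply Rle_trans with (2 := K'). right. field. lra.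
Qed.

Lemma generator_condition (G : H2) phi (T : R -> H2 -> H2) : analytic_semigroup phi ->
  (forall t (f : H2) z, 0 <= t -> Cmod z < 1 -> T t f z = f (phi t z)) ->
  is_generator (X := H2_CompleteNormedModule) (mult_derive G) T ->
  forall w, Cmod w < 1 ->
    2 * Re (Cconj w * G w)%C + (1 - Cmod w ^ 2) * Re (H2_deriv G w) <= 0.
Proof.
intros Hphi HT Hgen w Hw.
destruct H2_identity as [e1 He1].
assert (He1' : forall z, Cmod z < 1 -> H2_deriv e1 z = RtoC 1).
{ intros z Hz. exact (hol_deriv_unique _ _ _ _ z (H2_hol e1) hol_id He1 Hz). }
(* Since the identity function has image G, [T t e1] represents phi_t itself as an element of the
   Hardy space. *)
assert (HA : mult_derive G e1 G).
{ intros z Hz. change (Cmod z < 1) in Hz. rewrite H2_C_derive, He1' by trivial. ring. }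
assert (Hlim := proj1 (filterlim_at_right_H2 _ _) (proj1 (Hgen e1 G) HA)).
destruct (H2_C11 (Cmod w) Hw) as [K [HK HKf]].
set (o := 1 - Cmod w ^ 2). set (X := Re (H2_deriv G w)). set (Y := Re (Cconj w * G w)%C).
assert (Hw0 := Cmod_ge_0 w). assert (Ho : 0 < o <= 1) by (unfold o; nra).
set (g := Cmod (G w)). assert (Hg : 0 <= g) by apply Cmod_ge_0.
(* The errors are e o^2 from the derivative, 2 o e from the value, and t |c|^2 <= e (g + 1)^2 from
   the second-order term, with o <= 1. *)
assert (Main : forall e, 0 < e <= 1 -> o ^ 2 * X + 2 * o * Y <= e * (3 + (g + 1) ^ 2)).
{ intros e He. destruct (Hlim (e / (K + 1))) as [d [Hd Hdt]].
  { apply Rdiv_lt_0_compat; lra. }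
  (* Below d for the difference quotient, and at most e so that the second-order term in t is an
     error of order e. *)
  set (t := Rmin d e / 2).
  assert (Hmin : 0 < Rmin d e) by (apply Rmin_glb_lt; lra).
  assert (L1 := Rmin_l d e). assert (L2 := Rmin_r d e).
  assert (Ht : 0 < t < d) by (unfold t; lra). assert (Hte : t <= e) by (unfold t; lra).
  specialize (Hdt t Ht).
  set (psi := T t e1) in *.
  set (v := minus (scal (RtoC (/ t)) (minus psi e1)) G : H2).
  change (H2_norm v < e / (K + 1)) in Hdt.
  assert (Nt : RtoC t <> RtoC 0) by (intros E; apply RtoC_inj in E; lra).
  assert (Hpsi : forall z, Cmod z < 1 -> Cmod (psi z) < 1).
  { intros z Hz. assert (Hd' := semi_disc _ Hphi t z ltac:(lra) Hz). change (Cmod (phi t z) < 1) in Hd'.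
    unfold psi. rewrite HT, He1 by (trivial; lra). trivial. }
  assert (SP := schwarz_pick psi w Hw Hpsi).
  set (a := v w). set (b := H2_deriv v w).
  assert (Hve : K * H2_norm v <= e).
  { assert (E : e / (K + 1) * (K + 1) = e) by (field; lra).
    assert (H0 := H2_norm_ge0 v). nra. }
  assert (Ha : Cmod a <= e).
  { apply Rle_trans with (2 := Hve). apply (C11_bound _ _ _ _ (HKf v)), Rle_refl. }
  assert (Hb : Cmod b <= e).
  { apply Rle_trans with (2 := Hve). apply (C11_bound' _ _ _ _ (HKf v)), Rle_refl. }
  assert (Epsi : psi w = (w + t * (G w + a))%C).
  { unfold a, v. rewrite H2_fun_minus, H2_fun_scal, H2_fun_minus, He1, RtoC_inv by (trivial; lra).
    field. trivial. }
  assert (Epsi' : H2_deriv psi w = (1 + t * (H2_deriv G w + b))%C).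
  { unfold b, v. rewrite H2_deriv_minus, H2_deriv_scal, H2_deriv_minus, He1', RtoC_inv by (trivial; lra).
    field. trivial. }
  fold o in SP.
  assert (LB : 1 + t * (X - e) <= Cmod (H2_deriv psi w)).
  { apply Rle_trans with (2 := Re_le_Cmod _). rewrite Epsi'.
    replace (Re (1 + t * (H2_deriv G w + b))%C) with (1 + t * (X + Re b))
      by (unfold X; simpl; unfold Re, Im; ring).
    assert (Hrb := re_le_Cmod b). apply Rplus_le_compat_l, Rmult_le_compat_l; [lra|].
    generalize (Rle_abs (- Re b)). rewrite Rabs_Ropp. lra. }
  set (c := (Cconj w * (G w + a))%C).
  assert (Hc : Cmod c <= g + 1).
  { unfold c. rewrite Cmod_mult, Cmod_conj.
    assert (Hga := Cmod_triangle (G w) a). fold g in Hga. assert (H0 := Cmod_ge_0 (G w + a)). nra. }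
  assert (Hc2 : Y - e <= Re c).
  { replace (Re c) with (Y + Re (Cconj w * a)%C) by (unfold c, Y; simpl; unfold Re, Im; ring).
    assert (H1 := re_le_Cmod (Cconj w * a)). rewrite Cmod_mult, Cmod_conj in H1.
    assert (H2 := Rle_abs (- Re (Cconj w * a)%C)). rewrite Rabs_Ropp in H2.
    assert (H0 := Cmod_ge_0 a). nra. }
  assert (UB : Cmod (1 - Cconj w * psi w) ^ 2 = o ^ 2 - 2 * o * t * Re c + t ^ 2 * Cmod c ^ 2).
  { replace (1 - Cconj w * psi w)%C with (RtoC o - t * c)%C.
    - rewrite !Cmod2_alt. simpl. unfold Re, Im. ring.
    - rewrite Epsi. unfold c, o. rewrite RtoC_minus, <- (Cmod_conj w), Cmod2_conj, Cconj_conj. ring. }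
  rewrite UB in SP.
  assert (S1 : (1 + t * (X - e)) * o ^ 2 <= o ^ 2 - 2 * o * t * Re c + t ^ 2 * Cmod c ^ 2).
  { apply Rle_trans with (2 := SP). apply Rmult_le_compat_r; [apply pow2_ge_0|trivial]. }
  assert (Hcc := Cmod_ge_0 c).
  assert (S2 : Cmod c ^ 2 <= (g + 1) ^ 2) by (apply pow_incr; lra).
  assert (S3 : t * (o ^ 2 * X + 2 * o * Re c) <= t * (e * o ^ 2 + t * (g + 1) ^ 2)).
  { assert (t ^ 2 * Cmod c ^ 2 <= t ^ 2 * (g + 1) ^ 2) by (apply Rmult_le_compat_l; [apply pow2_ge_0|trivial]).
    lra. }
  apply Rmult_le_reg_l in S3; [|lra].
  assert (S4 : o * (Y - e) <= o * Re c) by (apply Rmult_le_compat_l; lra).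
  assert (S5 : t * (g + 1) ^ 2 <= e * (g + 1) ^ 2) by (apply Rmult_le_compat_r; [apply pow2_ge_0|trivial]).
  assert (S6 : e * o ^ 2 <= e * 1) by (apply Rmult_le_compat_l; nra).
  assert (S7 : o * e <= 1 * e) by (apply Rmult_le_compat_r; lra).
  lra. }
assert (Hle : o ^ 2 * X + 2 * o * Y <= 0).
{ apply le_epsilon. intros e He. rewrite Rplus_0_l.
  set (k := 3 + (g + 1) ^ 2). assert (Hk : 0 < k) by (unfold k; generalize (pow2_ge_0 (g + 1)); lra).
  apply Rle_trans with (1 := Main (Rmin 1 (e / k)) ltac:(split; [apply Rmin_glb_lt;
    [lra|now apply Rdiv_lt_0_compat]|apply Rmin_l])).
  fold k. apply Rle_trans with (e / k * k).
  - apply Rmult_le_compat_r; [lra|apply Rmin_r].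
  - right. field. lra. }
apply Rmult_le_reg_l with o; [lra|]. lra.
Qed.

Theorem theorem3p1 (G : H2) :
  generates_composition_C0_semigroup (mult_derive G) <->
  (forall z : C, Cmod z < 1 ->
    2 * Re (Cconj z * G z)%C + (1 - Cmod z ^ 2) * Re (C_derive G z) <= 0).
Proof.
split.
- intros [phi [T [Hphi [_ [HT Hgen]]]]] z Hz. rewrite H2_C_derive by trivial.
  exact (generator_condition G phi T Hphi HT Hgen z Hz).
- intros HG. destruct (flow_exists G) as [phi [phi' Hflow]].
  { intros z Hz. rewrite <- H2_C_derive by trivial. now apply HG. }
  (* Littlewood gives each image only existentially; choosing over pairs (t, f) turns values and
     norm bound into one family of operators, with default f for t < 0. *)
  destruct (choice (fun (p : R * H2) (g : H2) => 0 <= fst p ->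
    (forall z, Cmod z < 1 -> g z = snd p (phi (fst p) z)) /\
    H2_norm g ^ 2 <= (1 + Cmod (phi (fst p) 0)) / (1 - Cmod (phi (fst p) 0)) * H2_norm (snd p) ^ 2))
    as [T HT].
  { intros [t f]. simpl. destruct (Rle_lt_dec 0 t) as [Ht|Ht].
    - destruct (littlewood f (phi t) (phi' t)) as [g Hg].
      + now apply (flow_hol _ _ _ Hflow).
      + intros r Hr. destruct (flow_trap _ _ _ Hflow r t Hr) as [r' [Hr' H]].
        exists r'. split; trivial. intros z Hz. apply H; lra.
      + now exists g.
    - exists f. lra. }
  set (T' := fun t f => T (t, f)).
  assert (H1 : forall t f z, 0 <= t -> Cmod z < 1 -> T' t f z = f (phi t z)).
  { intros t f z Ht. now apply (HT (t, f)). }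
  assert (H2 : forall t f, 0 <= t -> H2_norm (T' t f) ^ 2
    <= (1 + Cmod (phi t 0)) / (1 - Cmod (phi t 0)) * H2_norm f ^ 2).
  { intros t f Ht. now apply (HT (t, f)). }
  exists phi, T'. split; [|split; [|split]].
  + exact (flow_analytic_semigroup G phi phi' Hflow).
  + exact (comp_C0_semigroup G phi phi' T' Hflow H1 H2).
  + exact H1.
  + exact (comp_generator G phi phi' T' Hflow H1 H2).
Qed.
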